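(* Let $n\in\{2,3,4,5,6,7,8,9,10,12,13,16,18,25\}$ (equivalently, $n>1$ is an integer such that $X_0(n)$ has genus $0$), and let $K$ be a field of characteristic $0$ or of characteristic relatively prime to $6n$. Let $t,d$ be indeterminates, and let $\mathcal C_{n,i}(t,d)$ ($1\le i\le m_n$), $k_1,k_2$ and $j_{n,1}(t),j_{n,2}(t)$ be as given in the context. Then the elliptic curves $\mathcal C_{n,i}(t,d)$ are defined over $K(t,d)$ and satisfy: (i) the $j$-invariant of $\mathcal C_{n,k_i}(t,d)$ is $j_{n,i}(t)$ for $i=1,2$; (ii) the elliptic curves $\mathcal C_{n,i}(t,d)$, $1\le i\le m_n$, are pairwise non-isomorphic over $K(t,d)$; (iii) the isogeny class of $\mathcal C_{n,1}(t,d)$ over $K(t,d)$ contains the set $\{[\mathcal C_{n,i}(t,d)]_{K(t,d)}\}_i$; (iv) the partial isogeny graph corresponding to $\{[\mathcal C_{n,i}(t,d)]_{K(t,d)}\}_i$ is the one listed in the context, where each arrow $k\overset{p}{\to}l$ corresponds to a cyclic isogeny $\mathcal C_{n,k}(t,d)\to\mathcal C_{n,l}(t,d)$ of degree $p$ defined over $K(t,d)$.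
   Context: Conventions. $[E]_F$ is the $F$-isomorphism class of $E$; the isogeny class of $E/F$ is the set of $[E']_F$ with $E'$ isogenous to $E$ over $F$. Integers are viewed in $K$. $m_n=2$ for $n=2,3,5,7,13$; $3$ for $n=9,25$; $4$ for $n=4,6,10$; $6$ for $n=8,18$; $8$ for $n=12,16$. Indices $(k_1,k_2)$: $(1,2)$ for $n=2,3,5,7,13$; $(4,2)$ for $n=4$; $(1,4)$ for $n=6,10$; $(3,6)$ for $n=8$; $(1,3)$ for $n=9,25$; $(5,4)$ for $n=12$; $(2,8)$ for $n=16$; $(1,6)$ for $n=18$. (I) Partial isogeny graphs. $n=2,3,5,7,13$: $1\overset n\to2$. $n=9,25$: $1\overset{\sqrt n}\to2\overset{\sqrt n}\to3$. $n=6,10$: $1\overset2\to2$, $1\overset{n/2}\to3$, $3\overset2\to4$, $2\overset{n/2}\to4$. $n=4$: $1\overset2\to2$, $1\overset2\to3$, $4\overset2\to1$. $n=8$: $1\overset2\to2$, $3\overset2\to1$, $1\overset2\to4$, $4\overset2\to5$, $4\overset2\to6$. $n=12$: $1\overset3\to2$, $8\overset2\to2$, $7\overset3\to8$, $1\overset2\to7$, $5\overset2\to1$, $5\overset3\to6$, $6\overset2\to2$, $2\overset2\to4$, $3\overset3\to4$, $1\overset2\to3$. $n=16$: $1\overset2\to3$, $2\overset2\to1$, $1\overset2\to4$, $4\overset2\to5$, $4\overset2\to6$, $6\overset2\to7$, $6\overset2\to8$. $n=18$: $1\overset3\to3$, $1\overset2\to2$, $2\overset3\to4$, $3\overset2\to4$,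 $3\overset3\to5$, $5\overset2\to6$, $4\overset3\to6$. (II) Fricke parameterizations. $j_{2,1}=\frac{(t+256)^3}{t^2}$, $j_{2,2}=\frac{(t+16)^3}{t}$. $j_{3,1}=\frac{(t+27)(t+243)^3}{t^3}$, $j_{3,2}=\frac{(t+27)(t+3)^3}{t}$. $j_{4,1}=\frac{(t^2+256t+4096)^3}{t^4(t+16)}$, $j_{4,2}=\frac{(t^2+16t+16)^3}{t(t+16)}$. $j_{5,1}=\frac{(t^2+250t+3125)^3}{t^5}$, $j_{5,2}=\frac{(t^2+10t+5)^3}{t}$. $j_{6,1}=\frac{(t+12)^3(t^3+252t^2+3888t+15552)^3}{t^6(t+8)^2(t+9)^3}$, $j_{6,2}=\frac{(t+6)^3(t^3+18t^2+84t+24)^3}{t(t+8)^3(t+9)^2}$. $j_{7,1}=\frac{(t^2+13t+49)(t^2+245t+2401)^3}{t^7}$, $j_{7,2}=\frac{(t^2+13t+49)(t^2+5t+1)^3}{t}$. $j_{8,1}=\frac{(t^4+240t^3+2144t^2+3840t+256)^3}{t(t-4)^8(t+4)^2}$, $j_{8,2}=\frac{(t^4-16t^2+16)^3}{t^2(t^2-16)}$. $j_{9,1}=\frac{(t+6)^3(t^3+234t^2+756t+2160)^3}{(t-3)^8(t^3-27)}$, $j_{9,2}=\frac{t^3(t^3-24)^3}{t^3-27}$. $j_{10,1}=\frac{(t^6+236t^5+1440t^4+1920t^3+3840t^2+256t+256)^3}{t^2(t-4)^{10}(t+1)^5}$, $j_{10,2}=\frac{(t^6-4t^5+16t+16)^3}{t^5(t+1)^2(t-4)}$.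 $j_{12,1}=\frac{(t^2+6t-3)^3(t^6+234t^5+747t^4+540t^3-729t^2-486t-243)^3}{t^3(t-3)^{12}(t-1)(t+1)^4(t+3)^3}$, $j_{12,2}=\frac{(t^2-3)^3(t^6-9t^4+3t^2-3)^3}{t^4(t^2-9)(t^2-1)^3}$. $j_{13,1}=\frac{(t^2+5t+13)(t^4+247t^3+3380t^2+15379t+28561)^3}{t^{13}}$, $j_{13,2}=\frac{(t^2+5t+13)(t^4+7t^3+20t^2+19t+1)^3}{t}$. $j_{16,1}=\frac{(t^8+240t^7+2160t^6+6720t^5+17504t^4+26880t^3+34560t^2+15360t+256)^3}{t(t-2)^{16}(t+2)^4(t^2+4)}$, $j_{16,2}=\frac{(t^8-16t^4+16)^3}{t^4(t^4-16)}$. $j_{18,1}=\frac{(t^3+6t^2+4)^3(t^9+234t^8+756t^7+2172t^6+1872t^5+3024t^4+48t^3+3744t^2+64)^3}{t^2(t-2)^{18}(t+1)^9(t^2-t+1)(t^2+2t+4)^2}$, $j_{18,2}=\frac{(t^3-2)^3(t^9-6t^6-12t^3-8)^3}{t^9(t^3-8)(t^3+1)^2}$. $j_{25,1}=\frac{(t^{10}+240t^9+2170t^8+8880t^7+34835t^6+83748t^5+206210t^4+313380t^3+503545t^2+424740t+375376)^3}{(t-1)^{25}(t^4+t^3+6t^2+6t+11)}$, $j_{25,2}=\frac{(t^{10}+10t^8+35t^6-12t^5+50t^4-60t^3+25t^2-60t+16)^3}{t^5+5t^3+5t-11}$. (III) Families: $\mathcal C_{n,i}(t,d):y^2=x^3+d^2\mathcal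 A_{n,i}x+d^3\mathcal B_{n,i}$, with the following polynomials in $t$. $n=2$: $\mathcal A_{2,1}=-27(t+64)(t+256)$, $\mathcal B_{2,1}=-54(t-512)(t+64)^2$; $\mathcal A_{2,2}=-432(t+16)(t+64)$, $\mathcal B_{2,2}=-3456(t-8)(t+64)^2$. $n=3$: $\mathcal A_{3,1}=-3(t+243)(t+27)^3$, $\mathcal B_{3,1}=-2(t+27)^4(t^2-486t-19683)$; $\mathcal A_{3,2}=-243(t+3)(t+27)^3$, $\mathcal B_{3,2}=-1458(t+27)^4(t^2+18t-27)$. $n=4$: $\mathcal A_{4,1}=-432(t^2+16t+256)$, $\mathcal B_{4,1}=3456(t-16)(t+8)(t+32)$; $\mathcal A_{4,2}=-6912(t^2+16t+16)$, $\mathcal B_{4,2}=221184(t+8)(t^2+16t-8)$; $\mathcal A_{4,3}=-432(t^2-224t+256)$, $\mathcal B_{4,3}=3456(t-16)(t^2+544t+256)$; $\mathcal A_{4,4}=-27(t^2+256t+4096)$, $\mathcal B_{4,4}=54(t+32)(t^2-512t-8192)$. $n=5$: $\mathcal A_{5,1}=-27(t^2+22t+125)(t^2+250t+3125)$, $\mathcal B_{5,1}=-54(t^2-500t-15625)(t^2+22t+125)^2$; $\mathcal A_{5,2}=-16875(t^2+10t+5)(t^2+22t+125)$, $\mathcal B_{5,2}=-843750(t^2+4t-1)(t^2+22t+125)^2$. $n=6$: $\mathcal A_{6,1}=-3(t+12)(t^3+252t^2+3888t+15552)$, $\mathcal B_{6,1}=-2(t^2+36t+216)(t^4-504t^3-13824t^2-124416t-373248)$;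 $\mathcal A_{6,2}=-48(t+6)(t^3+18t^2+324t+1944)$, $\mathcal B_{6,2}=-128(t^2+36t+216)(t^4-216t^2-1944t-5832)$; $\mathcal A_{6,3}=-243(t+12)(t^3+12t^2+48t+192)$, $\mathcal B_{6,3}=-1458(t^2+12t+24)(t^4+24t^3+192t^2-4608)$; $\mathcal A_{6,4}=-3888(t+6)(t^3+18t^2+84t+24)$, $\mathcal B_{6,4}=-93312(t^2+12t+24)(t^4+24t^3+192t^2+504t-72)$. $n=7$: $\mathcal A_{7,1}=-27(t^2+13t+49)(t^2+245t+2401)$, $\mathcal B_{7,1}=-54(t^2+13t+49)(t^4-490t^3-21609t^2-235298t-823543)$; $\mathcal A_{7,2}=-64827(t^2+5t+1)(t^2+13t+49)$, $\mathcal B_{7,2}=-6353046(t^2+13t+49)(t^4+14t^3+63t^2+70t-7)$. $n=8$: $\mathcal A_{8,1}=-432(t^4+224t^2+256)$, $\mathcal B_{8,1}=-3456(t^2-24t+16)(t^2+16)(t^2+24t+16)$; $\mathcal A_{8,2}=-432(t^4-240t^3+2144t^2-3840t+256)$, $\mathcal B_{8,2}=-3456(t^2-24t+16)(t^4+528t^3-4000t^2+8448t+256)$; $\mathcal A_{8,3}=-27(t^4+240t^3+2144t^2+3840t+256)$, $\mathcal B_{8,3}=-54(t^2+24t+16)(t^4-528t^3-4000t^2-8448t+256)$; $\mathcal A_{8,4}=-6912(t^4-16t^2+256)$, $\mathcal B_{8,4}=-221184(t^2-32)(t^2-8)(t^2+16)$; $\mathcal A_{8,5}=-6912(t^4-256t^2+4096)$,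 $\mathcal B_{8,5}=-221184(t^2-32)(t^4+512t^2-8192)$; $\mathcal A_{8,6}=-110592(t^4-16t^2+16)$, $\mathcal B_{8,6}=-14155776(t^2-8)(t^4-16t^2-8)$. $n=9$: $\mathcal A_{9,1}=-3(t+6)(t^3+234t^2+756t+2160)$, $\mathcal B_{9,1}=-2(t^6-504t^5-16632t^4-123012t^3-517104t^2-1143072t-1475496)$; $\mathcal A_{9,2}=-243t(t+6)(t^2-6t+36)$, $\mathcal B_{9,2}=-1458(t^2-6t-18)(t^4+6t^3+54t^2-108t+324)$; $\mathcal A_{9,3}=-19683t(t^3-24)$, $\mathcal B_{9,3}=-1062882(t^6-36t^3+216)$. $n=10$: $\mathcal A_{10,1}=-27(t^2+4)(t^6+236t^5+1440t^4+1920t^3+3840t^2+256t+256)$, $\mathcal B_{10,1}=-54(t^2+4t+8)(t^2+22t-4)(t^2+4)^2(t^4-536t^3-264t^2-416t-64)$; $\mathcal A_{10,2}=-432(t^2+4)(t^6-4t^5+240t^4-480t^3+1440t^2-944t+16)$, $\mathcal B_{10,2}=-3456(t^2-2t+2)(t^2+22t-4)(t^2+4)^2(t^4-26t^3+66t^2-536t-4)$; $\mathcal A_{10,3}=-16875(t^2+4)(t^6-4t^5+256t+256)$, $\mathcal B_{10,3}=-843750(t^2-2t-4)(t^2+4t+8)(t^2+4)^2(t^4-8t^3+24t^2-32t-64)$; $\mathcal A_{10,4}=-270000(t^2+4)(t^6-4t^5+16t+16)$, $\mathcal B_{10,4}=-54000000(t^2-2t-4)(t^2-2t+2)(t^2+4)^2(t^4-2t^3-6t^2-8t-4)$.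 $n=12$: $\mathcal A_{12,1}=-48(t^2+3)(t^6+225t^4-405t^2+243)$, $\mathcal B_{12,1}=-128(t^4-24t^3+18t^2-27)(t^4+18t^2-27)(t^4+24t^3+18t^2-27)$; $\mathcal A_{12,2}=-3888(t^2+3)(t^6-15t^4+75t^2+3)$, $\mathcal B_{12,2}=-93312(t^4-6t^2-24t-3)(t^4-6t^2-3)(t^4-6t^2+24t-3)$; $\mathcal A_{12,3}=-768(t^2-3)(t^6-9t^4+243t^2-243)$, $\mathcal B_{12,3}=-8192(t^4+18t^2-27)(t^8-36t^6+270t^4-972t^2+729)$; $\mathcal A_{12,4}=-62208(t^2-3)(t^6-9t^4+3t^2-3)$, $\mathcal B_{12,4}=-5971968(t^4-6t^2-3)(t^8-12t^6+30t^4-36t^2+9)$; $\mathcal A_{12,5}=-3(t^2+6t-3)(t^6+234t^5+747t^4+540t^3-729t^2-486t-243)$, $\mathcal B_{12,5}=-2(t^4+24t^3+18t^2-27)(t^8-528t^7-3996t^6-9504t^5+270t^4+14256t^3-972t^2+729)$; $\mathcal A_{12,6}=-243(t^2+6t-3)(t^6-6t^5+27t^4+60t^3-249t^2+234t-3)$, $\mathcal B_{12,6}=-1458(t^4-6t^2+24t-3)(t^8-12t^6-528t^5+30t^4+3168t^3-3996t^2+1584t+9)$; $\mathcal A_{12,7}=-48(t^2-6t-3)(t^6-234t^5+747t^4-540t^3-729t^2+486t-243)$, $\mathcal B_{12,7}=-128(t^4-24t^3+18t^2-27)(t^8+528t^7-3996t^6+9504t^5+270t^4-14256t^3-972t^2+729)$;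 $\mathcal A_{12,8}=-3888(t^2-6t-3)(t^6+6t^5+27t^4-60t^3-249t^2-234t-3)$, $\mathcal B_{12,8}=-93312(t^4-6t^2-24t-3)(t^8-12t^6+528t^5+30t^4-3168t^3-3996t^2-1584t+9)$. $n=13$: $\mathcal A_{13,1}=-27(t^2+5t+13)(t^2+6t+13)(t^4+247t^3+3380t^2+15379t+28561)$, $\mathcal B_{13,1}=-54(t^2+5t+13)(t^2+6t+13)^2(t^6-494t^5-20618t^4-237276t^3-1313806t^2-3712930t-4826809)$; $\mathcal A_{13,2}=-771147(t^2+5t+13)(t^2+6t+13)(t^4+7t^3+20t^2+19t+1)$, $\mathcal B_{13,2}=-260647686(t^2+5t+13)(t^2+6t+13)^2(t^6+10t^5+46t^4+108t^3+122t^2+38t-1)$. $n=16$: $\mathcal A_{16,1}=-432(t^8+240t^6+2144t^4+3840t^2+256)$, $\mathcal B_{16,1}=-3456(t^4-24t^3+24t^2-96t+16)(t^4+24t^2+16)(t^4+24t^3+24t^2+96t+16)$; $\mathcal A_{16,2}=-27(t^8+240t^7+2160t^6+6720t^5+17504t^4+26880t^3+34560t^2+15360t+256)$, $\mathcal B_{16,2}=-54(t^4+24t^3+24t^2+96t+16)(t^8-528t^7-3984t^6-14784t^5-31648t^4-59136t^3-63744t^2-33792t+256)$; $\mathcal A_{16,3}=-432(t^8-240t^7+2160t^6-6720t^5+17504t^4-26880t^3+34560t^2-15360t+256)$, $\mathcal B_{16,3}=-3456(t^4-24t^3+24t^2-96t+16)(t^8+528t^7-3984t^6+14784t^5-31648t^4+59136t^3-63744t^2+33792t+256)$;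 $\mathcal A_{16,4}=-6912(t^4-4t^3+8t^2+16t+16)(t^4+4t^3+8t^2-16t+16)$, $\mathcal B_{16,4}=-221184(t^2-4t-4)(t^2+4t-4)(t^4+16)(t^4+24t^2+16)$; $\mathcal A_{16,5}=-6912(t^4-16t^3+8t^2+64t+16)(t^4+16t^3+8t^2-64t+16)$, $\mathcal B_{16,5}=-221184(t^2-4t-4)(t^2+4t-4)(t^8+528t^6-4000t^4+8448t^2+256)$; $\mathcal A_{16,6}=-110592(t^8-16t^4+256)$, $\mathcal B_{16,6}=-14155776(t^4-32)(t^4-8)(t^4+16)$; $\mathcal A_{16,7}=-110592(t^8-256t^4+4096)$, $\mathcal B_{16,7}=-14155776(t^4-32)(t^8+512t^4-8192)$; $\mathcal A_{16,8}=-1769472(t^8-16t^4+16)$, $\mathcal B_{16,8}=-905969664(t^4-8)(t^8-16t^4-8)$. $n=18$: $\mathcal A_{18,1}=-3(t^3+6t^2+4)(t^9+234t^8+756t^7+2172t^6+1872t^5+3024t^4+48t^3+3744t^2+64)$, $\mathcal B_{18,1}=-2(t^6+24t^5+24t^4+92t^3-48t^2+96t-8)(t^{12}-528t^{11}-3984t^{10}-14792t^9-27936t^8-42624t^7-37632t^6-52992t^5-25344t^4-43520t^3-6144t^2-6144t-512)$; $\mathcal A_{18,2}=-48(t^3+6t-2)(t^9+234t^7-6t^6+756t^5-936t^4+2172t^3-1512t^2+936t-8)$, $\mathcal B_{18,2}=-128(t^6+24t^5+24t^4+92t^3-48t^2+96t-8)(t^{12}-24t^{11}+48t^{10}-680t^9+792t^8-3312t^7+4704t^6-10656t^5+13968t^4-14792t^3+7968t^2-2112t-8)$;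 $\mathcal A_{18,3}=-243(t^3+4)(t^3+6t^2+4)(t^6-6t^5+36t^4+8t^3-24t^2+16)$, $\mathcal B_{18,3}=-1458(t^2+2t-2)(t^4-8t^3-8t-8)(t^4-2t^3+6t^2+4t+4)(t^8+8t^7+64t^6-16t^5-56t^4+128t^3+64t^2-64t+64)$; $\mathcal A_{18,4}=-3888(t^3-2)(t^3+6t-2)(t^6-6t^4-4t^3+36t^2+12t+4)$, $\mathcal B_{18,4}=-93312(t^2+2t-2)(t^4-2t^3-8t-2)(t^4-2t^3+6t^2+4t+4)(t^8+2t^7+4t^6-16t^5-14t^4+8t^3+64t^2-16t+4)$; $\mathcal A_{18,5}=-19683(t^3+4)(t^9-12t^6+48t^3+64)$, $\mathcal B_{18,5}=-1062882(t^6-4t^3-8)(t^{12}-8t^9-512t^3-512)$; $\mathcal A_{18,6}=-314928(t^3-2)(t^9-6t^6-12t^3-8)$, $\mathcal B_{18,6}=-68024448(t^6-4t^3-8)(t^{12}-8t^9-8t^3-8)$. $n=25$: $\mathcal A_{25,1}=-27(t^2+4)(t^{10}+240t^9+2170t^8+8880t^7+34835t^6+83748t^5+206210t^4+313380t^3+503545t^2+424740t+375376)$, $\mathcal B_{25,1}=-54(t^2+4)^2(t^4+6t^3+21t^2+36t+61)(t^{10}-510t^9-13580t^8-36870t^7-190915t^6-393252t^5-1068040t^4-1508370t^3-2581955t^2-2087010t-1885124)$; $\mathcal A_{25,2}=-16875(t^2+4)(t^2+3t+1)(t^4-4t^3+11t^2-14t+31)(t^4+t^3+11t^2-4t+16)$,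 $\mathcal B_{25,2}=-843750(t^2-2t-4)(t^2+4)^2(t^4-4t^3+21t^2-34t+41)(t^4+3t^2+1)(t^4+6t^3+21t^2+36t+61)$; $\mathcal A_{25,3}=-10546875(t^2+4)(t^{10}+10t^8+35t^6-12t^5+50t^4-60t^3+25t^2-60t+16)$, $\mathcal B_{25,3}=-13183593750(t^2+4)^2(t^4+3t^2+1)(t^{10}+10t^8+35t^6-18t^5+50t^4-90t^3+25t^2-90t+76)$. *)

(* Defs.v *)
From HB Require Import structures.
From Stdlib Require Import ZArith.
From mathcomp Require Import all_boot all_order all_algebra.
From mathcomp Require Import mpoly.

Set Implicit Arguments.
Unset Strict Implicit.
Unset Printing Implicit Defensive.

Import GRing.Theory.
Local Open Scope ring_scope.

(* Weierstrass curves  y^2 + a1 x y + a3 y = x^3 + a2 x^2 + a4 x + a6,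
   with the standard formulary of Silverman, AEC, III.1. *)

Record wcurve (R : Type) := WCurve { wa1 : R; wa2 : R; wa3 : R; wa4 : R; wa6 : R }.

Definition map_wcurve (R S : Type) (f : R -> S) (E : wcurve R) : wcurve S :=
  WCurve (f (wa1 E)) (f (wa2 E)) (f (wa3 E)) (f (wa4 E)) (f (wa6 E)).

Definition short_wcurve (R : pzRingType) (A B : R) : wcurve R :=
  WCurve 0 0 0 A B.

Section Invariants.
Variables (R : comPzRingType) (E : wcurve R).
Let a1 := wa1 E.
Let a2 := wa2 E.
Let a3 := wa3 E.
Let a4 := wa4 E.
Let a6 := wa6 E.

Definition wb2 : R := a1 ^+ 2 + 4 * a2.
Definition wb4 : R := 2 * a4 + a1 * a3.
Definition wb6 : R := a3 ^+ 2 + 4 * a6.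
Definition wb8 : R :=
  a1 ^+ 2 * a6 + 4 * a2 * a6 - a1 * a3 * a4 + a2 * a3 ^+ 2 - a4 ^+ 2.
Definition wc4 : R := wb2 ^+ 2 - 24 * wb4.
Definition wdisc : R :=
  - wb2 ^+ 2 * wb8 - 8 * wb4 ^+ 3 - 27 * wb6 ^+ 2 + 9 * wb2 * wb4 * wb6.

End Invariants.

Definition elliptic (F : fieldType) (E : wcurve F) : Prop := wdisc E != 0.

Definition j_invariant (F : fieldType) (E : wcurve F) : F :=
  wc4 E ^+ 3 / wdisc E.

(* E and E' are F-isomorphic: E' arises from E by an admissible change of
   variables x = u^2 x' + r, y = u^3 y' + u^2 s x' + w with u, r, s, w in F. *)
Definition isomorphic (F : fieldType) (E E' : wcurve F) : Prop :=
  exists u r s w : F,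
  u != 0 /\
  [/\ u * wa1 E' = wa1 E + 2 * s,
      u ^+ 2 * wa2 E' = wa2 E - s * wa1 E + 3 * r - s ^+ 2,
      u ^+ 3 * wa3 E' = wa3 E + r * wa1 E + 2 * w,
      u ^+ 4 * wa4 E' = wa4 E - s * wa3 E + 2 * r * wa2 E
                        - (w + r * s) * wa1 E + 3 * r ^+ 2 - 2 * s * w
    & u ^+ 6 * wa6 E' = wa6 E + r * wa4 E + r ^+ 2 * wa2 E + r ^+ 3
                        - w * wa3 E - w ^+ 2 - r * w * wa1 E].

(* [None] is the point at infinity O = [0 : 1 : 0]. *)
Definition point (R : Type) := option (R * R).

Definition coords (R : pzRingType) (P : point R) : 'I_3 -> R :=
  fun i => (if P is Some (x, y) then [:: x; y; 1] else [:: 0; 1; 0])`_i.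

Definition on_curve (R : comPzRingType) (E : wcurve R) (P : point R) : Prop :=
  if P is Some (x, y) then
    y ^+ 2 + wa1 E * x * y + wa3 E * y
    = x ^+ 3 + wa2 E * x ^+ 2 + wa4 E * x + wa6 E
  else True.

(* Chord-and-tangent group law (AEC, III.2.3). *)
Definition add_point (F : fieldType) (E : wcurve F) (P Q : point F) : point F :=
  match P, Q with
  | None, _ => Q
  | _, None => P
  | Some (x1, y1), Some (x2, y2) =>
    if (x1 == x2) && (y1 + y2 + wa1 E * x2 + wa3 E == 0) then None
    else
      let: (lam, nu) :=
        if x1 == x2 then
          let den := 2 * y1 + wa1 E * x1 + wa3 E in
          ((3 * x1 ^+ 2 + 2 * wa2 E * x1 + wa4 E - wa1 E * y1) / den,
           (- x1 ^+ 3 + wa4 E * x1 + 2 * wa6 E - wa3 E * y1) / den)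
        else
          ((y2 - y1) / (x2 - x1), (y1 * x2 - y2 * x1) / (x2 - x1)) in
      let x3 := lam ^+ 2 + wa1 E * lam - wa2 E - x1 - x2 in
      Some (x3, - (lam + wa1 E) * x3 - nu - wa3 E)
  end.

Definition mul_point (F : fieldType) (E : wcurve F) (k : nat) (P : point F) :=
  iter k (add_point E P) None.

(* The function field F(E) = F(x)[y] / (Weierstrass equation). *)

Section FunctionField.
Variables (F : fieldType) (E : wcurve F).

Definition in_Fx (p : {poly F}) : {fraction {poly F}} := tofrac p.

Definition weierstrass_poly : {poly {fraction {poly F}}} :=
  'X^2 + in_Fx (wa1 E *: 'X + (wa3 E)%:P) *: 'X
  - (in_Fx ('X^3 + wa2 E *: 'X^2 + wa4 E *: 'X + (wa6 E)%:P))%:P.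

(* [{poly %/ p}] is R[X]/(p) only for p monic and nonconstant, which
   [mk_monic_weierstrass] below guarantees. *)
Definition function_field := {poly %/ weierstrass_poly}.

Definition ff_in (f : {fraction {poly F}}) : function_field :=
  in_qpoly weierstrass_poly f%:P.

Definition ff_const (c : F) : function_field := ff_in (in_Fx c%:P).

Definition ff_x : function_field := ff_in (in_Fx 'X).

Definition ff_y : function_field := in_qpoly weierstrass_poly 'X.

Lemma mk_monic_weierstrass : mk_monic weierstrass_poly = weierstrass_poly.
Proof.
rewrite /mk_monic /weierstrass_poly -addrA.
set q := (X in 'X^2 + X).
have sq : (size q < size ('X^2 : {poly {fraction {poly F}}}))%N.
  rewrite size_polyXn ltnS (leq_trans (size_polyD _ _)) // size_polyN geq_max.
  rewrite (leq_trans (size_scale_leq _ _)) ?size_polyX //=.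
  by rewrite (leq_trans (size_polyC_leq1 _)).
by rewrite size_polyDl // size_polyXn monicE lead_coefDl // lead_coefXn eqxx.
Qed.

End FunctionField.

(* A rational map P |-> [X : Y : 1] from E to the projective plane is given by
   the pair (X, Y) of elements of F(E); E being smooth, it is a morphism. *)
Definition rational_map (F : fieldType) (E : wcurve F) : Type :=
  (function_field E * function_field E)%type.

Section Isogeny.
Variables (F : fieldType) (E E' : wcurve F).

Definition eval_generic (G : {mpoly F[3]}) : function_field E :=
  mmap (@ff_const F E) (coords (Some (ff_x E, ff_y E))) G.

(* phi(P) = Q, for P and Q with coordinates in an extension iota : F -> L:
   some homogeneous polynomials G0, G1, G2 over F of the same degree satisfy
   [G0 : G1 : G2] = [X : Y : 1] on E, do not all vanish at P, and have
   [G0(P) : G1(P) : G2(P)] = Q. *)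
Definition maps_to (phi : rational_map E) (L : fieldType) (iota : F -> L)
    (P Q : point L) : Prop :=
  exists (m : nat) (G : 'I_3 -> {mpoly F[3]}),
  [/\ forall i, G i \is m.-homog,
      forall i j, eval_generic (G i) * coords (Some phi) j
                  = eval_generic (G j) * coords (Some phi) i
    & exists2 c : L, c != 0 &
        forall i, mmap iota (coords P) (G i) = c * coords Q i].

(* Nonzero isogenies E -> E' defined over F.  The condition phi(O) = O excludes
   constant maps, since a constant phi = (X, Y) takes O to an affine point; the
   zero isogeny is not of the form (X, Y). *)
Definition isogeny (phi : rational_map E) : Prop :=
  on_curve (map_wcurve (@ff_const F E) E') (Some phi)
  /\ maps_to phi idfun None None.

(* The subfield phi^* F(E') = F(X, Y) of F(E). *)
Definition in_pullback (phi : rational_map E) (z : function_field E) : Prop :=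
  exists G H : {mpoly F[2]},
  let ev := mmap (@ff_const F E)
              (fun i : 'I_2 => [:: phi.1; phi.2]`_i) in
  ev H <> 0 /\ z * ev H = ev G.

(* deg phi = [F(E) : phi^* F(E')], i.e., F(E) has a basis of m elements over
   the subfield phi^* F(E'). *)
Definition isogeny_degree (phi : rational_map E) (m : nat) : Prop :=
  exists e : 'I_m -> function_field E,
  forall z : function_field E,
  exists! c : {ffun 'I_m -> function_field E},
    (forall i, in_pullback phi (c i)) /\ z = \sum_i c i * e i.

Definition kernel (phi : rational_map E) (L : fieldType) (iota : F -> L)
    (P : point L) : Prop :=
  on_curve (map_wcurve iota E) P /\ maps_to phi iota P None.

(* The kernel, as a group of points over an algebraically closed extension of
   F, is generated by one point; it is finite, so that its elements are the
   nonnegative multiples of that point. *)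
Definition cyclic_kernel (phi : rational_map E) : Prop :=
  forall (L : closedFieldType) (iota : {rmorphism F -> L}),
  exists Q : point L, forall P : point L,
    kernel phi iota P <-> exists k, P = mul_point (map_wcurve iota E) k Q.

End Isogeny.

Arguments isogeny {F} E E' phi.

Definition isogenous (F : fieldType) (E E' : wcurve F) : Prop :=
  exists phi, isogeny E E' phi.

Definition cyclic_isogeny_of_degree (F : fieldType) (E E' : wcurve F)
    (p : nat) : Prop :=
  exists phi, [/\ isogeny E E' phi, isogeny_degree phi p & cyclic_kernel phi].

(* Integer polynomial expressions in one variable, so that large literals are
   kept in binary. *)
Inductive pexp :=
| PCst of Z
| PVar
| POpp of pexp
| PAdd of pexp & pexp
| PMul of pexp & pexp
| PPow of pexp & nat.

Definition pexp_of_Z (z : Z) : pexp := PCst z.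
Definition Z_of_pexp (e : pexp) : option Z :=
  if e is PCst z then Some z else None.

Declare Scope pexp_scope.
Delimit Scope pexp_scope with pexp.
Number Notation pexp pexp_of_Z Z_of_pexp : pexp_scope.
Notation "- x" := (POpp x) : pexp_scope.
Notation "x + y" := (PAdd x y) : pexp_scope.
Notation "x - y" := (PAdd x (POpp y)) : pexp_scope.
Notation "x * y" := (PMul x y) : pexp_scope.
Notation "x ^ n" := (PPow x n%N) : pexp_scope.

Definition intr_of_Z (R : pzRingType) (z : Z) : R :=
  match z with
  | Z0 => 0
  | Zpos p => (Pos.to_nat p)%:R
  | Zneg p => - (Pos.to_nat p)%:R
  end.

Fixpoint peval (R : pzRingType) (x : R) (e : pexp) : R :=
  match e with
  | PCst z => intr_of_Z R z
  | PVar => x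
  | POpp e1 => - peval x e1
  | PAdd e1 e2 => peval x e1 + peval x e2
  | PMul e1 e2 => peval x e1 * peval x e2
  | PPow e1 k => peval x e1 ^+ k
  end.

(* The levels n > 1 for which X_0(n) has genus 0. *)
Definition genus0_levels : seq nat :=
  [:: 2; 3; 4; 5; 6; 7; 8; 9; 10; 12; 13; 16; 18; 25]%N.

(* The number m_n of curves in the family of level n. *)
Definition family_size (n : nat) : nat :=
  match n with
  | 2 | 3 | 5 | 7 | 13 => 2
  | 9 | 25 => 3
  | 4 | 6 | 10 => 4
  | 8 | 18 => 6
  | 12 | 16 => 8
  | _ => 0
  end.

(* The indices (k_1, k_2) of the curves with j-invariants j_{n,1}, j_{n,2}. *)
Definition fricke_indices (n : nat) : nat * nat :=
  match n with
  | 2 | 3 | 5 | 7 | 13 => (1, 2)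
  | 4 => (4, 2)
  | 6 | 10 => (1, 4)
  | 8 => (3, 6)
  | 9 | 25 => (1, 3)
  | 12 => (5, 4)
  | 16 => (2, 8)
  | 18 => (1, 6)
  | _ => (0, 0)
  end%N.

(* (k, p, l) stands for the arrow of degree p from vertex k to vertex l. *)
Definition isogeny_graph (n : nat) : seq (nat * nat * nat) :=
  match n with
  | 2 | 3 | 5 | 7 | 13 => [:: (1, n, 2)]
  | 9 => [:: (1, 3, 2); (2, 3, 3)]
  | 25 => [:: (1, 5, 2); (2, 5, 3)]
  | 6 | 10 => [:: (1, 2, 2); (1, n %/ 2, 3); (3, 2, 4); (2, n %/ 2, 4)]
  | 4 => [:: (1, 2, 2); (1, 2, 3); (4, 2, 1)]
  | 8 => [:: (1, 2, 2); (3, 2, 1); (1, 2, 4); (4, 2, 5); (4, 2, 6)]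
  | 12 => [:: (1, 3, 2); (8, 2, 2); (7, 3, 8); (1, 2, 7); (5, 2, 1);
              (5, 3, 6); (6, 2, 2); (2, 2, 4); (3, 3, 4); (1, 2, 3)]
  | 16 => [:: (1, 2, 3); (2, 2, 1); (1, 2, 4); (4, 2, 5); (4, 2, 6);
              (6, 2, 7); (6, 2, 8)]
  | 18 => [:: (1, 3, 3); (1, 2, 2); (2, 3, 4); (3, 2, 4); (3, 3, 5);
              (5, 2, 6); (4, 3, 6)]
  | _ => [::]
  end%N.

Local Notation t := PVar.

(* The pairs (A_{n,i}, B_{n,i}). *)
Definition family_coefs (n i : nat) : pexp * pexp :=
  match n, i with
  | 2, 1 =>
      (-27 * (t + 64) * (t + 256),
       -54 * (t - 512) * (t + 64) ^ 2)%pexp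
  | 2, 2 =>
      (-432 * (t + 16) * (t + 64),
       -3456 * (t - 8) * (t + 64) ^ 2)%pexp
  | 3, 1 =>
      (-3 * (t + 243) * (t + 27) ^ 3,
       -2 * (t + 27) ^ 4 * (t ^ 2 - 486 * t - 19683))%pexp
  | 3, 2 =>
      (-243 * (t + 3) * (t + 27) ^ 3,
       -1458 * (t + 27) ^ 4 * (t ^ 2 + 18 * t - 27))%pexp
  | 4, 1 =>
      (-432 * (t ^ 2 + 16 * t + 256),
       3456 * (t - 16) * (t + 8) * (t + 32))%pexp
  | 4, 2 =>
      (-6912 * (t ^ 2 + 16 * t + 16),
       221184 * (t + 8) * (t ^ 2 + 16 * t - 8))%pexp
  | 4, 3 =>
      (-432 * (t ^ 2 - 224 * t + 256),
       3456 * (t - 16) * (t ^ 2 + 544 * t + 256))%pexp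
  | 4, 4 =>
      (-27 * (t ^ 2 + 256 * t + 4096),
       54 * (t + 32) * (t ^ 2 - 512 * t - 8192))%pexp
  | 5, 1 =>
      (-27 * (t ^ 2 + 22 * t + 125) * (t ^ 2 + 250 * t + 3125),
       -54 * (t ^ 2 - 500 * t - 15625) * (t ^ 2 + 22 * t + 125) ^ 2)%pexp
  | 5, 2 =>
      (-16875 * (t ^ 2 + 10 * t + 5) * (t ^ 2 + 22 * t + 125),
       -843750 * (t ^ 2 + 4 * t - 1) * (t ^ 2 + 22 * t + 125) ^ 2)%pexp
  | 6, 1 =>
      (-3 * (t + 12) * (t ^ 3 + 252 * t ^ 2 + 3888 * t + 15552),
       -2 * (t ^ 2 + 36 * t + 216) * (t ^ 4 - 504 * t ^ 3 - 13824 * t ^ 2 -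
         124416 * t - 373248))%pexp
  | 6, 2 =>
      (-48 * (t + 6) * (t ^ 3 + 18 * t ^ 2 + 324 * t + 1944),
       -128 * (t ^ 2 + 36 * t + 216) * (t ^ 4 - 216 * t ^ 2 - 1944 * t -
         5832))%pexp
  | 6, 3 =>
      (-243 * (t + 12) * (t ^ 3 + 12 * t ^ 2 + 48 * t + 192),
       -1458 * (t ^ 2 + 12 * t + 24) * (t ^ 4 + 24 * t ^ 3 + 192 * t ^ 2 -
         4608))%pexp
  | 6, 4 =>
      (-3888 * (t + 6) * (t ^ 3 + 18 * t ^ 2 + 84 * t + 24),
       -93312 * (t ^ 2 + 12 * t + 24) * (t ^ 4 + 24 * t ^ 3 + 192 * t ^ 2 +
         504 * t - 72))%pexp
  | 7, 1 =>
      (-27 * (t ^ 2 + 13 * t + 49) * (t ^ 2 + 245 * t + 2401),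
       -54 * (t ^ 2 + 13 * t + 49) * (t ^ 4 - 490 * t ^ 3 - 21609 * t ^ 2 -
         235298 * t - 823543))%pexp
  | 7, 2 =>
      (-64827 * (t ^ 2 + 5 * t + 1) * (t ^ 2 + 13 * t + 49),
       -6353046 * (t ^ 2 + 13 * t + 49) * (t ^ 4 + 14 * t ^ 3 + 63 * t ^ 2 +
         70 * t - 7))%pexp
  | 8, 1 =>
      (-432 * (t ^ 4 + 224 * t ^ 2 + 256),
       -3456 * (t ^ 2 - 24 * t + 16) * (t ^ 2 + 16) * (t ^ 2 + 24 * t +
         16))%pexp
  | 8, 2 =>
      (-432 * (t ^ 4 - 240 * t ^ 3 + 2144 * t ^ 2 - 3840 * t + 256),
       -3456 * (t ^ 2 - 24 * t + 16) * (t ^ 4 + 528 * t ^ 3 - 4000 * t ^ 2 +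
         8448 * t + 256))%pexp
  | 8, 3 =>
      (-27 * (t ^ 4 + 240 * t ^ 3 + 2144 * t ^ 2 + 3840 * t + 256),
       -54 * (t ^ 2 + 24 * t + 16) * (t ^ 4 - 528 * t ^ 3 - 4000 * t ^ 2 -
         8448 * t + 256))%pexp
  | 8, 4 =>
      (-6912 * (t ^ 4 - 16 * t ^ 2 + 256),
       -221184 * (t ^ 2 - 32) * (t ^ 2 - 8) * (t ^ 2 + 16))%pexp
  | 8, 5 =>
      (-6912 * (t ^ 4 - 256 * t ^ 2 + 4096),
       -221184 * (t ^ 2 - 32) * (t ^ 4 + 512 * t ^ 2 - 8192))%pexp
  | 8, 6 =>
      (-110592 * (t ^ 4 - 16 * t ^ 2 + 16),
       -14155776 * (t ^ 2 - 8) * (t ^ 4 - 16 * t ^ 2 - 8))%pexp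
  | 9, 1 =>
      (-3 * (t + 6) * (t ^ 3 + 234 * t ^ 2 + 756 * t + 2160),
       -2 * (t ^ 6 - 504 * t ^ 5 - 16632 * t ^ 4 - 123012 * t ^ 3 - 517104 * t
         ^ 2 - 1143072 * t - 1475496))%pexp
  | 9, 2 =>
      (-243 * t * (t + 6) * (t ^ 2 - 6 * t + 36),
       -1458 * (t ^ 2 - 6 * t - 18) * (t ^ 4 + 6 * t ^ 3 + 54 * t ^ 2 - 108 *
         t + 324))%pexp
  | 9, 3 =>
      (-19683 * t * (t ^ 3 - 24),
       -1062882 * (t ^ 6 - 36 * t ^ 3 + 216))%pexp
  | 10, 1 =>
      (-27 * (t ^ 2 + 4) * (t ^ 6 + 236 * t ^ 5 + 1440 * t ^ 4 + 1920 * t ^ 3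
        + 3840 * t ^ 2 + 256 * t + 256),
       -54 * (t ^ 2 + 4 * t + 8) * (t ^ 2 + 22 * t - 4) * (t ^ 2 + 4) ^ 2 * (t
         ^ 4 - 536 * t ^ 3 - 264 * t ^ 2 - 416 * t - 64))%pexp
  | 10, 2 =>
      (-432 * (t ^ 2 + 4) * (t ^ 6 - 4 * t ^ 5 + 240 * t ^ 4 - 480 * t ^ 3 +
        1440 * t ^ 2 - 944 * t + 16),
       -3456 * (t ^ 2 - 2 * t + 2) * (t ^ 2 + 22 * t - 4) * (t ^ 2 + 4) ^ 2 *
         (t ^ 4 - 26 * t ^ 3 + 66 * t ^ 2 - 536 * t - 4))%pexp
  | 10, 3 =>
      (-16875 * (t ^ 2 + 4) * (t ^ 6 - 4 * t ^ 5 + 256 * t + 256),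
       -843750 * (t ^ 2 - 2 * t - 4) * (t ^ 2 + 4 * t + 8) * (t ^ 2 + 4) ^ 2 *
         (t ^ 4 - 8 * t ^ 3 + 24 * t ^ 2 - 32 * t - 64))%pexp
  | 10, 4 =>
      (-270000 * (t ^ 2 + 4) * (t ^ 6 - 4 * t ^ 5 + 16 * t + 16),
       -54000000 * (t ^ 2 - 2 * t - 4) * (t ^ 2 - 2 * t + 2) * (t ^ 2 + 4) ^ 2
         * (t ^ 4 - 2 * t ^ 3 - 6 * t ^ 2 - 8 * t - 4))%pexp
  | 12, 1 =>
      (-48 * (t ^ 2 + 3) * (t ^ 6 + 225 * t ^ 4 - 405 * t ^ 2 + 243),
       -128 * (t ^ 4 - 24 * t ^ 3 + 18 * t ^ 2 - 27) * (t ^ 4 + 18 * t ^ 2 -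
         27) * (t ^ 4 + 24 * t ^ 3 + 18 * t ^ 2 - 27))%pexp
  | 12, 2 =>
      (-3888 * (t ^ 2 + 3) * (t ^ 6 - 15 * t ^ 4 + 75 * t ^ 2 + 3),
       -93312 * (t ^ 4 - 6 * t ^ 2 - 24 * t - 3) * (t ^ 4 - 6 * t ^ 2 - 3) *
         (t ^ 4 - 6 * t ^ 2 + 24 * t - 3))%pexp
  | 12, 3 =>
      (-768 * (t ^ 2 - 3) * (t ^ 6 - 9 * t ^ 4 + 243 * t ^ 2 - 243),
       -8192 * (t ^ 4 + 18 * t ^ 2 - 27) * (t ^ 8 - 36 * t ^ 6 + 270 * t ^ 4 -
         972 * t ^ 2 + 729))%pexp
  | 12, 4 =>
      (-62208 * (t ^ 2 - 3) * (t ^ 6 - 9 * t ^ 4 + 3 * t ^ 2 - 3),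
       -5971968 * (t ^ 4 - 6 * t ^ 2 - 3) * (t ^ 8 - 12 * t ^ 6 + 30 * t ^ 4 -
         36 * t ^ 2 + 9))%pexp
  | 12, 5 =>
      (-3 * (t ^ 2 + 6 * t - 3) * (t ^ 6 + 234 * t ^ 5 + 747 * t ^ 4 + 540 * t
        ^ 3 - 729 * t ^ 2 - 486 * t - 243),
       -2 * (t ^ 4 + 24 * t ^ 3 + 18 * t ^ 2 - 27) * (t ^ 8 - 528 * t ^ 7 -
         3996 * t ^ 6 - 9504 * t ^ 5 + 270 * t ^ 4 + 14256 * t ^ 3 - 972 * t ^
         2 + 729))%pexp
  | 12, 6 =>
      (-243 * (t ^ 2 + 6 * t - 3) * (t ^ 6 - 6 * t ^ 5 + 27 * t ^ 4 + 60 * t ^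
        3 - 249 * t ^ 2 + 234 * t - 3),
       -1458 * (t ^ 4 - 6 * t ^ 2 + 24 * t - 3) * (t ^ 8 - 12 * t ^ 6 - 528 *
         t ^ 5 + 30 * t ^ 4 + 3168 * t ^ 3 - 3996 * t ^ 2 + 1584 * t +
         9))%pexp
  | 12, 7 =>
      (-48 * (t ^ 2 - 6 * t - 3) * (t ^ 6 - 234 * t ^ 5 + 747 * t ^ 4 - 540 *
        t ^ 3 - 729 * t ^ 2 + 486 * t - 243),
       -128 * (t ^ 4 - 24 * t ^ 3 + 18 * t ^ 2 - 27) * (t ^ 8 + 528 * t ^ 7 -
         3996 * t ^ 6 + 9504 * t ^ 5 + 270 * t ^ 4 - 14256 * t ^ 3 - 972 * t ^
         2 + 729))%pexp
  | 12, 8 =>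
      (-3888 * (t ^ 2 - 6 * t - 3) * (t ^ 6 + 6 * t ^ 5 + 27 * t ^ 4 - 60 * t
        ^ 3 - 249 * t ^ 2 - 234 * t - 3),
       -93312 * (t ^ 4 - 6 * t ^ 2 - 24 * t - 3) * (t ^ 8 - 12 * t ^ 6 + 528 *
         t ^ 5 + 30 * t ^ 4 - 3168 * t ^ 3 - 3996 * t ^ 2 - 1584 * t +
         9))%pexp
  | 13, 1 =>
      (-27 * (t ^ 2 + 5 * t + 13) * (t ^ 2 + 6 * t + 13) * (t ^ 4 + 247 * t ^
        3 + 3380 * t ^ 2 + 15379 * t + 28561),
       -54 * (t ^ 2 + 5 * t + 13) * (t ^ 2 + 6 * t + 13) ^ 2 * (t ^ 6 - 494 *
         t ^ 5 - 20618 * t ^ 4 - 237276 * t ^ 3 - 1313806 * t ^ 2 - 3712930 *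
         t - 4826809))%pexp
  | 13, 2 =>
      (-771147 * (t ^ 2 + 5 * t + 13) * (t ^ 2 + 6 * t + 13) * (t ^ 4 + 7 * t
        ^ 3 + 20 * t ^ 2 + 19 * t + 1),
       -260647686 * (t ^ 2 + 5 * t + 13) * (t ^ 2 + 6 * t + 13) ^ 2 * (t ^ 6 +
         10 * t ^ 5 + 46 * t ^ 4 + 108 * t ^ 3 + 122 * t ^ 2 + 38 * t -
         1))%pexp
  | 16, 1 =>
      (-432 * (t ^ 8 + 240 * t ^ 6 + 2144 * t ^ 4 + 3840 * t ^ 2 + 256),
       -3456 * (t ^ 4 - 24 * t ^ 3 + 24 * t ^ 2 - 96 * t + 16) * (t ^ 4 + 24 *
         t ^ 2 + 16) * (t ^ 4 + 24 * t ^ 3 + 24 * t ^ 2 + 96 * t + 16))%pexp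
  | 16, 2 =>
      (-27 * (t ^ 8 + 240 * t ^ 7 + 2160 * t ^ 6 + 6720 * t ^ 5 + 17504 * t ^
        4 + 26880 * t ^ 3 + 34560 * t ^ 2 + 15360 * t + 256),
       -54 * (t ^ 4 + 24 * t ^ 3 + 24 * t ^ 2 + 96 * t + 16) * (t ^ 8 - 528 *
         t ^ 7 - 3984 * t ^ 6 - 14784 * t ^ 5 - 31648 * t ^ 4 - 59136 * t ^ 3
         - 63744 * t ^ 2 - 33792 * t + 256))%pexp
  | 16, 3 =>
      (-432 * (t ^ 8 - 240 * t ^ 7 + 2160 * t ^ 6 - 6720 * t ^ 5 + 17504 * t ^
        4 - 26880 * t ^ 3 + 34560 * t ^ 2 - 15360 * t + 256),
       -3456 * (t ^ 4 - 24 * t ^ 3 + 24 * t ^ 2 - 96 * t + 16) * (t ^ 8 + 528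
         * t ^ 7 - 3984 * t ^ 6 + 14784 * t ^ 5 - 31648 * t ^ 4 + 59136 * t ^
         3 - 63744 * t ^ 2 + 33792 * t + 256))%pexp
  | 16, 4 =>
      (-6912 * (t ^ 4 - 4 * t ^ 3 + 8 * t ^ 2 + 16 * t + 16) * (t ^ 4 + 4 * t
        ^ 3 + 8 * t ^ 2 - 16 * t + 16),
       -221184 * (t ^ 2 - 4 * t - 4) * (t ^ 2 + 4 * t - 4) * (t ^ 4 + 16) * (t
         ^ 4 + 24 * t ^ 2 + 16))%pexp
  | 16, 5 =>
      (-6912 * (t ^ 4 - 16 * t ^ 3 + 8 * t ^ 2 + 64 * t + 16) * (t ^ 4 + 16 *
        t ^ 3 + 8 * t ^ 2 - 64 * t + 16),
       -221184 * (t ^ 2 - 4 * t - 4) * (t ^ 2 + 4 * t - 4) * (t ^ 8 + 528 * t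
         ^ 6 - 4000 * t ^ 4 + 8448 * t ^ 2 + 256))%pexp
  | 16, 6 =>
      (-110592 * (t ^ 8 - 16 * t ^ 4 + 256),
       -14155776 * (t ^ 4 - 32) * (t ^ 4 - 8) * (t ^ 4 + 16))%pexp
  | 16, 7 =>
      (-110592 * (t ^ 8 - 256 * t ^ 4 + 4096),
       -14155776 * (t ^ 4 - 32) * (t ^ 8 + 512 * t ^ 4 - 8192))%pexp
  | 16, 8 =>
      (-1769472 * (t ^ 8 - 16 * t ^ 4 + 16),
       -905969664 * (t ^ 4 - 8) * (t ^ 8 - 16 * t ^ 4 - 8))%pexp
  | 18, 1 =>
      (-3 * (t ^ 3 + 6 * t ^ 2 + 4) * (t ^ 9 + 234 * t ^ 8 + 756 * t ^ 7 +
        2172 * t ^ 6 + 1872 * t ^ 5 + 3024 * t ^ 4 + 48 * t ^ 3 + 3744 * t ^ 2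
        + 64),
       -2 * (t ^ 6 + 24 * t ^ 5 + 24 * t ^ 4 + 92 * t ^ 3 - 48 * t ^ 2 + 96 *
         t - 8) * (t ^ 12 - 528 * t ^ 11 - 3984 * t ^ 10 - 14792 * t ^ 9 -
         27936 * t ^ 8 - 42624 * t ^ 7 - 37632 * t ^ 6 - 52992 * t ^ 5 - 25344
         * t ^ 4 - 43520 * t ^ 3 - 6144 * t ^ 2 - 6144 * t - 512))%pexp
  | 18, 2 =>
      (-48 * (t ^ 3 + 6 * t - 2) * (t ^ 9 + 234 * t ^ 7 - 6 * t ^ 6 + 756 * t
        ^ 5 - 936 * t ^ 4 + 2172 * t ^ 3 - 1512 * t ^ 2 + 936 * t - 8),
       -128 * (t ^ 6 + 24 * t ^ 5 + 24 * t ^ 4 + 92 * t ^ 3 - 48 * t ^ 2 + 96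
         * t - 8) * (t ^ 12 - 24 * t ^ 11 + 48 * t ^ 10 - 680 * t ^ 9 + 792 *
         t ^ 8 - 3312 * t ^ 7 + 4704 * t ^ 6 - 10656 * t ^ 5 + 13968 * t ^ 4 -
         14792 * t ^ 3 + 7968 * t ^ 2 - 2112 * t - 8))%pexp
  | 18, 3 =>
      (-243 * (t ^ 3 + 4) * (t ^ 3 + 6 * t ^ 2 + 4) * (t ^ 6 - 6 * t ^ 5 + 36
        * t ^ 4 + 8 * t ^ 3 - 24 * t ^ 2 + 16),
       -1458 * (t ^ 2 + 2 * t - 2) * (t ^ 4 - 8 * t ^ 3 - 8 * t - 8) * (t ^ 4
         - 2 * t ^ 3 + 6 * t ^ 2 + 4 * t + 4) * (t ^ 8 + 8 * t ^ 7 + 64 * t ^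
         6 - 16 * t ^ 5 - 56 * t ^ 4 + 128 * t ^ 3 + 64 * t ^ 2 - 64 * t +
         64))%pexp
  | 18, 4 =>
      (-3888 * (t ^ 3 - 2) * (t ^ 3 + 6 * t - 2) * (t ^ 6 - 6 * t ^ 4 - 4 * t
        ^ 3 + 36 * t ^ 2 + 12 * t + 4),
       -93312 * (t ^ 2 + 2 * t - 2) * (t ^ 4 - 2 * t ^ 3 - 8 * t - 2) * (t ^ 4
         - 2 * t ^ 3 + 6 * t ^ 2 + 4 * t + 4) * (t ^ 8 + 2 * t ^ 7 + 4 * t ^ 6
         - 16 * t ^ 5 - 14 * t ^ 4 + 8 * t ^ 3 + 64 * t ^ 2 - 16 * t +
         4))%pexp
  | 18, 5 =>
      (-19683 * (t ^ 3 + 4) * (t ^ 9 - 12 * t ^ 6 + 48 * t ^ 3 + 64),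
       -1062882 * (t ^ 6 - 4 * t ^ 3 - 8) * (t ^ 12 - 8 * t ^ 9 - 512 * t ^ 3
         - 512))%pexp
  | 18, 6 =>
      (-314928 * (t ^ 3 - 2) * (t ^ 9 - 6 * t ^ 6 - 12 * t ^ 3 - 8),
       -68024448 * (t ^ 6 - 4 * t ^ 3 - 8) * (t ^ 12 - 8 * t ^ 9 - 8 * t ^ 3 -
         8))%pexp
  | 25, 1 =>
      (-27 * (t ^ 2 + 4) * (t ^ 10 + 240 * t ^ 9 + 2170 * t ^ 8 + 8880 * t ^ 7
        + 34835 * t ^ 6 + 83748 * t ^ 5 + 206210 * t ^ 4 + 313380 * t ^ 3 +
        503545 * t ^ 2 + 424740 * t + 375376),
       -54 * (t ^ 2 + 4) ^ 2 * (t ^ 4 + 6 * t ^ 3 + 21 * t ^ 2 + 36 * t + 61)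
         * (t ^ 10 - 510 * t ^ 9 - 13580 * t ^ 8 - 36870 * t ^ 7 - 190915 * t
         ^ 6 - 393252 * t ^ 5 - 1068040 * t ^ 4 - 1508370 * t ^ 3 - 2581955 *
         t ^ 2 - 2087010 * t - 1885124))%pexp
  | 25, 2 =>
      (-16875 * (t ^ 2 + 4) * (t ^ 2 + 3 * t + 1) * (t ^ 4 - 4 * t ^ 3 + 11 *
        t ^ 2 - 14 * t + 31) * (t ^ 4 + t ^ 3 + 11 * t ^ 2 - 4 * t + 16),
       -843750 * (t ^ 2 - 2 * t - 4) * (t ^ 2 + 4) ^ 2 * (t ^ 4 - 4 * t ^ 3 +
         21 * t ^ 2 - 34 * t + 41) * (t ^ 4 + 3 * t ^ 2 + 1) * (t ^ 4 + 6 * t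
         ^ 3 + 21 * t ^ 2 + 36 * t + 61))%pexp
  | 25, 3 =>
      (-10546875 * (t ^ 2 + 4) * (t ^ 10 + 10 * t ^ 8 + 35 * t ^ 6 - 12 * t ^
        5 + 50 * t ^ 4 - 60 * t ^ 3 + 25 * t ^ 2 - 60 * t + 16),
       -13183593750 * (t ^ 2 + 4) ^ 2 * (t ^ 4 + 3 * t ^ 2 + 1) * (t ^ 10 + 10
         * t ^ 8 + 35 * t ^ 6 - 18 * t ^ 5 + 50 * t ^ 4 - 90 * t ^ 3 + 25 * t
         ^ 2 - 90 * t + 76))%pexp
  | _, _ => (0, 0)%pexp
  end%N.

(* Numerator and denominator of j_{n,i}. *)
Definition fricke_j (n i : nat) : pexp * pexp :=
  match n, i with
  | 2, 1 =>
      ((t + 256) ^ 3,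
       t ^ 2)%pexp
  | 2, 2 =>
      ((t + 16) ^ 3,
       t)%pexp
  | 3, 1 =>
      ((t + 27) * (t + 243) ^ 3,
       t ^ 3)%pexp
  | 3, 2 =>
      ((t + 27) * (t + 3) ^ 3,
       t)%pexp
  | 4, 1 =>
      ((t ^ 2 + 256 * t + 4096) ^ 3,
       t ^ 4 * (t + 16))%pexp
  | 4, 2 =>
      ((t ^ 2 + 16 * t + 16) ^ 3,
       t * (t + 16))%pexp
  | 5, 1 =>
      ((t ^ 2 + 250 * t + 3125) ^ 3,
       t ^ 5)%pexp
  | 5, 2 =>
      ((t ^ 2 + 10 * t + 5) ^ 3,
       t)%pexp
  | 6, 1 =>
      ((t + 12) ^ 3 * (t ^ 3 + 252 * t ^ 2 + 3888 * t + 15552) ^ 3,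
       t ^ 6 * (t + 8) ^ 2 * (t + 9) ^ 3)%pexp
  | 6, 2 =>
      ((t + 6) ^ 3 * (t ^ 3 + 18 * t ^ 2 + 84 * t + 24) ^ 3,
       t * (t + 8) ^ 3 * (t + 9) ^ 2)%pexp
  | 7, 1 =>
      ((t ^ 2 + 13 * t + 49) * (t ^ 2 + 245 * t + 2401) ^ 3,
       t ^ 7)%pexp
  | 7, 2 =>
      ((t ^ 2 + 13 * t + 49) * (t ^ 2 + 5 * t + 1) ^ 3,
       t)%pexp
  | 8, 1 =>
      ((t ^ 4 + 240 * t ^ 3 + 2144 * t ^ 2 + 3840 * t + 256) ^ 3,
       t * (t - 4) ^ 8 * (t + 4) ^ 2)%pexp
  | 8, 2 =>
      ((t ^ 4 - 16 * t ^ 2 + 16) ^ 3,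
       t ^ 2 * (t ^ 2 - 16))%pexp
  | 9, 1 =>
      ((t + 6) ^ 3 * (t ^ 3 + 234 * t ^ 2 + 756 * t + 2160) ^ 3,
       (t - 3) ^ 8 * (t ^ 3 - 27))%pexp
  | 9, 2 =>
      (t ^ 3 * (t ^ 3 - 24) ^ 3,
       t ^ 3 - 27)%pexp
  | 10, 1 =>
      ((t ^ 6 + 236 * t ^ 5 + 1440 * t ^ 4 + 1920 * t ^ 3 + 3840 * t ^ 2 + 256
        * t + 256) ^ 3,
       t ^ 2 * (t - 4) ^ 10 * (t + 1) ^ 5)%pexp
  | 10, 2 =>
      ((t ^ 6 - 4 * t ^ 5 + 16 * t + 16) ^ 3,
       t ^ 5 * (t + 1) ^ 2 * (t - 4))%pexp
  | 12, 1 =>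
      ((t ^ 2 + 6 * t - 3) ^ 3 * (t ^ 6 + 234 * t ^ 5 + 747 * t ^ 4 + 540 * t
        ^ 3 - 729 * t ^ 2 - 486 * t - 243) ^ 3,
       t ^ 3 * (t - 3) ^ 12 * (t - 1) * (t + 1) ^ 4 * (t + 3) ^ 3)%pexp
  | 12, 2 =>
      ((t ^ 2 - 3) ^ 3 * (t ^ 6 - 9 * t ^ 4 + 3 * t ^ 2 - 3) ^ 3,
       t ^ 4 * (t ^ 2 - 9) * (t ^ 2 - 1) ^ 3)%pexp
  | 13, 1 =>
      ((t ^ 2 + 5 * t + 13) * (t ^ 4 + 247 * t ^ 3 + 3380 * t ^ 2 + 15379 * t
        + 28561) ^ 3,
       t ^ 13)%pexp
  | 13, 2 =>
      ((t ^ 2 + 5 * t + 13) * (t ^ 4 + 7 * t ^ 3 + 20 * t ^ 2 + 19 * t + 1) ^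
        3,
       t)%pexp
  | 16, 1 =>
      ((t ^ 8 + 240 * t ^ 7 + 2160 * t ^ 6 + 6720 * t ^ 5 + 17504 * t ^ 4 +
        26880 * t ^ 3 + 34560 * t ^ 2 + 15360 * t + 256) ^ 3,
       t * (t - 2) ^ 16 * (t + 2) ^ 4 * (t ^ 2 + 4))%pexp
  | 16, 2 =>
      ((t ^ 8 - 16 * t ^ 4 + 16) ^ 3,
       t ^ 4 * (t ^ 4 - 16))%pexp
  | 18, 1 =>
      ((t ^ 3 + 6 * t ^ 2 + 4) ^ 3 * (t ^ 9 + 234 * t ^ 8 + 756 * t ^ 7 + 2172
        * t ^ 6 + 1872 * t ^ 5 + 3024 * t ^ 4 + 48 * t ^ 3 + 3744 * t ^ 2 +
        64) ^ 3,
       t ^ 2 * (t - 2) ^ 18 * (t + 1) ^ 9 * (t ^ 2 - t + 1) * (t ^ 2 + 2 * t +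
         4) ^ 2)%pexp
  | 18, 2 =>
      ((t ^ 3 - 2) ^ 3 * (t ^ 9 - 6 * t ^ 6 - 12 * t ^ 3 - 8) ^ 3,
       t ^ 9 * (t ^ 3 - 8) * (t ^ 3 + 1) ^ 2)%pexp
  | 25, 1 =>
      ((t ^ 10 + 240 * t ^ 9 + 2170 * t ^ 8 + 8880 * t ^ 7 + 34835 * t ^ 6 +
        83748 * t ^ 5 + 206210 * t ^ 4 + 313380 * t ^ 3 + 503545 * t ^ 2 +
        424740 * t + 375376) ^ 3,
       (t - 1) ^ 25 * (t ^ 4 + t ^ 3 + 6 * t ^ 2 + 6 * t + 11))%pexp
  | 25, 2 =>
      ((t ^ 10 + 10 * t ^ 8 + 35 * t ^ 6 - 12 * t ^ 5 + 50 * t ^ 4 - 60 * t ^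
        3 + 25 * t ^ 2 - 60 * t + 16) ^ 3,
       t ^ 5 + 5 * t ^ 3 + 5 * t - 11)%pexp
  | _, _ => (0, 1)%pexp
  end%N.

(* K(t,d) as the fraction field of K[t][d]. *)
Definition Ktd (K : fieldType) : fieldType := {fraction {poly {poly K}}}.
Definition Ktd_t (K : fieldType) : Ktd K := tofrac ('X%:P : {poly {poly K}}).
Definition Ktd_d (K : fieldType) : Ktd K := tofrac ('X : {poly {poly K}}).

(* C_{n,i}(t,d) : y^2 = x^3 + d^2 A_{n,i} x + d^3 B_{n,i}. *)
Definition isogeny_family (F : fieldType) (n i : nat) (t d : F) : wcurve F :=
  let: (A, B) := family_coefs n i in
  short_wcurve (d ^+ 2 * peval t A) (d ^+ 3 * peval t B).

Definition fricke (F : fieldType) (n i : nat) (t : F) : F :=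
  let: (num, den) := fricke_j n i in peval t num / peval t den.

(* Main.v *)
Require Import Defs.
From HB Require Import structures.
From Stdlib Require Import ZArith Classical_Prop.
From mathcomp Require Import all_boot all_order all_algebra.
From mathcomp Require Import mpoly ring zify ssrZ fieldext separable closed_field.

Set Implicit Arguments.
Unset Strict Implicit.
Unset Printing Implicit Defensive.
Import GRing.Theory.
Local Open Scope ring_scope.

(** All the assertions reduce to identities between integer polynomials in t, plus the fact that
    certain integer polynomials stay nonzero over K. The latter holds as soon as one coefficient has
    only prime divisors of 6n, because such a coefficient is a unit in K ([nonvanishing_Ktd]).
    Discriminants then give ellipticity, c4^3/disc gives the j-invariants, and A^3 B2^2 <> A2^3 B^2
    separates the curves, since an isomorphism forces A = u^4 A2 and B = u^6 B2
    ([isomorphic_short]).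

    Isogenies are written (x, y) -> (U/D^2, y V/D^3), with prescribed degrees of U, V, D
    ([isogeny_data]). Such a map fixes O ([isogeny_data_isogeny]), and the affine points of its
    kernel lie above the roots of D. Its degree is [F(E) : F(X, Y)] = [F(x) : F(U/D^2)], the degree
    of the reduced fraction ([isogeny_data_degree]). These data compose ([isogeny_data_comp]), so
    the isogeny class assertion follows once every vertex is reached from vertex 1.

    For degree 2 the formulas of Velu apply to a rational root of the cubic ([cyclic_2isogeny]). For
    an odd prime p = 2h+1, D has the abscissas of the kernel as roots and U is the numerator of
    Kohel. The Weierstrass equation of the target becomes a differential equation for D. It holds
    once a bilinear form of Hirota type vanishes, D is separable, and one coefficient of the
    expansion at infinity is right ([velu_isogeny_data], [velu_defect_const]). That the roots of D
    come from a cyclic group of order p is certified by a chain of lines through P and kP which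
    closes up after h steps ([cyclic_odd_isogeny]).

    For p = 3 the chain is an inflection tangent ([cyclic_3isogeny]). For p = 5, 7, 13 it lives on
    the universal curve over X_1(p), reached by adjoining a point of X_1(p) above the given
    parameter and a square root that undoes a quadratic twist ([modular_isogeny]). The arrows of
    degree 5 at levels 10 and 25 are pulled back from level 5 ([five_arrow]). The polynomial
    identities themselves are verified by computation ([level_checks], and the [velu_check] and
    [chain_check] of the three modular data). *)

(** * The function field of a short Weierstrass curve *)

Section FunctionFieldMorphisms.
Variables (F : fieldType) (E : wcurve F).

Fact ff_in_is_zmod_morphism : zmod_morphism (@ff_in F E).
Proof. by move=> x y; rewrite /ff_in polyCB raddfB. Qed.

Fact ff_in_is_monoid_morphism : monoid_morphism (@ff_in F E).
Proof.
split; first by rewrite /ff_in polyC1 rmorph1.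
by move=> x y; rewrite /ff_in polyCM rmorphM.
Qed.

HB.instance Definition _ := GRing.isZmodMorphism.Build
  {fraction {poly F}} (function_field E) (@ff_in F E) ff_in_is_zmod_morphism.
HB.instance Definition _ := GRing.isMonoidMorphism.Build
  {fraction {poly F}} (function_field E) (@ff_in F E) ff_in_is_monoid_morphism.

Fact ff_const_is_zmod_morphism : zmod_morphism (@ff_const F E).
Proof. by move=> x y; rewrite /ff_const /in_Fx polyCB !rmorphB. Qed.

Fact ff_const_is_monoid_morphism : monoid_morphism (@ff_const F E).
Proof.
split; first by rewrite /ff_const /in_Fx polyC1 !rmorph1.
by move=> x y; rewrite /ff_const /in_Fx polyCM !rmorphM.
Qed.

HB.instance Definition _ := GRing.isZmodMorphism.Build
  F (function_field E) (@ff_const F E) ff_const_is_zmod_morphism.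
HB.instance Definition _ := GRing.isMonoidMorphism.Build
  F (function_field E) (@ff_const F E) ff_const_is_monoid_morphism.

Lemma ff_in0 : ff_in E 0 = 0. Proof. exact: rmorph0. Qed.
Lemma ff_in1 : ff_in E 1 = 1. Proof. exact: rmorph1. Qed.
Lemma ff_inD a b : ff_in E (a + b) = ff_in E a + ff_in E b. Proof. exact: rmorphD. Qed.

Lemma ff_inM a b : ff_in E (a * b) = ff_in E a * ff_in E b. Proof. exact: rmorphM. Qed.
Lemma ff_inX a k : ff_in E (a ^+ k) = ff_in E a ^+ k. Proof. exact: rmorphXn. Qed.
Lemma ff_const0 : ff_const E 0 = 0. Proof. exact: rmorph0. Qed.

End FunctionFieldMorphisms.

Definition cubic (R : nzRingType) (A B : R) : {poly R} := 'X^3 + A *: 'X + B%:P.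

Section ShortFunctionField.
Variables (F : fieldType) (A B : F).
Let E := short_wcurve A B.
Let f := cubic A B.

Lemma size_cubic : size f = 4%N.
Proof.
rewrite /f /cubic -addrA size_polyDl ?size_polyXn //.
rewrite ltnS (leq_trans (size_polyD _ _)) // geq_max.
rewrite (leq_trans (size_scale_leq _ _)) ?size_polyX //=.
by rewrite (leq_trans (size_polyC_leq1 _)).
Qed.

Lemma cubic_neq0 : f != 0.
Proof. by rewrite -size_poly_eq0 size_cubic. Qed.

Lemma weierstrass_polyE : weierstrass_poly E = 'X^2 - (in_Fx f)%:P.
Proof.
rewrite /weierstrass_poly /in_Fx /= !scale0r polyC0 addr0 tofrac0 scale0r addr0.
by rewrite addr0.
Qed.

Lemma size_weierstrass_poly : size (weierstrass_poly E) = 3%N.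
Proof.
rewrite weierstrass_polyE size_polyDl ?size_polyXn // size_polyN.
by rewrite (leq_ltn_trans (size_polyC_leq1 _)).
Qed.

Lemma ff_y_sqr : ff_y E ^+ 2 = ff_in E (in_Fx f).
Proof.
apply/eqP; rewrite -subr_eq0; apply/eqP.
have -> : ff_y E ^+ 2 - ff_in E (in_Fx f)
    = in_qpoly (weierstrass_poly E) (weierstrass_poly E).
  by rewrite [X in _ = in_qpoly _ X]weierstrass_polyE rmorphB rmorphXn.
apply: val_inj; rewrite /= mk_monic_weierstrass.
by rewrite Pdiv.Ring.rmodpp // /GRing.comm mulrC.
Qed.

Lemma ff_split z : exists a b, z = ff_in E a + ff_in E b * ff_y E.
Proof.
have e : size (mk_monic (weierstrass_poly E)) = 3%N.
  by rewrite mk_monic_weierstrass size_weierstrass_poly.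
pose p : {poly {fraction {poly F}}} := val z.
have sz : (size p < 3)%N.
  by rewrite ltnS; apply: leq_trans (valP z) _; rewrite e.
exists p`_0, p`_1; transitivity (in_qpoly (weierstrass_poly E) p).
  by apply: val_inj; symmetry; apply: in_qpoly_small; apply: leq_trans sz _; rewrite e.
rewrite /ff_in /ff_y -rmorphM -rmorphD; congr in_qpoly.
apply/polyP => -[|[|i]]; rewrite coefD coefC coefCM coefX ?mulr0 ?mulr1 ?addr0 ?add0r //.
by rewrite nth_default // -ltnS (leq_trans sz).
Qed.

Lemma ff_split_eq0 a b : ff_in E a + ff_in E b * ff_y E = 0 -> a = 0 /\ b = 0.
Proof.
rewrite /ff_in /ff_y -rmorphM -rmorphD => h0.
pose p : {poly {fraction {poly F}}} := a%:P + b%:P * 'X.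
have sz : (size p < 3)%N.
  rewrite ltnS (leq_trans (size_polyD _ _)) // geq_max.
  rewrite (leq_trans (size_polyC_leq1 _)) //=.
  by rewrite mul_polyC (leq_trans (size_scale_leq _ _)) ?size_polyX.
have p0 : p = 0.
  rewrite -(@in_qpoly_small _ (weierstrass_poly E) p); first by rewrite h0.
  by rewrite mk_monic_weierstrass size_weierstrass_poly.
have h i : p`_i = 0 by rewrite p0 coef0.
move: (h 0%N) (h 1%N); rewrite !coefD !coefC !coefCM !coefX /=.
by rewrite mulr0 mulr1 addr0 add0r.
Qed.

Lemma ff_split_inj a b c d :
  ff_in E a + ff_in E b * ff_y E = ff_in E c + ff_in E d * ff_y E ->
  a = c /\ b = d.
Proof.
move/eqP; rewrite -subr_eq0 => /eqP h.
have /ff_split_eq0 [/eqP + /eqP] : ff_in E (a - c) + ff_in E (b - d) * ff_y E = 0.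
  by rewrite -[RHS]h !rmorphB mulrBl opprD addrACA.
by rewrite !subr_eq0 => /eqP -> /eqP ->.
Qed.

End ShortFunctionField.

(** * Values of forms at the generic point and at points of extensions *)

Lemma mpoly_closed_ind (n : nat) (R : comNzRingType) (P : {mpoly R[n]} -> Prop) :
  (forall c, P c%:MP) -> (forall i, P 'X_i) ->
  (forall p q, P p -> P q -> P (p + q)) -> (forall p q, P p -> P q -> P (p * q)) ->
  forall p, P p.
Proof.
move=> PC PX PD PM p; rewrite [p]mpolyE.
elim/big_ind: _ => [||m _]; [by rewrite -mpolyC0| exact: PD |].
rewrite -mul_mpolyC; apply: (PM) => //; rewrite mpolyXE_id.
elim/big_ind: _ => [||i _]; [by rewrite -mpolyC1| exact: PM |].
elim: (m i) => [|k IH]; first by rewrite expr0 -mpolyC1.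
by rewrite exprS; apply: (PM).
Qed.

Lemma mmapM (n : nat) (R : nzRingType) (S : comNzRingType) (iota : {rmorphism R -> S})
    (h : 'I_n -> S) (p q : {mpoly R[n]}) :
  mmap iota h (p * q) = mmap iota h p * mmap iota h q.
Proof. exact: (mmap_is_multiplicative h iota).1. Qed.

Lemma mmap_exp (n : nat) (R : nzRingType) (S : comNzRingType) (iota : {rmorphism R -> S})
    (h : 'I_n -> S) (p : {mpoly R[n]}) (k : nat) :
  mmap iota h (p ^+ k) = mmap iota h p ^+ k.
Proof.
elim: k => [|k IH]; last by rewrite !exprS mmapM IH.
by rewrite !expr0; exact: (mmap_is_multiplicative h iota).2.
Qed.

Lemma mmap_var (n : nat) (R : nzRingType) (S : comNzRingType) (iota : {rmorphism R -> S})
    (h : 'I_n -> S) (j : 'I_n) :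
  mmap iota h 'X_j = h j.
Proof. by rewrite mmapX mmap1U. Qed.

Lemma mul_split (R : comPzRingType) (a b c d y : R) :
  (a + b * y) * (c + d * y) = (a * c + b * d * y ^+ 2) + (a * d + b * c) * y.
Proof. by ring. Qed.

Section Evaluation.
Variables (F : fieldType) (A B : F).
Let E := short_wcurve A B.
Let f := cubic A B.

(** Reduction modulo y^2 = f is done once: the same pair [g0], [g1] describes G in F(E) and at every
    affine point over every extension. This is how relations in F(E) are transferred to points. *)
Lemma eval_generic_split (G : {mpoly F[3]}) : exists g0 g1 : {poly F},
  eval_generic E G = ff_in E (in_Fx g0) + ff_in E (in_Fx g1) * ff_y E /\
  forall (L : fieldType) (iota : {rmorphism F -> L}) x y,
    y ^+ 2 = (map_poly iota f).[x] ->
    mmap iota (coords (Some (x, y))) G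
    = (map_poly iota g0).[x] + (map_poly iota g1).[x] * y.
Proof.
have in0 : ff_in E (in_Fx 0) = 0 by rewrite /in_Fx tofrac0 ff_in0.
have inD a b : ff_in E (in_Fx (a + b)) = ff_in E (in_Fx a) + ff_in E (in_Fx b).
  by rewrite /in_Fx tofracD ff_inD.
have inM a b : ff_in E (in_Fx (a * b)) = ff_in E (in_Fx a) * ff_in E (in_Fx b).
  by rewrite /in_Fx tofracM ff_inM.
have in1 : ff_in E (in_Fx 1) = 1 by rewrite /in_Fx tofrac1 ff_in1.
elim/mpoly_closed_ind: G => [c|i|p q [p0 [p1 [pE pP]]] [q0 [q1 [qE qP]]]
                            |p q [p0 [p1 [pE pP]]] [q0 [q1 [qE qP]]]].
- exists c%:P, 0; split=> [|L iota x y _].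
    by rewrite /eval_generic mmapC in0 mul0r addr0.
  by rewrite mmapC map_polyC hornerC rmorph0 horner0 mul0r addr0.
- rewrite /eval_generic; case: i => -[|[|[|//]]] hi.
  + exists 'X, 0; split=> [|L iota x y _].
      by rewrite mmapX mmap1U /coords /= in0 mul0r addr0.
    by rewrite mmapX mmap1U /coords /= map_polyX hornerX rmorph0 horner0 mul0r addr0.
  + exists 0, 1; split=> [|L iota x y _].
      by rewrite mmapX mmap1U /coords /= in0 in1 mul1r add0r.
    by rewrite mmapX mmap1U /coords /= rmorph0 horner0 rmorph1 hornerC mul1r add0r.
  + exists 1, 0; split=> [|L iota x y _].
      by rewrite mmapX mmap1U /coords /= in0 in1 mul0r addr0.
    by rewrite mmapX mmap1U /coords /= rmorph0 horner0 rmorph1 hornerC mul0r addr0.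
- exists (p0 + q0), (p1 + q1); split=> [|L iota x y xy].
    rewrite /eval_generic in pE qE *.
    by rewrite mmapD pE qE !inD mulrDl addrACA.
  by rewrite mmapD pP // qP // !rmorphD !hornerD mulrDl addrACA.
- exists (p0 * q0 + p1 * q1 * f), (p0 * q1 + p1 * q0); split=> [|L iota x y xy].
    rewrite /eval_generic in pE qE *.
    rewrite mmapM pE qE.
    rewrite !inD !inM -(ff_y_sqr A B) -/E.
    exact: mul_split.
  rewrite mmapM pP // qP //.
  have hD u v : (map_poly iota (u + v)).[x] = (map_poly iota u).[x] + (map_poly iota v).[x].
    by rewrite rmorphD hornerD.
  have hM u v : (map_poly iota (u * v)).[x] = (map_poly iota u).[x] * (map_poly iota v).[x].
    by rewrite rmorphM hornerM.
  rewrite (hD (p0 * q0)) (hD (p0 * q1)) (hM p0 q0) (hM (p1 * q1)) (hM p1 q1).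
  rewrite (hM p0 q1) (hM p1 q0) -xy; apply: mul_split.
Qed.

End Evaluation.

(** * Homogenizations of polynomials in x *)

Section Homogenization.
Variables (F : fieldType).

Lemma homogXn (j : 'I_3) k : ('X_j ^+ k : {mpoly F[3]}) \is k.-homog.
Proof.
have h : ('X_j : {mpoly F[3]}) \is 1.-homog by rewrite dhomogX /= mdeg1.
by have := dhomogMn k h; rewrite mul1n.
Qed.

Definition hom_poly (m : nat) (p : {poly F}) : {mpoly F[3]} :=
  \sum_(i < m.+1) p`_i *: ('X_(inord 0) ^+ i * 'X_(inord 2) ^+ (m - i)).

Lemma hom_polyP m p : hom_poly m p \is m.-homog.
Proof.
apply: rpred_sum => i _; apply: rpredZ.
suff h : ('X_(inord 0) ^+ i * 'X_(inord 2) ^+ (m - i) : {mpoly F[3]}) \is (i + (m - i)).-homog.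
  by rewrite subnKC ?leq_ord // in h.
by apply: dhomogM; apply: homogXn.
Qed.

Lemma mmap_hom_poly (S : comNzRingType) (iota : {rmorphism F -> S}) m (p : {poly F}) (P : 'I_3 -> S) :
  (size p <= m.+1)%N -> P (inord 2) = 1 ->
  mmap iota P (hom_poly m p) = (map_poly iota p).[P (inord 0)].
Proof.
move=> sp P2; rewrite /hom_poly raddf_sum /=.
rewrite (@horner_coef_wide _ m.+1); last exact: leq_trans (size_poly _ _) sp.
apply: eq_bigr => i _.
by rewrite mmapZ mmapM !mmap_exp !mmap_var P2 expr1n mulr1 coef_map.
Qed.

(* On the curve x ^ 3 = y ^ 2 - A x - B, so that a polynomial in x of degree at
   most 3k has a homogenization of degree 2k, whose value at O is the
   coefficient of x ^ 3k. *)
Variables (A B : F).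
Let E := short_wcurve A B.

Definition cubeH : {mpoly F[3]} :=
  'X_(inord 1) ^+ 2 - A *: ('X_(inord 0) * 'X_(inord 2)) - B *: 'X_(inord 2) ^+ 2.

Definition hom_cubic (k : nat) (p : {poly F}) : {mpoly F[3]} :=
  \sum_(i < (3 * k).+1) p`_i *:
    (cubeH ^+ (i %/ 3) * ('X_(inord 0) ^+ (i %% 3)
                          * 'X_(inord 2) ^+ (2 * k - 2 * (i %/ 3) - i %% 3))).

Lemma hom_cubicP k p : hom_cubic k p \is (2 * k).-homog.
Proof.
apply: rpred_sum => i _; apply: rpredZ.
have le_ik : (2 * (i %/ 3) + i %% 3 <= 2 * k)%N.
  by have := ltn_ord i; have := divn_eq i 3; have := ltn_pmod i (isT : 0 < 3)%N; lia.
have e : (2 * k = (2 * (i %/ 3)) + ((i %% 3) + (2 * k - 2 * (i %/ 3) - i %% 3)))%N.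
  by rewrite addnA -subnDA subnKC.
have hX (j : 'I_3) : ('X_j : {mpoly F[3]}) \is 1.-homog by rewrite dhomogX /= mdeg1.
suff hH : cubeH \is 2.-homog.
  have := dhomogM (dhomogMn (i %/ 3) hH) (dhomogM
    (homogXn (inord 0) (i %% 3)) (homogXn (inord 2) (2 * k - 2 * (i %/ 3) - i %% 3))).
  by rewrite -e.
rewrite /cubeH.
apply: rpredB; first apply: rpredB.
- exact: homogXn.
- by apply: rpredZ; exact: (dhomogM (hX _) (hX _)).
- by apply: rpredZ; apply: homogXn.
Qed.

Lemma mmap_hom_cubic (S : comNzRingType) (iota : {rmorphism F -> S}) k (p : {poly F}) (x y : S) :
  y ^+ 2 = x ^+ 3 + iota A * x + iota B -> (size p <= (3 * k).+1)%N ->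
  mmap iota (coords (Some (x, y))) (hom_cubic k p) = (map_poly iota p).[x].
Proof.
move=> xy sp; rewrite /hom_cubic raddf_sum /=.
rewrite (@horner_coef_wide _ (3 * k).+1); last exact: leq_trans (size_poly _ _) sp.
apply: eq_bigr => i _.
rewrite mmapZ !mmapM !mmap_exp !mmap_var coef_map /=; congr (_ * _).
have -> : mmap iota (coords (Some (x, y))) cubeH = x ^+ 3.
  rewrite /cubeH !mmapB !mmapZ !mmap_exp mmapM !mmap_var /coords !inordK //= xy expr1n !mulr1.
  by rewrite addrAC !addrK.
rewrite /coords !inordK //= expr1n mulr1 -exprM -exprD.
by rewrite mulnC -divn_eq.
Qed.

(** At [0 : 1 : 0] the form [cubeH] is 1, and a monomial survives only when neither of the other two
    variables occurs in it, that is for i = 3k. *)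
Lemma mmap_hom_cubic_infty k (p : {poly F}) :
  mmap idfun (coords None) (hom_cubic k p) = p`_(3 * k) :> F.
Proof.
have HE : mmap idfun (coords None) cubeH = 1 :> F.
  rewrite /cubeH !mmapB !mmapZ !mmap_exp mmapM !mmap_var /coords !inordK //=.
  by rewrite expr1n mulr0 expr0n /= !mulr0 !subr0.
rewrite /hom_cubic raddf_sum /= big_ord_recr big1 /=.
  rewrite add0r mulKn // mulnC modnMl mmapZ !mmapM !mmap_exp HE !mmap_var expr1n mulnC.
  by rewrite subnn sub0n !expr0 !mulr1 mulnC.
move=> i _ /=; rewrite mmapZ !mmapM !mmap_exp HE !mmap_var expr1n /coords !inordK //= !expr0n.
case: eqP => [m0|]; last by rewrite mul0r !mulr0.
have lt_k : (i %/ 3 < k)%N by have := ltn_ord i; rewrite ltn_divLR //; lia.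
by rewrite m0 subn0 subn_eq0 leq_mul2l /= leqNgt lt_k !mulr0.
Qed.

End Homogenization.

Lemma size_mul_monic_bound (F : fieldType) (p q : {poly F}) a b :
  size p = a.+1 -> size q = b.+1 -> size (p * q) = (a + b).+1.
Proof.
move=> sp sq.
have p0 : p != 0 by rewrite -size_poly_gt0 sp.
have q0 : q != 0 by rewrite -size_poly_gt0 sq.
by rewrite size_mul // sp sq /= addnS.
Qed.

Lemma size_exp_eq (F : fieldType) (p : {poly F}) a k :
  size p = a.+1 -> size (p ^+ k) = (k * a).+1.
Proof.
move=> sp; elim: k => [|k IH]; first by rewrite expr0 size_poly1.
by rewrite exprS (size_mul_monic_bound sp IH) mulSn.
Qed.

Lemma weierstrass_fraction (K : fieldType) (A B f u v d : K) : d != 0 ->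
  f * v ^+ 2 = u ^+ 3 + A * (u * d ^+ 4) + B * d ^+ 6 ->
  f * (v / d ^+ 3) ^+ 2 = (u / d ^+ 2) ^+ 3 + A * (u / d ^+ 2) + B.
Proof.
move=> d0 h.
have -> : f * (v / d ^+ 3) ^+ 2 = (f * v ^+ 2) / d ^+ 6 by field.
by rewrite h; field.
Qed.

Lemma rmorph_weierstrass (K S : comNzRingType) (j : {rmorphism K -> S}) (y : S)
    (f a b A B : K) : y ^+ 2 = j f -> f * a ^+ 2 = b ^+ 3 + A * b + B ->
  (j a * y) ^+ 2 = j b ^+ 3 + j A * j b + j B.
Proof.
move=> yf h; rewrite -rmorphXn -rmorphM -!rmorphD -h rmorphM rmorphXn -yf /=.
by rewrite exprMn mulrC.
Qed.

Lemma mul_num_x (K : fieldType) (u d : K) : d != 0 -> u * d = d ^+ 3 * (u / d ^+ 2).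
Proof. by move=> d0; field. Qed.

Lemma mul_num_y (K : fieldType) (v d : K) : d != 0 -> v = d ^+ 3 * (v / d ^+ 3).
Proof. by move=> d0; field. Qed.

Lemma rmorph_numX (S : comNzRingType) (R : idomainType)
    (j : {rmorphism {fraction R} -> S}) (u d : R) : tofrac d != 0 ->
  j (tofrac (u * d)) = j (tofrac (d ^+ 3)) * j (tofrac u / tofrac d ^+ 2).
Proof. by move=> d0; rewrite -rmorphM tofracM tofracXn -mul_num_x. Qed.

Lemma rmorph_numY (S : comNzRingType) (R : idomainType)
    (j : {rmorphism {fraction R} -> S}) (v d : R) (y : S) : tofrac d != 0 ->
  y * j (tofrac v) = j (tofrac (d ^+ 3)) * (j (tofrac v / tofrac d ^+ 3) * y).
Proof.
by move=> d0; rewrite mulrC mulrA -rmorphM tofracXn -mul_num_y.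
Qed.

(** * Maps (U/D^2, y V/D^3) and their value at infinity *)

Section IsogenyData.
Variables (F : fieldType) (A B A2 B2 : F).
Let E := short_wcurve A B.
Let E2 := short_wcurve A2 B2.
Let f := cubic A B.

(* The rational map (x, y) |-> (U / D ^ 2, y V / D ^ 3). *)
Definition xy_map (U V D : {poly F}) : rational_map E :=
  (ff_in E (in_Fx U / in_Fx D ^+ 2), ff_in E (in_Fx V / in_Fx D ^+ 3) * ff_y E).

(** The degrees make U/D^2 grow like x and V/D^3 like a constant, so that O goes to O. The equation
    is that of the target, multiplied by D^6. Coprimality is not demanded: a 2-isogeny fits with
    numerators multiplied by D, and composites need no reduction. *)
Definition isogeny_data (h : nat) (U V D : {poly F}) : Prop :=
  [/\ size U = (2 * h).+2, size V = (3 * h).+1, size D = h.+1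
    & f * V ^+ 2 = U ^+ 3 + A2 *: (U * D ^+ 4) + B2 *: D ^+ 6].

Lemma maps_to_intro (phi : rational_map E) (L : fieldType) (iota : F -> L)
    (P Q : point L) (m : nat) (G0 G1 G2 : {mpoly F[3]}) (z : function_field E) (c : L) :
  [/\ G0 \is m.-homog, G1 \is m.-homog & G2 \is m.-homog] ->
  [/\ eval_generic E G0 = z * phi.1, eval_generic E G1 = z * phi.2
    & eval_generic E G2 = z] ->
  c != 0 ->
  [/\ mmap iota (coords P) G0 = c * coords Q (inord 0),
      mmap iota (coords P) G1 = c * coords Q (inord 1)
    & mmap iota (coords P) G2 = c * coords Q (inord 2)] ->
  maps_to phi iota P Q.
Proof.
move=> [h0 h1 h2] [e0 e1 e2] c0 [m0 m1 m2].
pose G (i : 'I_3) := [:: G0; G1; G2]`_i.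
have I3 (P' : 'I_3 -> Prop) : P' (inord 0) -> P' (inord 1) -> P' (inord 2) -> forall i, P' i.
  move=> p0 p1 p2 i; rewrite -[i]inord_val.
  by case: i => -[|[|[|//]]] hi /=.
have GE i : eval_generic E (G i) = z * coords (Some phi) i.
  apply: (I3 (fun i => eval_generic E (G i) = z * coords (Some phi) i)).
  - by rewrite /G /coords !inordK //= e0; case: (phi).
  - by rewrite /G /coords !inordK //= e1; case: (phi).
  - by rewrite /G /coords !inordK //= e2; case: (phi) => *; rewrite mulr1.
exists m, G; split.
- by apply: I3; rewrite /G inordK.
- by move=> i j; rewrite !GE mulrAC.
- exists c => //.
  by apply: (I3 (fun i => mmap iota (coords P) (G i) = c * coords Q i)); rewrite /G inordK.
Qed.

Lemma ff_horner (p : {poly F}) : (map_poly (ff_const E) p).[ff_x E] = ff_in E (in_Fx p).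
Proof.
elim/poly_ind: p => [|p c IH].
  by rewrite (rmorph0 (map_poly (ff_const E))) horner0 /in_Fx tofrac0 ff_in0.
rewrite (rmorphD (map_poly (ff_const E))) (rmorphM (map_poly (ff_const E))) /=.
rewrite map_polyX map_polyC hornerD hornerMX hornerC IH.
by rewrite /in_Fx tofracD tofracM ff_inD ff_inM.
Qed.

Lemma ff_weierstrass :
  ff_y E ^+ 2 = ff_x E ^+ 3 + ff_const E A * ff_x E + ff_const E B.
Proof.
rewrite ff_y_sqr /cubic -mul_polyC /in_Fx !tofracD tofracXn tofracM.
by rewrite ff_inD ff_inD ff_inX ff_inM.
Qed.

(** U D has degree 3h+1, one too many for [hom_cubic] at h. One factor x is therefore split off and
    the constant term is homogenized apart, to total degree 2h+1. *)
Definition hom_numX (h : nat) (U D : {poly F}) : {mpoly F[3]} :=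
  'X_(inord 0) * hom_cubic A B h (\poly_(i < (3 * h).+1) (U * D)`_i.+1)
  + (U * D)`_0 *: 'X_(inord 2) ^+ (1 + 2 * h).

Lemma mmap_hom_data (S : comNzRingType) (iota : {rmorphism F -> S}) (x y : S)
    (h : nat) (U V D : {poly F}) :
  size U = (2 * h).+2 -> size V = (3 * h).+1 -> size D = h.+1 ->
  y ^+ 2 = x ^+ 3 + iota A * x + iota B ->
  let ev := mmap iota (coords (Some (x, y))) in
  [/\ ev (hom_numX h U D) = (map_poly iota (U * D)).[x],
      ev ('X_(inord 1) * hom_cubic A B h V) = y * (map_poly iota V).[x]
    & ev ('X_(inord 2) * hom_cubic A B h (D ^+ 3)) = (map_poly iota (D ^+ 3)).[x]].
Proof.
move=> sU sV sD xy ev.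
have sUD : size (U * D) = (3 * h).+2 by rewrite (size_mul_monic_bound sU sD); congr _.+1; lia.
have sD3 : (size (D ^+ 3) <= (3 * h).+1)%N by rewrite (size_exp_eq 3 sD).
rewrite /ev /hom_numX mmapD !mmapM mmapZ mmap_exp !mmap_var.
rewrite !(mmap_hom_cubic xy) ?sV ?size_poly // /coords !inordK //= expr1n mul1r mulr1.
split=> //; set W := \poly_(i < _) _.
have {2}-> : U * D = W * 'X + ((U * D)`_0)%:P.
  apply/polyP => -[|i]; rewrite coefD coefMX coefC /= ?add0r // addr0 coef_poly.
  by case: ltnP => // hi; rewrite nth_default // sUD.
by rewrite rmorphD rmorphM /= map_polyX map_polyC hornerD hornerMX hornerC mulrC.
Qed.

Lemma isogeny_data_isogeny h U V D : isogeny_data h U V D -> isogeny E E2 (xy_map U V D).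
Proof.
move=> [sU sV sD eq].
have D0 : in_Fx D != 0 by rewrite /in_Fx tofrac_eq0 -size_poly_gt0 sD.
split.
  have K : in_Fx f * (in_Fx V / in_Fx D ^+ 3) ^+ 2 = (in_Fx U / in_Fx D ^+ 2) ^+ 3
      + in_Fx A2%:P * (in_Fx U / in_Fx D ^+ 2) + in_Fx B2%:P.
    apply: weierstrass_fraction => //.
    rewrite /in_Fx -!tofracXn -!tofracM -!tofracD; congr tofrac.
    by rewrite -/f eq -!mul_polyC.
  rewrite /on_curve /xy_map /=.
  move: (in_Fx V / _) (in_Fx U / _) K => a b K.
  rewrite ff_const0 !mul0r !addr0.
  exact: (rmorph_weierstrass (j := ff_in E) (ff_y_sqr A B) K).
have lV : V`_(3 * h) != 0.
  have := lead_coef_eq0 V; rewrite lead_coefE sV /= => ->.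
  by rewrite -size_poly_gt0 sV.
have hX (j : 'I_3) : ('X_j : {mpoly F[3]}) \is 1.-homog by rewrite dhomogX /= mdeg1.
(* The map is [U D : y V : D^3], lifted to forms of degree 2h+1. At O only the middle one survives,
   with value the leading coefficient of V. *)
apply: (@maps_to_intro _ _ _ _ _ (1 + 2 * h) (hom_numX h U D)
  ('X_(inord 1) * hom_cubic A B h V) ('X_(inord 2) * hom_cubic A B h (D ^+ 3))
  (ff_in E (in_Fx (D ^+ 3))) V`_(3 * h)) => //.
- split; try by exact: (dhomogM (hX _) (hom_cubicP _ _ _ _)).
  apply: rpredD; first exact: (dhomogM (hX _) (hom_cubicP _ _ _ _)).
  by apply: rpredZ; apply: homogXn.
- have [e0 e1 e2] := mmap_hom_data sU sV sD ff_weierstrass.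
  split.
  + exact: (etrans e0 (etrans (ff_horner _) (rmorph_numX (ff_in E) U D0))).
  + apply: (etrans e1); apply: (etrans (congr1 (fun z => _ * z) (ff_horner _))).
    exact: (rmorph_numY (ff_in E) V _ D0).
  + exact: (etrans e2 (ff_horner _)).
- rewrite /hom_numX mmapD !mmapM mmapZ mmap_exp !mmap_var !mmap_hom_cubic_infty /coords !inordK //=.
  by rewrite expr0n /= !mul0r !mulr0 mul1r mulr1 addr0.
Qed.

End IsogenyData.

(** * Affine points sent to infinity *)

Lemma split_mul_y (K S : comNzRingType) (j : {rmorphism K -> S}) (y : S) (f a b w : K) :
  y ^+ 2 = j f ->
  (j a + j b * y) * (j w * y) = j (b * w * f) + j (a * w) * y.
Proof.
by move=> yf; rewrite !rmorphM /= -yf; ring. Qed.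

Lemma divr_cancel3 (K : fieldType) (c v d f : K) : d != 0 ->
  c * (v / d ^+ 3) * f * d ^+ 3 = c * v * f.
Proof. by move=> d0; field. Qed.

Section Coordinates.
Variables (R : pzRingType) (x y : R).

Lemma coords_affine0 : coords (Some (x, y)) (inord 0) = x.
Proof. by rewrite /coords inordK. Qed.
Lemma coords_affine1 : coords (Some (x, y)) (inord 1) = y.
Proof. by rewrite /coords inordK. Qed.
Lemma coords_affine2 : coords (Some (x, y)) (inord 2) = 1.
Proof. by rewrite /coords inordK. Qed.
Lemma coords_infty0 : coords (None : point R) (inord 0) = 0.
Proof. by rewrite /coords inordK. Qed.
Lemma coords_infty1 : coords (None : point R) (inord 1) = 1.
Proof. by rewrite /coords inordK. Qed.
Lemma coords_infty2 : coords (None : point R) (inord 2) = 0.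
Proof. by rewrite /coords inordK. Qed.

End Coordinates.

Lemma rmorph_numX2 (S : comNzRingType) (K : fieldType) (j : {rmorphism K -> S})
    (u d : K) (y : S) : d != 0 -> y * j u = j d * y * j (u * d / d ^+ 2).
Proof.
move=> d0; have {1}-> : u = d * (u * d / d ^+ 2) by field.
by rewrite rmorphM; ring.
Qed.

Lemma rmorph_numY2 (S : comNzRingType) (K : fieldType) (j : {rmorphism K -> S})
    (v d q : K) (y : S) : d != 0 -> y ^+ 2 = j (d * q) ->
  j (v * q) = j d * y * (j (v * d / d ^+ 3) * y).
Proof.
move=> d0 yf; have -> : v * q = d * (v * d / d ^+ 3) * (d * q) by field.
by rewrite rmorphM -yf rmorphM; ring.
Qed.

Section Kernel.
Variables (F : fieldType) (A B : F).
Let E := short_wcurve A B.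
Let f := cubic A B.
Variables (L : fieldType) (iota : {rmorphism F -> L}) (x y : L).
Hypothesis xy : y ^+ 2 = (map_poly iota f).[x].

(** Comparing components in G1 = G2 Y gives G1 D^3 = V y G2 at the point. If D(x) were nonzero,
    G2(P) = 0 would force G1(P) = 0, whereas G1(P) is the nonzero coordinate of O. *)
Lemma maps_to_infty_root (U V D : {poly F}) : D != 0 ->
  maps_to (xy_map A B U V D) iota (Some (x, y)) None -> root (map_poly iota D) x.
Proof.
move=> D0 [m [G [_ rel [c c0 GP]]]].
have d0 : in_Fx D != 0 by rewrite /in_Fx tofrac_eq0.
have [b0 [b1 [bE bP]]] := eval_generic_split A B (G (inord 1)).
have [c1 [c2 [cE cP]]] := eval_generic_split A B (G (inord 2)).
have e0 := etrans (rel (inord 1) (inord 2))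
  (congr1 (fun z => eval_generic E (G (inord 2)) * z) (coords_affine1 _ _)).
have e1 := etrans (esym (etrans (congr1 (fun z => _ * z) (coords_affine2 _ _)) (mulr1 _))) e0.
have {e0} := etrans (esym bE) e1.
move=> {}e1.
have e2 := etrans e1 (congr1 (fun z => z * _) cE).
have e3 := etrans e2 (split_mul_y _ _ _ (ff_y_sqr A B)).
have [r0 r1] := ff_split_inj e3.
have {}r0 : b0 * D ^+ 3 = c2 * V * f.
  apply/eqP; rewrite -tofrac_eq tofracM tofracXn !tofracM; apply/eqP.
  by move: r0; rewrite /in_Fx => ->; exact: divr_cancel3.
have {}r1 : b1 * D ^+ 3 = c1 * V.
  apply/eqP; rewrite -tofrac_eq tofracM tofracXn !tofracM; apply/eqP.
  by move: r1; rewrite /in_Fx => ->; by have := divr_cancel3 (tofrac c1) (tofrac V) 1 d0; rewrite !mulr1.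
clear e1 e2 e3 rel bE cE.
apply/negPn/negP => nroot; case/eqP: c0.
have := GP (inord 1); rewrite (bP _ _ _ _ xy) coords_infty1 mulr1 => <-.
have := GP (inord 2); rewrite (cP _ _ _ _ xy) coords_infty2 mulr0 => eq0.
have nD : (map_poly iota D).[x] ^+ 3 != 0 by rewrite expf_neq0.
apply: (mulIf nD); rewrite mul0r mulrDl.
have hM p q : (map_poly iota (p * q)).[x] = (map_poly iota p).[x] * (map_poly iota q).[x].
  by rewrite rmorphM hornerM.
have hX p : (map_poly iota (p ^+ 3)).[x] = (map_poly iota p).[x] ^+ 3.
  by rewrite rmorphXn horner_exp.
have h0 := congr1 (fun p => (map_poly iota p).[x]) r0.
have h1 := congr1 (fun p => (map_poly iota p).[x]) r1.
rewrite /= (hM b0) hX (hM (c2 * V)) (hM c2) -xy in h0.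
rewrite /= (hM b1) hX (hM c1) in h1.
transitivity ((map_poly iota V).[x] * y * 0); last by rewrite mulr0.
by rewrite h0 [X in _ + X = _]mulrAC h1 -eq0; ring.
Qed.

Lemma eval_hom_poly m (p : {poly F}) : (size p <= m.+1)%N ->
  eval_generic E (hom_poly m p) = ff_in E (in_Fx p).
Proof.
move=> sp; apply: etrans (ff_horner _ _ p).
apply: etrans (mmap_hom_poly _ sp (coords_affine2 _ _)) _.
exact: congr1 (coords_affine0 _ _).
Qed.

Lemma mmap_hom_affine m (p : {poly F}) : (size p <= m.+1)%N ->
  mmap iota (coords (Some (x, y))) (hom_poly m p) = (map_poly iota p).[x].
Proof.
by move=> sp; rewrite (mmap_hom_poly _ sp (coords_affine2 _ _)) coords_affine0.
Qed.

(** The forms [U D : y V : D^3], now homogenized naively to degree 3h+1, take the value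
    [0 : y V(x) : 0] at a root of D. *)
Lemma maps_to_infty_odd (h : nat) (U V D : {poly F}) :
  size U = (2 * h).+2 -> size V = (3 * h).+1 -> size D = h.+1 ->
  root (map_poly iota D) x -> ~~ root (map_poly iota V) x -> y != 0 ->
  maps_to (xy_map A B U V D) iota (Some (x, y)) None.
Proof.
move=> sU sV sD rD rV y0.
have d0 : in_Fx D != 0 by rewrite /in_Fx tofrac_eq0 -size_poly_gt0 sD.
have sUD : (size (U * D)%R <= (1 + 3 * h).+1)%N.
  by rewrite (size_mul_monic_bound sU sD) ltnS; lia.
have sD3 : (size (D ^+ 3) <= (1 + 3 * h).+1)%N by rewrite (size_exp_eq 3 sD) ltnS; lia.
have sV' : (size V <= (3 * h).+1)%N by rewrite sV.
have hX (j : 'I_3) : ('X_j : {mpoly F[3]}) \is 1.-homog by rewrite dhomogX /= mdeg1.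
apply: (@maps_to_intro _ _ _ _ _ _ _ _ (1 + 3 * h) (hom_poly (1 + 3 * h) (U * D))
  ('X_(inord 1) * hom_poly (3 * h) V) (hom_poly (1 + 3 * h) (D ^+ 3))
  (ff_in E (in_Fx (D ^+ 3))) ((map_poly iota V).[x] * y)).
- split; try exact: hom_polyP.
  exact: (dhomogM (hX _) (hom_polyP _ _)).
- split.
  + exact: (etrans (eval_hom_poly sUD) (rmorph_numX (ff_in E) U d0)).
  + apply: etrans (mmapM _ _ _ _) _.
    apply: etrans (congr1 (fun z => _ * z) (eval_hom_poly sV')) _.
    apply: etrans (congr1 (fun z => z * _) (etrans (mmap_var _ _ _) (coords_affine1 _ _))) _.
    exact: (rmorph_numY (ff_in E) V _ d0).
  + exact: eval_hom_poly.
- by rewrite mulf_neq0.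
- rewrite mmapM mmap_var !mmap_hom_affine // coords_affine1 coords_infty0 coords_infty1 coords_infty2.
  rewrite !mulr0 mulr1 [y * _]mulrC.
  have -> : (map_poly iota (U * D)).[x] = 0 by rewrite rmorphM hornerM (rootP rD) mulr0.
  by have -> : (map_poly iota (D ^+ 3)).[x] = 0 by rewrite rmorphXn horner_exp (rootP rD) expr0n.
Qed.

(** At the 2-torsion point both y and D vanish, so [U D : y V : D^3] is useless there. Multiplying
    the map by D y instead and using y^2 = D q gives [y U : V q : y D], which is [0 : V(a) q(a) : 0]
    at that point. *)
Lemma maps_to_infty_2torsion (a : F) (U V q : {poly F}) :
  f = ('X - a%:P) * q -> (size U <= 4)%N -> (size (V * q)%R <= 5)%N -> x = iota a ->
  ~~ root V a -> ~~ root q a ->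
  maps_to (xy_map A B (U * ('X - a%:P)) (V * ('X - a%:P)) ('X - a%:P)) iota (Some (x, y)) None.
Proof.
move=> fq sU sV xa rV rq; set D := 'X - a%:P.
have d0 : in_Fx D != 0 by rewrite /in_Fx tofrac_eq0 polyXsubC_eq0.
have sD : (size D <= 4)%N by rewrite size_XsubC.
have hX (j : 'I_3) : ('X_j : {mpoly F[3]}) \is 1.-homog by rewrite dhomogX /= mdeg1.
have y0 : y = 0.
  apply/eqP; rewrite -sqrf_eq0 xy fq rmorphM /= hornerM /D map_polyXsubC.
  by rewrite hornerXsubC xa subrr mul0r.
have yE (p : {poly F}) m : (size p <= m.+1)%N ->
  eval_generic E ('X_(inord 1) * hom_poly m p) = ff_y E * ff_in E (in_Fx p).
  move=> sp; apply: etrans (mmapM _ _ _ _) _.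
  apply: etrans (congr1 (fun z => _ * z) (eval_hom_poly sp)) _.
  exact: (congr1 (fun z => z * _) (etrans (mmap_var _ _ _) (coords_affine1 _ _))).
apply: (@maps_to_intro _ _ _ _ _ _ _ _ (1 + 3) ('X_(inord 1) * hom_poly 3 U)
  (hom_poly 4 (V * q)) ('X_(inord 1) * hom_poly 3 D)
  (ff_in E (in_Fx D) * ff_y E) (map_poly iota (V * q)).[x]).
- split; try exact: hom_polyP; exact: (dhomogM (hX _) (hom_polyP _ _)).
- split.
  + apply: etrans (yE _ _ sU) _.
    apply: etrans (rmorph_numX2 (ff_in E) (in_Fx U) (ff_y E) d0) _.
    by rewrite /xy_map /in_Fx tofracM.
  + apply: etrans (eval_hom_poly sV) _.
    have yq : ff_y E ^+ 2 = ff_in E (in_Fx D * in_Fx q).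
      by apply: etrans (ff_y_sqr A B) _; rewrite /in_Fx -tofracM -/f fq.
    have := rmorph_numY2 (in_Fx V) d0 yq.
    by rewrite /xy_map /in_Fx !tofracM.
  + by apply: etrans (yE _ _ sD) _; apply: mulrC.
- by rewrite xa horner_map fmorph_eq0 hornerM mulf_neq0.
- rewrite !mmapM !mmap_var !mmap_hom_affine // coords_affine1 coords_infty0 coords_infty1 coords_infty2.
  by rewrite y0 !mul0r !mulr0 mulr1; split.
Qed.

End Kernel.

(** * From a basis of F(x) over F(r) to a basis of F(E) over F(X, Y) *)

Section QuadraticPullback.
Variables (F K : fieldType) (S : comNzRingType).
Variables (kappa : {rmorphism F -> K}) (j : {rmorphism K -> S}) (iota : {rmorphism F -> S}).
Hypothesis iotaE : forall c, iota c = j (kappa c).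
Variables (y : S) (f0 : K).
Hypothesis yf : y ^+ 2 = j f0.
Hypothesis split_ex : forall z, exists a b, z = j a + j b * y.
Hypothesis split_inj : forall a b c d, j a + j b * y = j c + j d * y -> a = c /\ b = d.
Hypothesis f0_nonsquare : forall a b, a ^+ 2 = b ^+ 2 * f0 -> b = 0.
Variables (r s : K) (g : {poly F}).
Hypothesis s_neq0 : s != 0.
Let ev (c : {poly F}) : K := (map_poly kappa c).[r].
Hypothesis sg : f0 * s ^+ 2 = ev g.
Variables (p : nat) (x : 'I_p -> K).
Hypothesis ev_inj : forall c, ev c = 0 -> c = 0.
Hypothesis indep : forall c : 'I_p -> {poly F},
  \sum_i ev (c i) * x i = 0 -> forall i, c i = 0.
Hypothesis spans : forall z, exists n (c : 'I_p -> {poly F}),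
  n != 0 /\ z * ev n = \sum_i ev (c i) * x i.

Let Y := j s * y.
Let evm := mmap iota (fun i : 'I_2 => [:: j r; Y]`_i).
Let pull (z : S) := exists G H : {mpoly F[2]}, evm H <> 0 /\ z * evm H = evm G.

Let evD c d : ev (c + d) = ev c + ev d. Proof. by rewrite /ev rmorphD hornerD. Qed.
Let evB c d : ev (c - d) = ev c - ev d. Proof. by rewrite /ev rmorphB hornerD hornerN. Qed.
Let evM c d : ev (c * d) = ev c * ev d. Proof. by rewrite /ev rmorphM hornerM. Qed.
Let evC c : ev c%:P = kappa c. Proof. by rewrite /ev map_polyC hornerC. Qed.
Let evX : ev 'X = r. Proof. by rewrite /ev map_polyX hornerX. Qed.
Let ev0 : ev 0 = 0. Proof. by rewrite /ev rmorph0 horner0. Qed.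
Let ev1 : ev 1 = 1. Proof. by rewrite /ev rmorph1 hornerC. Qed.
Let ev_neq0 n : n != 0 -> ev n != 0.
Proof. by apply: contraNneq => /ev_inj ->. Qed.

Let Y2 : Y ^+ 2 = j (ev g).
Proof. by rewrite /Y exprMn yf -rmorphXn -rmorphM mulrC sg. Qed.

(** The subfield F(r) of K, with r as generator and [ev] as evaluation at r. *)
Definition subfield_frac (a : K) := exists c n, n != 0 /\ a * ev n = ev c.

Lemma evm_split G : exists a b, evm G = j (ev a) + j (ev b) * Y.
Proof.
elim/mpoly_closed_ind: G => [c|[[|[|//]] hi]|G H [a [b eG]] [c [d eH]]
                            |G H [a [b eG]] [c [d eH]]].
- by exists c%:P, 0; rewrite /evm mmapC /= iotaE evC ev0 rmorph0 mul0r addr0.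
- by exists 'X, 0; rewrite /evm mmap_var evX ev0 rmorph0 mul0r addr0.
- by exists 0, 1; rewrite /evm mmap_var ev1 ev0 rmorph0 rmorph1 mul1r add0r.
- exists (a + c), (b + d); rewrite /evm mmapD -/evm eG eH !evD !rmorphD.
  by rewrite mulrDl addrACA.
- exists (a * c + b * d * g), (a * d + b * c); rewrite /evm mmapM -/evm eG eH mul_split.
  by rewrite Y2 !evD !rmorphD !evM !rmorphM.
Qed.

Lemma evm_surj a b : exists G, evm G = j (ev a) + j (ev b) * Y.
Proof.
pose var (i : nat) : {mpoly F[2]} := 'X_(inord i).
have evp (c : {poly F}) : evm (map_poly (@mpolyC 2 F) c).[var 0%N] = j (ev c).
  elim/poly_ind: c => [|c k IH].
    by rewrite rmorph0 horner0 /evm mmap0 ev0 rmorph0.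
  rewrite rmorphD rmorphM /= map_polyX map_polyC hornerD hornerMX hornerC /=.
  rewrite /evm mmapD mmapM mmapC (mmap_var _ _ (inord 0)) -/(evm _) IH inordK //= iotaE.
  by rewrite evD evM evX evC rmorphD rmorphM.
exists ((map_poly (@mpolyC 2 F) a).[var 0%N] + (map_poly (@mpolyC 2 F) b).[var 0%N] * var 1%N).
by rewrite /evm mmapD mmapM (mmap_var _ _ (inord 1)) -!/(evm _) !evp inordK.
Qed.

(** This is F(X, Y) = F(r) + F(r) Y. A denominator a + b Y is rationalized by a - b Y, and the norm
    a^2 - b^2 g is nonzero because [f0] is not a square in K. *)
Lemma pullP z : pull z <->
  exists a b, [/\ subfield_frac a, subfield_frac b & z = j a + j b * Y].
Proof.
split.
- move=> [G [H [H0 zH]]].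
  have [a [b eH]] := evm_split H; have [c [d eG]] := evm_split G.
  pose nu := a ^+ 2 - b ^+ 2 * g.
  have nu0 : nu != 0.
    apply/eqP => n0; apply: H0; rewrite eH.
    have /eqP : ev nu = 0 by rewrite n0 ev0.
    rewrite /nu evB evM !expr2 !evM -!expr2 -sg subr_eq0 => /eqP h.
    have /f0_nonsquare/eqP : ev a ^+ 2 = (ev b * s) ^+ 2 * f0 by rewrite h; ring.
    rewrite mulf_eq0 (negbTE s_neq0) orbF => /eqP b0.
    move: h; rewrite b0 expr0n mul0r => /eqP; rewrite sqrf_eq0 => /eqP a0.
    by rewrite a0 rmorph0 mul0r addr0.
  have znu : z * j (ev nu) = j (ev (a * c - b * d * g)) + j (ev (a * d - b * c)) * Y.
    transitivity (z * evm H * (j (ev a) - j (ev b) * Y)).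
      rewrite -mulrA eH /nu; congr (_ * _).
      by rewrite evB evM !expr2 !evM !rmorphB !rmorphM -Y2; ring.
    rewrite zH eG !evB !evM !rmorphB !rmorphM -Y2; ring.
  have nu1 := ev_neq0 nu0.
  exists (ev (a * c - b * d * g) / ev nu), (ev (a * d - b * c) / ev nu); split.
  + by exists (a * c - b * d * g), nu; rewrite divfK.
  + by exists (a * d - b * c), nu; rewrite divfK.
  + rewrite -[LHS]mulr1 -(rmorph1 j) -(divff nu1) rmorphM mulrA znu !rmorphM; ring.
- move=> [a [b [[c [n [n0 ac]]] [d [m [m0 bd]]] ->]]].
  have [G eG] := evm_surj (c * m) (d * n); have [H eH] := evm_surj (n * m) 0.
  exists G, H; rewrite eG eH ev0 rmorph0 mul0r addr0; split.
    have h : ev (n * m) != 0 by rewrite ev_neq0 // mulf_neq0.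
    move=> h0; case/eqP: h; have [] // := @split_inj (ev (n * m)) 0 0 0.
    by rewrite h0 !rmorph0.
  by rewrite !evM -ac -bd !rmorphM; ring.
Qed.

Lemma frac_indep (a : 'I_p -> K) : (forall i, subfield_frac (a i)) ->
  \sum_i a i * x i = 0 -> forall i, a i = 0.
Proof.
move=> /fin_all_exists [c /fin_all_exists [n hn]] sum0.
pose N := \prod_i n i; pose N' i := \prod_(k | k != i) n k.
have NE i : N = n i * N' i by rewrite /N (bigD1 i).
have aN i : a i * ev N = ev (c i * N' i).
  by rewrite (NE i) evM mulrA (hn i).2 evM.
have h : \sum_i ev (c i * N' i) * x i = 0.
  transitivity ((\sum_i a i * x i) * ev N); last by rewrite sum0 mul0r.
  rewrite mulr_suml.
  by apply: eq_bigr => i _; rewrite -aN mulrAC.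
move=> i; have := indep h i => ci0.
apply/eqP; have := aN i; rewrite ci0 ev0 => /eqP; rewrite mulf_eq0.
by rewrite (negbTE (ev_neq0 _)) ?orbF //; apply/prodf_neq0 => k _; case: (hn k).
Qed.

Lemma frac_spans z : exists a : 'I_p -> K,
  (forall i, subfield_frac (a i)) /\ z = \sum_i a i * x i.
Proof.
have [n [c [n0 h]]] := spans z; have n1 := ev_neq0 n0.
exists (fun i => ev (c i) / ev n); split=> [i|].
  by exists (c i), n; rewrite divfK.
rewrite -[LHS](mulfK n1) h mulr_suml; apply: eq_bigr => i _; exact: mulrAC.
Qed.

Lemma frac_sub a b : subfield_frac a -> subfield_frac b -> subfield_frac (a - b).
Proof.
move=> [c [n [n0 ac]]] [d [m [m0 bd]]]; exists (c * m - d * n), (n * m).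
by rewrite mulf_neq0 // evB !evM -ac -bd; split => //; ring.
Qed.

(** Since Y is y times a unit s of K, S = K + K Y, while the subfield is F(r) + F(r) Y. A basis of K
    over F(r) therefore serves for both components at once. *)
Theorem pullback_basis : exists e : 'I_p -> S, forall z,
  exists! c : {ffun 'I_p -> S}, (forall i, pull (c i)) /\ z = \sum_i c i * e i.
Proof.
exists (fun i => j (x i)) => z.
have combE (a b : 'I_p -> K) : \sum_i (j (a i) + j (b i) * Y) * j (x i)
    = j (\sum_i a i * x i) + j ((\sum_i b i * x i) * s) * y.
  rewrite mulr_suml !rmorph_sum /= mulr_suml -big_split /=.
  by apply: eq_bigr => i _; rewrite /Y !rmorphM; ring.
have [u [v ->]] := split_ex z.
have [a [fa ua]] := frac_spans u; have [b [fb vb]] := frac_spans (v / s).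
exists [ffun i => j (a i) + j (b i) * Y]; split.
  split=> [i|]; first by rewrite ffunE; apply/pullP; exists (a i), (b i).
  under eq_bigr do rewrite ffunE.
  by rewrite combE -ua -vb divfK.
move=> c' [pc' zc'].
have /fin_all_exists [a' /fin_all_exists [b' hab]] :
    forall i, exists a' b', [/\ subfield_frac a', subfield_frac b' & c' i = j a' + j b' * Y].
  by move=> i; apply/pullP.
move: zc'; under eq_bigr => i _ do (have [_ _ ->] := hab i).
rewrite combE => /split_inj [ua' vb'].
have eqs (d d' : 'I_p -> K) : (forall i, subfield_frac (d i)) ->
    (forall i, subfield_frac (d' i)) -> \sum_i d i * x i = \sum_i d' i * x i ->
    forall i, d i = d' i.
  move=> hd hd' e i; apply/eqP; rewrite -subr_eq0; apply/eqP.
  apply: (@frac_indep (fun i => d i - d' i)) => [k|]; first exact: frac_sub.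
  under eq_bigr do rewrite mulrBl.
  by rewrite sumrB e subrr.
have ea : forall i, a i = a' i.
  by apply: eqs => // [k|]; [case: (hab k) | rewrite -ua].
have eb : forall i, b i = b' i.
  by apply: eqs => // [k|]; [case: (hab k) | rewrite -vb vb' mulfK].
by apply/ffunP => i; rewrite ffunE ea eb; have [_ _ ->] := hab i.
Qed.

End QuadraticPullback.

Lemma fraction_split (R : idomainType) (z : {fraction R}) :
  exists g h, h != 0 /\ z = tofrac g / tofrac h.
Proof.
elim/quotW: z => x; exists x.1, x.2; split; first exact: denom_ratioP.
have x0 : tofrac x.2 != 0 by rewrite tofrac_eq0 denom_ratioP.
apply: (mulIf x0); rewrite divfK //; unlock tofrac.
apply: etrans (esym (FracField.pi_mul _ _)) _; apply/eqmodP.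
rewrite /= FracField.equivfE /FracField.mulf /= !numden_Ratio ?oner_neq0 //;
  rewrite ?mulf_neq0 ?oner_neq0 ?denom_ratioP //.
by rewrite !mulr1 mulrC.
Qed.

Lemma mul_pow_div (K : fieldType) (n m : K) k i : m != 0 -> (i <= k)%N ->
  n ^+ i * m ^+ (k - i) = m ^+ k * (n / m) ^+ i.
Proof.
move=> m0 le_ik; rewrite -{2}(subnK le_ik) exprD expr_div_n -mulrA [m ^+ i * _]mulrC.
by rewrite divfK ?expf_neq0 // mulrC.
Qed.

Lemma fraction_combine (K : fieldType) (g h s a R m m' : K) : h != 0 -> m != 0 -> m' != 0 ->
  h * s = m * a -> g * s * m' = m * m' * R -> g / h * a = R.
Proof.
move=> h0 m0 m0' hs gs; apply: (mulfI m0); apply: (mulIf m0').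
transitivity (g / h * (m * a) * m'); first by ring.
rewrite -hs; transitivity (g * s * m'); first by field.
by rewrite gs; ring.
Qed.

(** * The degree of F(x) over F(N/M) for coprime N and M *)

Section RationalSubfield.
Variables (F : fieldType) (N M : {poly F}) (p : nat).
Hypothesis coNM : coprimep N M.
Hypothesis sN : size N = p.+1.
Hypothesis sM : (size M <= p)%N.
Hypothesis p_gt0 : (0 < p)%N.

Let N0 : N != 0. Proof. by rewrite -size_poly_gt0 sN. Qed.
Let M0 : M != 0.
Proof.
apply/eqP => M0; move: coNM; rewrite M0 coprimep0 -size_poly_eq1 sN.
by case: p p_gt0.
Qed.

(** An expansion in powers of N/M with digits q i, cleared of its denominator M^k. *)
Definition comb k (q : nat -> {poly F}) : {poly F} :=
  \sum_(i < k.+1) N ^+ i * M ^+ (k - i) * q i.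

Lemma combS k q : comb k.+1 q = M ^+ k.+1 * q 0%N + N * comb k (fun i => q i.+1).
Proof.
rewrite /comb big_ord_recl /= mul1r subn0; congr (_ + _).
rewrite mulr_sumr; apply: eq_bigr => i _.
by rewrite /bump /= add1n subSS exprS !mulrA.
Qed.

(** Modulo N only the digit q 0 times a power of M remains. As M is prime to N and q 0 has degree
    below that of N, this digit is 0; then N is cancelled. *)
Lemma comb_indep k (q : nat -> {poly F}) : (forall i, (size (q i) <= p)%N) -> comb k q = 0 ->
  forall i, (i <= k)%N -> q i = 0.
Proof.
elim: k q => [|k IH] q sq.
  by rewrite /comb big_ord1 !expr0 !mul1r => q0 i; rewrite leqn0 => /eqP ->.
rewrite combS => h0.
have q0 : q 0%N = 0.
  have Nd : N %| q 0%N.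
    rewrite -(Gauss_dvdpr _ (coprimep_expr k.+1 coNM)).
    have -> : M ^+ k.+1 * q 0%N = N * - comb k (fun i => q i.+1).
      by apply/eqP; rewrite mulrN -addr_eq0 h0.
    exact: dvdp_mulIl.
  apply/eqP; apply: contraTT Nd => q0.
  by apply: contraL (sq 0%N) => /(dvdp_leq q0); rewrite sN -ltnNge.
move: h0; rewrite q0 mulr0 add0r => /eqP; rewrite mulf_eq0 (negbTE N0) /= => /eqP h.
by case=> [//|i]; rewrite ltnS; apply: (IH (fun i => q i.+1)).
Qed.

Lemma comb_span k (a : {poly F}) : (size a <= p * k.+1)%N ->
  exists q : nat -> {poly F}, (forall i, (size (q i) <= p)%N) /\ a = comb k q.
Proof.
elim: k a => [|k IH] a sa.
  by exists (fun=> a); split; [rewrite muln1 in sa | rewrite /comb big_ord1 !expr0 !mul1r].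
(* The lowest digit has to be a divided by M^(k+1) modulo N, and v is that inverse. *)
have /Bezout_eq1_coprimepP [[u v] /= uv] : coprimep N (M ^+ k.+1) by apply: coprimep_expr.
pose q0 := (a * v) %% N.
have sq0 : (size q0 <= p)%N by rewrite -ltnS -sN ltn_modp.
have Nd : N %| a - M ^+ k.+1 * q0.
  have -> : a - M ^+ k.+1 * q0 = N * (a * u + M ^+ k.+1 * ((a * v) %/ N)).
    have avE := divp_eq (a * v) N.
    have -> : q0 = a * v - (a * v) %/ N * N by rewrite {1}avE addrC addKr.
    by rewrite -{1}[a]mulr1 -uv; ring.
  exact: dvdp_mulIl.
have sMk : (size (M ^+ k.+1 * q0)%R <= p * k.+2)%N.
  apply: leq_trans (size_polyMleq _ _) _.
  have := size_poly_exp_leq M k.+1.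
  have : ((size M).-1 * k.+1 <= p.-1 * k.+1)%N by rewrite leq_mul2r; apply/orP; right; lia.
  rewrite -(subn1 p) mulnBl mul1n => h1 h2; rewrite mulnS.
  have : (k.+1 <= p * k.+1)%N by rewrite leq_pmull.
  by move: h1 h2 sq0; move: ((size M).-1 * k.+1)%N (p * k.+1)%N (size (M ^+ k.+1)) (size q0) => *; lia.
have /IH [q [sq aq]] : (size ((a - M ^+ k.+1 * q0) %/ N)%R <= p * k.+1)%N.
  rewrite size_divp // sN /=.
  have : (size (a - M ^+ k.+1 * q0)%R <= p * k.+2)%N.
    by rewrite (leq_trans (size_polyD _ _)) // geq_max sa size_polyN.
  by rewrite (mulnS p k.+1) leq_subLR.
exists (fun i => if i is i'.+1 then q i' else q0); split; first by case.
by rewrite combS -aq [N * _]mulrC divpK // addrC subrK.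
Qed.

(* Some nonzero homogeneous form in N and M is divisible by a given h, because
   there are more monomials than the dimension of F[X]/(h). *)
Lemma norm_multiple (h : {poly F}) : h != 0 -> exists (k : nat) (c : nat -> F) (s : {poly F}),
  (exists2 i, (i <= k)%N & c i != 0) /\ h * s = comb k (fun i => (c i)%:P).
Proof.
move=> h0; pose e := (size h).-1.
pose A : 'M[F]_(e.+1, e) := \matrix_(i < e.+1) poly_rV ((N ^+ i * M ^+ (e - i)) %% h).
have : kermx A != 0.
  by rewrite kermx_eq0 -row_leq_rank -ltnNge ltnS rank_leq_col.
move=> /rowV0Pn [v /sub_kermxP vA v0].
have sh : size h = e.+1 by rewrite /e prednK ?size_poly_gt0.
pose c i := if insub i is Some i' then v 0 i' else 0 : F.
have cE (i : 'I_e.+1) : c i = v 0 i by rewrite /c valK.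
pose a i := N ^+ i * M ^+ (e - i).
have sm (u : {poly F}) : (size (u %% h)%R <= e)%N by rewrite -ltnS -sh ltn_modp.
have ca : \sum_(i < e.+1) c i *: (a i %% h) = 0.
  transitivity (rVpoly (v *m A)); last by rewrite vA linear0.
  rewrite mulmx_sum_row linear_sum.
  apply: eq_bigr => i _; by rewrite linearZ /= cE rowK poly_rV_K ?sm.
pose s := \sum_(i < e.+1) c i *: (a i %/ h).
exists e, c, s; split; last first.
  transitivity (h * s + \sum_(i < e.+1) c i *: (a i %% h)); first by rewrite ca addr0.
  rewrite mulr_sumr -big_split; apply: eq_bigr => i _ /=.
  by rewrite -scalerAr -scalerDr mulrC -divp_eq mulrC mul_polyC.
have [i vi] : exists i, v 0 i != 0.
  apply/existsP; apply: contraNT v0; rewrite negb_exists => /forallP v0.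
  by apply/eqP/rowP => i; rewrite mxE; apply/eqP; move: (v0 i); rewrite negbK.
by exists i; rewrite ?cE // -ltnS.
Qed.


Lemma comb_horner (k : nat) (q : nat -> {poly F}) :
  tofrac (comb k q) = tofrac (M ^+ k) * \sum_(i < k.+1) (tofrac N / tofrac M) ^+ i * tofrac (q i).
Proof.
have m0 : tofrac M != 0 by rewrite tofrac_eq0.
rewrite /comb rmorph_sum mulr_sumr; apply: eq_bigr => i _ /=.
rewrite mulrA !tofracM !tofracXn; congr (_ * _).
exact: mul_pow_div (ltnSE (ltn_ord i)).
Qed.

Let kappa : {rmorphism F -> {fraction {poly F}}} := @tofrac {poly F} \o @polyC F.
Let r := tofrac N / tofrac M.

Let ev (c : {poly F}) := (map_poly kappa c).[r].

Lemma ev_poly m (u : nat -> F) : ev (\poly_(e < m) u e) = \sum_(e < m) kappa (u e) * r ^+ e.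
Proof.
rewrite /ev (@horner_coef_wide _ m); last by apply: leq_trans (size_poly _ _) (size_poly _ _).
by apply: eq_bigr => i _; rewrite coef_map coef_poly ltn_ord.
Qed.

Lemma rational_sum_coef m (q : nat -> {poly F}) : (forall e, (size (q e) <= p)%N) ->
  \sum_(e < m) r ^+ e * tofrac (q e)
  = \sum_(i < p) ev (\poly_(e < m) (q e)`_i) * tofrac ('X^i).
Proof.
move=> sq.
transitivity (\sum_(e < m) \sum_(i < p) kappa (q e)`_i * r ^+ e * tofrac ('X^i)).
  apply: eq_bigr => e _.
  have {1}-> : q e = \sum_(i < p) ((q e)`_i)%:P * 'X^i.
    have {1}-> : q e = \poly_(i < p) (q e)`_i.
      apply/polyP => i; rewrite coef_poly; case: ltnP => // le_pi.
      by apply: nth_default; apply: leq_trans (sq e) le_pi.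
    by rewrite poly_def; apply: eq_bigr => i _; rewrite mul_polyC.
  rewrite rmorph_sum mulr_sumr; apply: eq_bigr => i _ /=.
  by rewrite tofracM mulrA [r ^+ e * _]mulrC.
by rewrite exchange_big; apply: eq_bigr => i _; rewrite ev_poly mulr_suml.
Qed.

Lemma rational_subfield_indep (c : 'I_p -> {poly F}) :
  \sum_i ev (c i) * tofrac ('X^i) = 0 -> forall i, c i = 0.
Proof.
move=> sum0; pose k := \max_i size (c i).
pose q n : {poly F} := \poly_(i < p) (if insub i is Some i' then (c i')`_n else 0).
have sq n : (size (q n) <= p)%N by apply: size_poly.
have qc n (i : 'I_p) : (q n)`_i = (c i)`_n by rewrite coef_poly ltn_ord valK.
have le_k i : (size (c i) <= k)%N by apply: (leq_bigmax i).
have cq i : c i = \poly_(e < k.+1) (q e)`_i.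
  apply/polyP => n; rewrite coef_poly ltnS; case: leqP => [_|lt_kn]; first by rewrite qc.
  by apply: nth_default; apply: leq_trans (le_k i) (ltnW lt_kn).
have q0 : comb k q = 0.
  apply/eqP; rewrite -tofrac_eq0 comb_horner -/r rational_sum_coef //.
  by under eq_bigr do rewrite -cq; rewrite sum0 mulr0.
move=> i; rewrite cq; apply/polyP => n; rewrite coef_poly coef0 ltnS.
by case: leqP => // le_nk; rewrite (comb_indep sq q0 le_nk) coef0.
Qed.

Lemma rational_subfield_inj (c : {poly F}) : ev c = 0 -> c = 0.
Proof.
move=> c0; pose d (i : 'I_p) := if i == 0%N :> nat then c else 0.
suff h : forall i, d i = 0 by have := h (Ordinal p_gt0).
apply: rational_subfield_indep; apply: big1 => i _; rewrite /d.
by case: ifP => _; rewrite ?c0 /ev ?rmorph0 ?horner0 mul0r.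
Qed.

(** For z = g/h, a multiple h s is a form in N and M with constant coefficients, hence an element of
    F(N/M) times a power of M. The numerator g s is then expanded in powers of N/M. *)
Lemma rational_subfield_span (z : {fraction {poly F}}) :
  exists (n : {poly F}) (c : 'I_p -> {poly F}), n != 0 /\
  z * ev n = \sum_i ev (c i) * tofrac ('X^i).
Proof.
have [g [h [h0 ->]]] := fraction_split z.
have [k [n [s [[i0 le_i0 ni0] hs]]]] := norm_multiple h0.
(* Multiplying by M^l raises the degree by at most (p-1) l while the bound of [comb_span] rises by p
   l. The difference l absorbs g s, whatever its degree. *)
pose l := size (g * s).
have sgs : (size (g * s * M ^+ l)%R <= p * (k + l).+1)%N.
  apply: leq_trans (size_polyMleq _ _) _; rewrite -/l.
  have := size_poly_exp_leq M l.
  have : ((size M).-1 * l <= p.-1 * l)%N by rewrite leq_mul2r; apply/orP; right; lia.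
  rewrite -(subn1 p) mulnBl mul1n => h1 h2; rewrite mulnS mulnDr.
  have h3 : (l <= p * l)%N by rewrite leq_pmull.
  move: h1 h2 h3; move: ((size M).-1 * l)%N (p * l)%N (p * k)%N (size (M ^+ l)) => *; lia.
have [q [sq gsq]] := comb_span sgs.
have m0 e : tofrac M ^+ e != 0 by rewrite expf_neq0 // tofrac_eq0.
exists (\poly_(i < k.+1) n i), (fun i => \poly_(e < (k + l).+1) (q e)`_i); split.
  by apply/eqP => /(congr1 (fun u : {poly F} => u`_i0)); rewrite coef_poly ltnS le_i0 coef0; apply/eqP.
rewrite -rational_sum_coef //; set R := \sum_(e < _) _.
have nE : tofrac h * tofrac s = tofrac M ^+ k * ev (\poly_(i < k.+1) n i).
  rewrite -tofracM hs comb_horner tofracXn ev_poly; congr (_ * _).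
  by apply: eq_bigr => i _; rewrite mulrC.
have qE : tofrac g * tofrac s * tofrac M ^+ l = tofrac M ^+ (k + l) * R.
  by rewrite -tofracXn -!tofracM gsq comb_horner tofracXn.
apply: (fraction_combine _ (m0 k) (m0 l) nE); first by rewrite tofrac_eq0.
by rewrite qE exprD.
Qed.

End RationalSubfield.

Lemma div_exp_neq0 (K : fieldType) (v d : K) k : v != 0 -> d != 0 -> v / d ^+ k != 0.
Proof. by move=> v0 d0; rewrite mulf_neq0 // invr_neq0 // expf_neq0. Qed.

Lemma eq_fractions (K : fieldType) (u d n m : K) : d != 0 -> m != 0 ->
  u * m = n * d ^+ 2 -> u / d ^+ 2 = n / m.
Proof.
move=> d0 m0 e; apply/eqP; rewrite -subr_eq0; apply/eqP.
transitivity ((u * m - n * d ^+ 2) / (d ^+ 2 * m)); first by field; rewrite d0 m0.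
by rewrite e subrr mul0r.
Qed.

Lemma cross_square (K : fieldType) (g h g' h' f : K) : h != 0 -> h' != 0 ->
  (g / h) ^+ 2 = (g' / h') ^+ 2 * f -> (g * h') ^+ 2 = (g' * h) ^+ 2 * f.
Proof.
move=> h0 h0' e; have -> : (g * h') ^+ 2 = (g / h) ^+ 2 * (h * h') ^+ 2 by field.
by rewrite e; field.
Qed.

(** Parity of degrees: squares have even degree, the cubic has degree 3. *)
Lemma cubic_nonsquare (F : fieldType) (A B : F) (a b : {fraction {poly F}}) :
  a ^+ 2 = b ^+ 2 * tofrac (cubic A B) -> b = 0.
Proof.
have [g [h [h0 ->]]] := fraction_split a; have [g' [h' [h0' ->]]] := fraction_split b.
have t0 : tofrac h != 0 by rewrite tofrac_eq0.
have t0' : tofrac h' != 0 by rewrite tofrac_eq0.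
move=> e; suff -> : g' = 0 by rewrite tofrac0 mul0r.
apply/eqP/negPn/negP => g0'.
have {}e : (g * h') ^+ 2 = (g' * h) ^+ 2 * cubic A B.
  apply/eqP; rewrite -tofrac_eq tofracXn !(tofracM, tofracXn); apply/eqP.
  exact: (cross_square t0 t0' e).
have gh0 : g' * h != 0 by rewrite mulf_neq0.
have : size ((g * h') ^+ 2) = size ((g' * h) ^+ 2 * cubic A B) by rewrite e.
have gh0' : g * h' != 0.
  apply/eqP => z0; move: e; rewrite z0 expr0n => /esym/eqP.
  by rewrite mulf_eq0 expf_eq0 (negbTE gh0) (negbTE (cubic_neq0 A B)).
have sz2 (u : {poly F}) : u != 0 -> size (u ^+ 2) = (size u + size u).-1.
  by move=> u0; rewrite expr2 size_mul.
rewrite (@size_mul _ ((g' * h) ^+ 2)) ?expf_neq0 ?cubic_neq0 // size_cubic !sz2 //.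
have : (0 < size (g * h')%R)%N by rewrite size_poly_gt0.
have : (0 < size (g' * h)%R)%N by rewrite size_poly_gt0.
by move: (size (g * h')) (size (g' * h)) => m n; lia.
Qed.

Section Degree.
Variables (F : fieldType) (A B A2 B2 : F).

(** N/M is U/D^2 in lowest terms, and its numerator has the larger degree p, which is the degree of
    F(x) over F(X). *)
Lemma isogeny_data_degree h (U V D N M : {poly F}) p :
  isogeny_data A B A2 B2 h U V D ->
  coprimep N M -> size N = p.+1 -> (size M <= p)%N -> (0 < p)%N -> U * M = N * D ^+ 2 ->
  isogeny_degree (xy_map A B U V D) p.
Proof.
move=> [sU sV sD eq] coNM sN sM p0 UM.
have d0 : in_Fx D != 0 by rewrite /in_Fx tofrac_eq0 -size_poly_gt0 sD.
have m0 : in_Fx M != 0.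
  rewrite /in_Fx tofrac_eq0; apply/eqP => M0.
  by move: coNM; rewrite M0 coprimep0 -size_poly_eq1 sN; case: p p0 {sN sM}.
have rE : in_Fx U / in_Fx D ^+ 2 = tofrac N / tofrac M.
  apply: eq_fractions d0 m0 _.
  by rewrite /in_Fx -(tofracXn 2 D) -(tofracM U) -(tofracM N) UM.
have s0 : in_Fx V / in_Fx D ^+ 3 != 0.
  by apply: div_exp_neq0 d0; rewrite /in_Fx tofrac_eq0 -size_poly_gt0 sV.
pose kappa : {rmorphism F -> {fraction {poly F}}} := @tofrac {poly F} \o @polyC F.
have K : in_Fx (cubic A B) * (in_Fx V / in_Fx D ^+ 3) ^+ 2
    = (map_poly kappa (cubic A2 B2)).[tofrac N / tofrac M].
  rewrite -rE (weierstrass_fraction (A := in_Fx A2%:P) (B := in_Fx B2%:P)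
    (u := in_Fx U) d0); last first.
    rewrite /in_Fx -!tofracXn -!tofracM -!tofracD; congr tofrac.
    by rewrite eq -!mul_polyC.
  rewrite /cubic !rmorphD /= map_polyXn map_polyZ /= map_polyX map_polyC !hornerD.
  by rewrite hornerXn hornerZ hornerX hornerC.
have [e he] := pullback_basis (kappa := kappa) (iota := ff_const (short_wcurve A B))
  (fun c => erefl) (ff_y_sqr A B) (ff_split (A := A) (B := B)) (@ff_split_inj _ A B)
  (@cubic_nonsquare _ A B) s0 K
  (x := fun i : 'I_p => tofrac 'X^i)
  (rational_subfield_inj coNM sN p0)
  (rational_subfield_indep coNM sN p0)
  (rational_subfield_span coNM sN sM p0).
exists e => z; have := he z; rewrite -rE; exact.
Qed.

End Degree.

(** * Composition and rescaling of isogeny data *)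

Section Composition.
Variables (F : fieldType) (U D : {poly F}) (h : nat).
Hypotheses (sU : size U = (2 * h).+2) (sD : size D = h.+1).

(* D ^ 2k P(U / D ^ 2), for P of degree at most k. *)
Definition hom_subst k (P : {poly F}) : {poly F} :=
  \sum_(i < k.+1) P`_i *: (U ^+ i * D ^+ (2 * (k - i))).

Lemma size_hom_subst k (P : {poly F}) : size P = k.+1 ->
  size (hom_subst k P) = (k * (2 * h).+1).+1.
Proof.
move=> sP; rewrite /hom_subst big_ord_recr /= subnn muln0 expr0 mulr1.
have lP : P`_k != 0.
  by have := lead_coef_eq0 P; rewrite lead_coefE sP /= => ->; rewrite -size_poly_gt0 sP.
have sk : size (P`_k *: U ^+ k) = (k * (2 * h).+1).+1 by rewrite size_scale // (size_exp_eq k sU).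
rewrite addrC size_polyDl sk // ltnS; apply: leq_trans (size_sum _ _ _) _.
apply/bigmax_leqP => i _; apply: leq_trans (size_scale_leq _ _) _.
rewrite (size_mul_monic_bound (size_exp_eq i sU) (size_exp_eq _ sD)).
by have := ltn_ord i; nia.
Qed.

Let kappa : {rmorphism F -> {fraction {poly F}}} := @tofrac {poly F} \o @polyC F.

Lemma tofrac_hom_subst k (P : {poly F}) : (size P <= k.+1)%N ->
  tofrac (hom_subst k P)
  = tofrac D ^+ (2 * k) * (map_poly kappa P).[tofrac U / tofrac D ^+ 2].
Proof.
move=> sP; have d0 : tofrac D != 0 by rewrite tofrac_eq0 -size_poly_gt0 sD.
rewrite (@horner_coef_wide _ k.+1); last by apply: leq_trans (size_poly _ _) sP.
rewrite /hom_subst rmorph_sum mulr_sumr; apply: eq_bigr => i _ /=.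
rewrite coef_map /= -mul_polyC !tofracM !tofracXn [RHS]mulrCA; congr (_ * _).
rewrite !exprM; apply: mul_pow_div (ltnSE (ltn_ord i)).
by rewrite expf_neq0.
Qed.

End Composition.

Lemma compose_weierstrass (K : fieldType) (f u v d A2 B2 A3 B3 u2 v2 d2 e : K) : d != 0 ->
  f * v ^+ 2 = u ^+ 3 + A2 * (u * d ^+ 4) + B2 * d ^+ 6 ->
  ((u / d ^+ 2) ^+ 3 + A2 * (u / d ^+ 2) + B2) * v2 ^+ 2
    = u2 ^+ 3 + A3 * (u2 * d2 ^+ 4) + B3 * d2 ^+ 6 ->
  f * (v * (e ^+ 3 * v2)) ^+ 2
  = (e ^+ 2 * d ^+ 2 * u2) ^+ 3 + A3 * ((e ^+ 2 * d ^+ 2 * u2) * (d * (e * d2)) ^+ 4)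
    + B3 * (d * (e * d2)) ^+ 6.
Proof.
move=> d0 h1 h2.
transitivity (e ^+ 6 * d ^+ 6 * (u2 ^+ 3 + A3 * (u2 * d2 ^+ 4) + B3 * d2 ^+ 6)); last by ring.
rewrite -h2; transitivity ((f * v ^+ 2) * (e ^+ 6 * v2 ^+ 2)); first by ring.
by rewrite h1; field.
Qed.

Lemma horner_weierstrass (F K : fieldType) (kappa : {rmorphism F -> K}) (r : K)
    (A B A2 B2 : F) (U V D : {poly F}) :
  cubic A B * V ^+ 2 = U ^+ 3 + A2 *: (U * D ^+ 4) + B2 *: D ^+ 6 ->
  let ev P := (map_poly kappa P).[r] in
  (r ^+ 3 + kappa A * r + kappa B) * ev V ^+ 2
  = ev U ^+ 3 + kappa A2 * (ev U * ev D ^+ 4) + kappa B2 * ev D ^+ 6.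
Proof.
move=> eq ev.
have evD P Q : ev (P + Q) = ev P + ev Q by rewrite /ev rmorphD hornerD.
have evM P Q : ev (P * Q) = ev P * ev Q by rewrite /ev rmorphM hornerM.
have evX P k : ev (P ^+ k) = ev P ^+ k by rewrite /ev rmorphXn horner_exp.
have evZ c P : ev (c *: P) = kappa c * ev P by rewrite /ev map_polyZ hornerZ.
have ev_cubic : ev (cubic A B) = r ^+ 3 + kappa A * r + kappa B.
  by rewrite /cubic !evD evX evZ /ev map_polyX map_polyC hornerX hornerC.
have := congr1 ev eq.
by rewrite (evM (cubic A B)) ev_cubic !evX !evD !evZ (evX U) (evM U) !evX.
Qed.

(** U/D^2 is substituted into the second map, and U2, V2, D2 are cleared by powers of D chosen so
    that the shape is preserved. The fractions may fail to be reduced, which is harmless for the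
    existence of an isogeny. *)
Lemma isogeny_data_comp (F : fieldType) (A B A2 B2 A3 B3 : F) h h2 U V D U2 V2 D2 :
  isogeny_data A B A2 B2 h U V D -> isogeny_data A2 B2 A3 B3 h2 U2 V2 D2 ->
  exists h3 U3 V3 D3, isogeny_data A B A3 B3 h3 U3 V3 D3.
Proof.
move=> [sU sV sD eq] [sU2 sV2 sD2 eq2].
have d0 : tofrac D != 0 by rewrite tofrac_eq0 -size_poly_gt0 sD.
have sU2h := size_hom_subst sU sD sU2; have sV2h := size_hom_subst sU sD sV2.
have sD2h := size_hom_subst sU sD sD2.
exists (h + h2 * (2 * h).+1)%N, (hom_subst U D (2 * h2).+1 U2),
  (V * hom_subst U D (3 * h2) V2), (D * hom_subst U D h2 D2); split.
- by rewrite sU2h; congr _.+1; lia.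
- by rewrite (size_mul_monic_bound sV sV2h); congr _.+1; lia.
- by rewrite (size_mul_monic_bound sD sD2h).
- move: (cubic A B) eq => c eq.
  apply/eqP; rewrite -tofrac_eq -!mul_polyC; apply/eqP.
  rewrite (tofracM c) (tofracXn 2) (tofracM V).
  rewrite 2!tofracD (tofracXn 3) (tofracM A3%:P) (tofracM (hom_subst _ _ _ _)) (tofracM B3%:P).
  rewrite (tofracXn 4) (tofracXn 6) (tofracM D).
  rewrite !(tofrac_hom_subst U sD) ?sU2 ?sV2 ?sD2 //.
  pose kappa : {rmorphism F -> {fraction {poly F}}} := @tofrac {poly F} \o @polyC F.
  have ev p : (map_poly kappa p).[tofrac U / tofrac D ^+ 2]
      = horner_eval (tofrac U / tofrac D ^+ 2) (map_poly kappa p) by [].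
  have eh : tofrac c * tofrac V ^+ 2
      = tofrac U ^+ 3 + tofrac A2%:P * (tofrac U * tofrac D ^+ 4) + tofrac B2%:P * tofrac D ^+ 6.
    by rewrite -!tofracXn -!tofracM -!tofracD -!mul_polyC in eq *; congr tofrac.
  have eh2 := horner_weierstrass kappa (tofrac U / tofrac D ^+ 2) eq2.
  have := compose_weierstrass (tofrac D ^+ (2 * h2)) d0 eh eh2.
  have -> : (2 * (3 * h2) = 2 * h2 * 3)%N by lia.
  have -> : (2 * (2 * h2).+1 = 2 * h2 * 2 + 2)%N by lia.
  by rewrite (exprD _ (2 * h2 * 2)) (exprM _ (2 * h2) 3) (exprM _ (2 * h2) 2).
Qed.

Lemma isogeny_data_scale (F : fieldType) (A B A2 B2 m : F) h U V D : m != 0 ->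
  isogeny_data A B (m ^+ 4 * A2) (m ^+ 6 * B2) h U V D ->
  isogeny_data A B A2 B2 h (m ^- 2 *: U) (m ^- 3 *: V) D.
Proof.
move=> m0 [sU sV sD eq]; split; rewrite ?size_scale ?invr_eq0 ?expf_neq0 //.
have mP : m%:P * (m^-1)%:P = 1 :> {poly F} by rewrite -polyCM divff.
move: eq; rewrite -!exprVn -!mul_polyC (polyCM (m ^+ 4)) (polyCM (m ^+ 6)) !polyC_exp => eq.
transitivity ((m^-1)%:P ^+ 6 * (cubic A B * V ^+ 2)); first by ring.
have e4 : (m^-1)%:P ^+ 6 * (m%:P ^+ 4 * A2%:P * (U * D ^+ 4))
    = (m%:P * (m^-1)%:P) ^+ 4 * (A2%:P * ((m^-1)%:P ^+ 2 * U * D ^+ 4)) by ring.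
have e6 : (m^-1)%:P ^+ 6 * (m%:P ^+ 6 * B2%:P * D ^+ 6)
    = (m%:P * (m^-1)%:P) ^+ 6 * (B2%:P * D ^+ 6) by ring.
by rewrite eq 2!mulrDr e4 e6 mP !expr1n !mul1r; ring.
Qed.

Lemma mmap_comp_rmorph (n : nat) (R S : nzRingType) (T : comNzRingType) (f : {rmorphism R -> S})
    (g : {rmorphism S -> T}) (h : 'I_n -> S) (h' : 'I_n -> T) (G : {mpoly R[n]}) :
  (forall i, h' i = g (h i)) -> mmap (g \o f) h' G = g (mmap f h G).
Proof.
move=> hh; rewrite /mmap rmorph_sum; apply: eq_bigr => m _ /=.
rewrite rmorphM; congr (_ * _); rewrite /mmap1 rmorph_prod.
by apply: eq_bigr => i _; rewrite rmorphXn hh.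
Qed.

(** * Kernels, and isogenies of degree 2 *)

Section KernelOfData.
Variables (F : fieldType) (A B A2 B2 : F) (h : nat) (U V D : {poly F}).
Hypothesis dat : isogeny_data A B A2 B2 h U V D.
Let E := short_wcurve A B.
Variables (L : fieldType) (iota : {rmorphism F -> L}).

Lemma on_curve_cubic x y : on_curve (map_wcurve iota E) (Some (x, y)) <->
  y ^+ 2 = (map_poly iota (cubic A B)).[x].
Proof.
rewrite /on_curve /= !rmorph0 !mul0r !addr0 /cubic !rmorphD /= map_polyXn map_polyZ /=.
by rewrite map_polyX map_polyC !hornerD hornerXn hornerZ hornerX hornerC.
Qed.

Lemma kernel_infty : kernel (xy_map A B U V D) iota None.
Proof.
split=> //; have [_ [m [G [hG rel [c c0 GP]]]]] := isogeny_data_isogeny dat.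
exists m, G; split=> //; exists (iota c); first by rewrite fmorph_eq0.
move=> i; have -> : coords None i = iota (coords None i).
  rewrite /coords; case: i => -[|[|[|//]]] hi /=; by rewrite ?rmorph0 ?rmorph1.
rewrite -rmorphM -GP.
apply: (@mmap_comp_rmorph _ _ _ _ idfun iota) => -[[|[|[|//]]] hk];
  by rewrite /coords /= ?rmorph0 ?rmorph1.
Qed.

Lemma kernel_affine x y : kernel (xy_map A B U V D) iota (Some (x, y)) ->
  y ^+ 2 = (map_poly iota (cubic A B)).[x] /\ root (map_poly iota D) x.
Proof.
move=> [/on_curve_cubic xy mt]; split => //; apply: maps_to_infty_root mt => //.
by have [_ _ sD _] := dat; rewrite -size_poly_gt0 sD.
Qed.

End KernelOfData.

Section TwoIsogeny.
Variables (F : fieldType) (A B A2 B2 a m : F).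
Hypotheses (m0 : m != 0) (T0 : 3 * a ^+ 2 + A != 0) (fa : a ^+ 3 + A * a + B = 0).
Let T := 3 * a ^+ 2 + A.
Hypotheses (hA2 : A - 5 * T = m ^+ 4 * A2) (hB2 : B - 7 * (a * T) = m ^+ 6 * B2).
Let D : {poly F} := 'X - a%:P.
Let U0 : {poly F} := 'X * D + T%:P.
Let V0 : {poly F} := D ^+ 2 - T%:P.
Let q : {poly F} := 'X^2 + a%:P * 'X + (a ^+ 2 + A)%:P.

Let BE : B = - (a ^+ 3 + A * a).
Proof. by apply/eqP; rewrite -addr_eq0 addrC fa. Qed.

Lemma cubic_factor : cubic A B = D * q.
Proof.
by rewrite /cubic BE /D /q -mul_polyC !(polyCN, polyCD, polyCM, polyC_exp); ring.
Qed.

Lemma two_isogeny_size : [/\ size D = 2%N, size U0 = 3%N & size V0 = 3%N].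
Proof.
have sD : size D = 2%N by rewrite size_XsubC.
split=> //.
  rewrite /U0 size_polyDl mulrC size_mulX ?polyXsubC_eq0 // sD //.
  by rewrite (leq_ltn_trans (size_polyC_leq1 _)).
by rewrite /V0 size_polyDl (size_exp_eq 2 sD) // size_polyN (leq_ltn_trans (size_polyC_leq1 _)).
Qed.

(** The formula of Velu for the kernel {O, (a, 0)}: X = x + T/(x - a) with T = f'(a), and Y/y =
    dX/dx = 1 - T/(x - a)^2. Both numerators carry an extra D, and m rescales to the prescribed
    model of the target. *)
Lemma two_isogeny_data :
  isogeny_data A B A2 B2 1 (m ^- 2 *: (U0 * D)) (m ^- 3 *: (V0 * D)) D.
Proof.
have [sD sU0 sV0] := two_isogeny_size.
apply: isogeny_data_scale => //; split=> //.
- by rewrite (size_mul_monic_bound sU0 sD).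
- by rewrite (size_mul_monic_bound sV0 sD).
- rewrite -hA2 -hB2 cubic_factor BE /U0 /V0 /D /q /T -!mul_polyC.
  rewrite !(polyCN, polyCD, polyCM, polyC_exp, polyC_natr).
  by ring.
Qed.

Theorem cyclic_2isogeny : cyclic_isogeny_of_degree (short_wcurve A B) (short_wcurve A2 B2) 2.
Proof.
have [sD sU0 sV0] := two_isogeny_size; have dat := two_isogeny_data.
have D0 : D != 0 by rewrite polyXsubC_eq0.
exists (xy_map A B (m ^- 2 *: (U0 * D)) (m ^- 3 *: (V0 * D)) D); split.
- exact: isogeny_data_isogeny dat.
- apply: (isogeny_data_degree (N := m ^- 2 *: U0) (M := D) dat) => //.
  + have U0a : U0.[a] = T.
      by rewrite /U0 hornerD hornerM hornerX hornerXsubC subrr mulr0 add0r hornerC.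
    by rewrite coprimep_XsubC rootE hornerZ U0a mulf_neq0 // invr_neq0 // expf_neq0.
  + by rewrite size_scale // invr_neq0 // expf_neq0.
  + by rewrite sD.
  + by rewrite -!scalerAl -mulrA expr2.
- move=> L iota; exists (Some (iota a, 0)) => P.
  have m2 k : mul_point (map_wcurve iota (short_wcurve A B)) k (Some (iota a, 0))
      = if odd k then Some (iota a, 0) else None.
    elim: k => [//|k IH]; rewrite /mul_point iterS -/(mul_point _ _ _) IH /=.
    by case: (odd k) => //=; rewrite !rmorph0 mul0r !addr0 !eqxx.
  split.
    case: P => [[x y]|]; last by exists 0%N.
    move=> /(kernel_affine dat) [xy]; rewrite map_polyXsubC root_XsubC => /eqP xa.
    exists 1%N; rewrite m2 /= xa; congr (Some (_, _)); apply/eqP.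
    rewrite -sqrf_eq0 xy xa cubic_factor horner_map hornerM hornerXsubC subrr.
    by rewrite mul0r rmorph0.
  move=> [k ->]; rewrite m2; case: odd; last exact: (kernel_infty dat).
  have xy : 0 ^+ 2 = (map_poly iota (cubic A B)).[iota a].
    by rewrite horner_map cubic_factor hornerM hornerXsubC subrr mul0r rmorph0 expr0n.
  split; first by apply/on_curve_cubic.
  rewrite !scalerAl.
  apply: (maps_to_infty_2torsion xy cubic_factor) => //.
  + by rewrite (leq_trans (size_scale_leq _ _)) // sU0.
  + rewrite -scalerAl (leq_trans (size_scale_leq _ _)) // (leq_trans (size_polyMleq _ _)) // sV0.
    have : (size q <= 3)%N; last by case: (size q).
    rewrite /q -addrA (leq_trans (size_polyD _ _)) // geq_max size_polyXn /=.
    rewrite (leq_trans (size_polyD _ _)) // geq_max mul_polyC.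
    rewrite (leq_trans (size_scale_leq _ _)) ?size_polyX //=.
    by rewrite (leq_trans (size_polyC_leq1 _)).
  + have V0a : V0.[a] = - T.
      by rewrite /V0 hornerD hornerN horner_exp hornerXsubC subrr expr0n sub0r hornerC.
    by rewrite rootE hornerZ V0a mulf_neq0 ?oppr_eq0 // invr_neq0 // expf_neq0.
  + have qa : q.[a] = T.
      by rewrite /q !hornerD hornerXn hornerM hornerX !hornerC /T; ring.
    by rewrite rootE qa.
Qed.

End TwoIsogeny.

(** * Cyclic groups of prime order from chains of collinear points *)

Section CollinearTriples.
Variables (L : fieldType) (A B : L).
Hypothesis two0 : 2 != 0 :> L.
Hypothesis disc0 : 4 * A ^+ 3 + 27 * B ^+ 2 != 0.
Let E := short_wcurve A B.

(* The line y = s x + nu meets the curve exactly at P, Q and R. *)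
Definition collinear (P Q R : L * L) : Prop := exists s nu,
  [/\ P.2 = s * P.1 + nu, Q.2 = s * Q.1 + nu & R.2 = s * R.1 + nu] /\
  [/\ s ^+ 2 = P.1 + Q.1 + R.1, A - 2 * (s * nu) = P.1 * Q.1 + P.1 * R.1 + Q.1 * R.1
    & B - nu ^+ 2 = - (P.1 * Q.1 * R.1)].

Definition opp_pt (P : L * L) : L * L := (P.1, - P.2).

Lemma opp_ptK : involutive opp_pt.
Proof. by case=> x y; rewrite /opp_pt opprK. Qed.

Lemma collinear_swap P Q R : collinear P Q R -> collinear P R Q.
Proof.
move=> [s [nu [[hP hQ hR] [h1 h2 h3]]]]; exists s, nu; split=> //.
by split; [rewrite h1 | rewrite h2 | rewrite h3]; ring.
Qed.

Lemma collinear_on_curve P Q R : collinear P Q R ->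
  Q.2 ^+ 2 = Q.1 ^+ 3 + A * Q.1 + B.
Proof.
move=> [s [nu [[hP hQ hR] [h1 h2 h3]]]]; rewrite hQ.
have -> : A = P.1 * Q.1 + P.1 * R.1 + Q.1 * R.1 + 2 * (s * nu) by rewrite -h2; ring.
have -> : B = nu ^+ 2 - P.1 * Q.1 * R.1 by rewrite -h3; ring.
have -> : (s * Q.1 + nu) ^+ 2 = s ^+ 2 * Q.1 ^+ 2 + 2 * (s * nu) * Q.1 + nu ^+ 2 by ring.
by rewrite h1; ring.
Qed.

(** The relations in [collinear] are the coefficients of f - (s x + nu)^2 = (x - x1)(x - x2)(x -
    x3). They therefore determine R even when abscissas coincide, and P = Q is the tangent case. *)
Lemma add_collinear P Q R : collinear P Q R ->
  add_point E (Some P) (Some Q) = Some (opp_pt R).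
Proof.
move=> col; have onQ := collinear_on_curve col.
move: col => [s [nu [[hP hQ hR] [h1 h2 h3]]]].
case: P Q R => [x1 y1] [x2 y2] [x3 y3] /= in onQ hP hQ hR h1 h2 h3 *.
rewrite /opp_pt !mul0r !addr0 !subr0 /=.
have x3E : s ^+ 2 - x1 - x2 = x3 by rewrite h1; ring.
have y3E : - s * x3 - nu = - y3 by rewrite hR; ring.
have [x12|x12] := eqVneq x1 x2; last first.
  have x21 : x2 - x1 != 0 by rewrite subr_eq0 eq_sym.
  have -> : (y2 - y1) / (x2 - x1) = s by rewrite hP hQ; field.
  have -> : (y1 * x2 - y2 * x1) / (x2 - x1) = nu by rewrite hP hQ; field.
  by rewrite ?mul0r ?addr0 ?subr0 x3E y3E.
have y12 : y2 = y1 by rewrite hQ hP x12.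
have tang : 3 * x1 ^+ 2 + A = 2 * y1 * s.
  have -> : A = x1 * x2 + x1 * x3 + x2 * x3 + 2 * (s * nu) by rewrite -h2; ring.
  have -> : 2 * y1 * s = 2 * x1 * s ^+ 2 + 2 * (s * nu) by rewrite hP; ring.
  by rewrite h1 -x12; ring.
(* If y1 = 0, tangency makes x1 a double root of the cubic, against the nonzero discriminant. *)
have y0 : y1 != 0.
  apply: contraNneq disc0 => y0; apply/eqP.
  have AE : A = - (3 * x1 ^+ 2) by apply/eqP; rewrite -addr_eq0 addrC tang y0 mulr0 mul0r.
  have -> : B = 2 * x1 ^+ 3.
    have : 0 = x1 ^+ 3 + A * x1 + B.
      by rewrite x12 -onQ y12 y0 expr0n.
    rewrite AE => h0; apply/eqP; rewrite -subr_eq0; apply/eqP.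
    by rewrite [RHS]h0; ring.
  by rewrite AE; ring.
have y20 : 2 * y1 != 0 by rewrite mulf_neq0.
have yy : (y1 + y1 == 0) = false by rewrite -mulr2n -mulr_natl (negbTE y20).
rewrite y12 yy /= !(mul0r, mulr0, addr0, subr0).
have -> : (3 * x1 ^+ 2 + A) / (2 * y1) = s by rewrite tang; field; rewrite two0 y0.
have -> : (- x1 ^+ 3 + A * x1 + 2 * B) / (2 * y1) = nu.
  have BE : B = y1 ^+ 2 - x1 ^+ 3 - A * x1 by rewrite -y12 onQ -x12; ring.
  rewrite BE; apply: (mulIf y20); rewrite divfK //.
  transitivity (2 * y1 ^+ 2 - (3 * x1 ^+ 2 + A) * x1); first by ring.
  by rewrite tang hP; ring.
by rewrite ?mul0r ?addr0 ?subr0 x3E y3E.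
Qed.

End CollinearTriples.

(** Bezout for iterates of one map. It shows that the multiples of P are distinct without appeal to
    the associativity of the group law. *)
Lemma iter_coprime_fix (T : Type) (f : T -> T) (x : T) m n : (0 < m)%N -> coprime m n ->
  iter m f x = x -> iter n f x = x -> f x = x.
Proof.
move=> m_gt0 co_mn fm fn.
have fix_mul k q : iter q f x = x -> iter (k * q) f x = x.
  by move=> fq; elim: k => [//|k IH]; rewrite mulSn iterD IH.
case: (egcdnP n m_gt0) => km kn e _.
move: (fix_mul km m fm); rewrite {}e (eqP co_mn) addnC iterD.
by rewrite fix_mul.
Qed.

Section PrimeOrbit.
Variables (L : fieldType) (A B : L) (h : nat) (P : nat -> L * L).
Hypothesis two0 : 2 != 0 :> L.
Hypothesis disc0 : 4 * A ^+ 3 + 27 * B ^+ 2 != 0.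
Let p := (2 * h).+1.
Hypothesis h_gt0 : (0 < h)%N.
Hypothesis p_prime : prime p.
Hypothesis collinear_chain : forall k, (1 <= k < h)%N ->
  collinear A B (P 1%N) (P k) (opp_pt (P k.+1)).
Hypothesis collinear_last : collinear A B (P 1%N) (P h) (P h).
Let E := short_wcurve A B.

(** This is kP for 0 < k < p: the second half of the group consists of the negatives of the
    first. *)
Definition orbit_pt k : L * L := if (k <= h)%N then P k else opp_pt (P (p - k)%N).

Definition orbit_point k : point L :=
  if (0 < k < p)%N then Some (orbit_pt k) else None.

Lemma orbit_pt_opp k : (0 < k < p)%N -> orbit_pt (p - k) = opp_pt (orbit_pt k).
Proof.
move=> kp; rewrite /orbit_pt; case: (leqP k h) => hk.
  by rewrite ifF; [congr (opp_pt (P _)); lia | apply/negP; rewrite /p in kp *; lia].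
by rewrite ifT ?opp_ptK // /p in kp *; lia.
Qed.

Lemma orbit_collinear k : (0 < k)%N -> (k < 2 * h)%N ->
  collinear A B (orbit_pt 1) (orbit_pt k) (opp_pt (orbit_pt k.+1)).
Proof.
have le1 : forall k, (0 < k <= h)%N ->
    collinear A B (orbit_pt 1) (orbit_pt k) (opp_pt (orbit_pt k.+1)).
  move=> {}k kh; rewrite {1 2}/orbit_pt h_gt0 ifT; last by lia.
  have [lt_kh|] := ltnP k h.
    by rewrite /orbit_pt lt_kh; apply: collinear_chain; lia.
  move=> le_hk; have ek : k = h by lia.
  rewrite ek; have -> : opp_pt (orbit_pt h.+1) = P h; last exact: collinear_last.
  rewrite -orbit_pt_opp; last by rewrite /p; lia.
  by rewrite /orbit_pt ifT; [congr P|]; rewrite /p; lia.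
move=> k0 k2; have [le_kh|lt_hk] := leqP k h; first by apply: le1; lia.
(* Beyond the middle, the line through P, kP and -(k+1)P is the line already treated for the index p
   - (k+1), with its last two points exchanged. *)
apply: collinear_swap; rewrite -orbit_pt_opp; last by rewrite /p; lia.
have -> : orbit_pt k = opp_pt (orbit_pt (p - k.+1).+1).
  rewrite -orbit_pt_opp; last by rewrite /p; lia.
  by congr orbit_pt; rewrite /p; lia.
by apply: le1; rewrite /p; lia.
Qed.

Lemma orbit_pt_on_curve k : (0 < k < p)%N ->
  (orbit_pt k).2 ^+ 2 = (orbit_pt k).1 ^+ 3 + A * (orbit_pt k).1 + B.
Proof.
move=> kp; have [k2|k2] := ltnP k (2 * h).
  by apply: collinear_on_curve (orbit_collinear _ k2); lia.
have -> : k = (p - 1)%N by rewrite /p in kp *; lia.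
rewrite orbit_pt_opp; last by rewrite /p; lia.
rewrite /opp_pt /= sqrrN; apply: collinear_on_curve (orbit_collinear _ _); lia.
Qed.

Lemma mul_point_orbit k : (k <= p)%N -> mul_point E k (orbit_point 1) = orbit_point k.
Proof.
have o1 : orbit_point 1 = Some (orbit_pt 1) by rewrite /orbit_point ifT // /p; lia.
elim: k => [|k IH] le_kp; first by rewrite /orbit_point.
rewrite /mul_point iterS -/(mul_point _ _ _) IH; last exact: ltnW.
case: k {IH} => [|k] in le_kp *; first by rewrite o1 /=; case: (orbit_pt 1).
have -> : orbit_point k.+1 = Some (orbit_pt k.+1) by rewrite /orbit_point ifT //=.
rewrite o1; have [lt_k|ge_k] := ltnP k.+1 (2 * h).
  rewrite (add_collinear two0 disc0 (orbit_collinear _ lt_k)) // opp_ptK.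
  by rewrite /orbit_point ifT // /p; lia.
have ek : k.+2 = p by rewrite /p in le_kp *; lia.
rewrite ek /orbit_point ltnn andbF.
have -> : orbit_pt k.+1 = opp_pt (orbit_pt 1).
  rewrite -orbit_pt_opp; last by rewrite /p; lia.
  by congr orbit_pt; rewrite -ek; lia.
by case: (orbit_pt 1) => x y; rewrite /= eqxx mul0r !addr0 subrr eqxx.
Qed.

Lemma mul_point_orbit_order k : mul_point E k (orbit_point 1) = orbit_point (k %% p).
Proof.
have iter_p q : mul_point E (q * p) (orbit_point 1) = None.
  have ep : mul_point E p (orbit_point 1) = None.
    by rewrite mul_point_orbit // /orbit_point ltnn andbF.
  elim: q => [//|q IH]; rewrite mulSn /mul_point iterD -/(mul_point _ (q * p) _) IH.
  exact: ep.
rewrite {1}(divn_eq k p) addnC /mul_point iterD -/(mul_point _ (_ * p) _) iter_p.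
by apply: mul_point_orbit; rewrite ltnW // ltn_mod.
Qed.

Lemma orbit_point_inj i j : (i < p)%N -> (j < p)%N -> orbit_point i = orbit_point j -> i = j.
Proof.
wlog lt_ij : i j / (i < j)%N.
  move=> H ip jp e; case: (ltngtP i j) => // lt_ij; first exact: H.
  by apply/esym/H.
move=> ip jp e; exfalso.
(* Adding P a further p - j times to iP = jP shows that m steps lead from O back to O, as p steps
   do. Since 0 < m < p is prime to p, one step would also fix O. *)
pose m := (p - j + i)%N.
have fixm : iter m (add_point E (orbit_point 1)) None = None.
  rewrite /m iterD -/(mul_point _ i _) mul_point_orbit ?(ltnW ip) // e.
  have -> : orbit_point j = iter j (add_point E (orbit_point 1)) None.
    exact: esym (mul_point_orbit (ltnW jp)).
  rewrite -iterD subnK ?(ltnW jp) //.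
  by rewrite -/(mul_point _ p _) mul_point_orbit // /orbit_point ltnn andbF.
have fixp : iter p (add_point E (orbit_point 1)) None = None.
  by rewrite -/(mul_point _ p _) mul_point_orbit // /orbit_point ltnn andbF.
have co : coprime m p.
  by rewrite coprime_sym prime_coprime // gtnNdvd // /m; lia.
have m_gt0 : (0 < m)%N by rewrite /m; lia.
have := iter_coprime_fix m_gt0 co fixm fixp.
rewrite /orbit_point ifT; last by rewrite /p; lia.
by case: (orbit_pt 1).
Qed.

Lemma orbit_abscissa_inj i j : (1 <= i <= h)%N -> (1 <= j <= h)%N ->
  (P i).1 = (P j).1 -> i = j.
Proof.
move=> hi hj xij.
have Pk k : (1 <= k <= h)%N -> P k = orbit_pt k by rewrite /orbit_pt => /andP [_ ->].
have ip : (0 < i < p)%N by rewrite /p; lia.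
have jp : (0 < j < p)%N by rewrite /p; lia.
have : (P i).2 ^+ 2 = (P j).2 ^+ 2.
  by rewrite !Pk // !orbit_pt_on_curve // -!Pk // xij.
move/eqP; rewrite eqf_sqr => /orP [] /eqP yij.
  apply: orbit_point_inj; [by lia | by lia |].
  rewrite /orbit_point ip jp -!Pk //; congr Some.
  by move: xij yij; case: (P i) (P j) => [? ?] [? ?] /= -> ->.
have e : i = (p - j)%N; last by rewrite /p in e; lia.
apply: orbit_point_inj; [by lia | by rewrite /p; lia |].
have jp' : (0 < p - j < p)%N by rewrite /p in jp *; lia.
rewrite /orbit_point ip jp' orbit_pt_opp // -!Pk //; congr Some.
by move: xij yij; case: (P i) (P j) => [? ?] [? ?]; rewrite /opp_pt /= => -> ->.
Qed.

Lemma orbit_ordinate_neq0 i : (1 <= i <= h)%N -> (P i).2 != 0.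
Proof.
move=> hi; apply/eqP => y0.
have Pi : orbit_pt i = P i by rewrite /orbit_pt; case/andP: hi => _ ->.
have ip : (0 < i < p)%N by rewrite /p; lia.
have ip' : (0 < p - i < p)%N by rewrite /p in ip *; lia.
have e : i = (p - i)%N; last by rewrite /p in e; lia.
apply: orbit_point_inj; [by lia | by lia |].
rewrite /orbit_point ip ip' orbit_pt_opp // Pi /opp_pt y0 oppr0 -y0.
by case: (P i).
Qed.

Variables (D : {poly L}).
Hypotheses (sD : size D = h.+1) (rD : forall k, (1 <= k <= h)%N -> root D (P k).1).

Let xs := [seq (P k).1 | k <- iota 1 h].

Lemma uniq_abscissas : uniq xs.
Proof.
rewrite map_inj_in_uniq ?iota_uniq // => i j; rewrite !mem_iota => hi hj.
by apply: orbit_abscissa_inj; lia.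
Qed.

(** The h abscissas are distinct, because equal ones would make jP equal to iP or -iP with i and j
    both at most h. They therefore exhaust the roots of D, which has degree h. *)
Lemma kernel_polyE : D = lead_coef D *: \prod_(x <- xs) ('X - x%:P).
Proof.
apply: all_roots_prod_XsubC.
- by rewrite size_map size_iota sD.
- apply/allP => x /mapP [k]; rewrite mem_iota => hk ->; apply: rD; lia.
- by rewrite uniq_rootsE uniq_abscissas.
Qed.

Lemma kernel_poly_root x : root D x -> exists2 k, (1 <= k <= h)%N & x = (P k).1.
Proof.
rewrite kernel_polyE rootZ; last first.
  by rewrite lead_coef_eq0 -size_poly_gt0 sD.
rewrite root_prod_XsubC => /mapP [k]; rewrite mem_iota => hk ->; exists k => //; lia.
Qed.

Lemma kernel_poly_separable : coprimep D D^`().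
Proof.
have l0 : lead_coef D != 0 by rewrite lead_coef_eq0 -size_poly_gt0 sD.
have := separable_prod_XsubC xs; rewrite uniq_abscissas unlock => sep.
by rewrite kernel_polyE derivZ coprimepZl // coprimepZr.
Qed.

Lemma affine_orbit x y : y ^+ 2 = x ^+ 3 + A * x + B -> root D x ->
  exists2 k, (0 < k < p)%N & Some (x, y) = orbit_point k.
Proof.
move=> xy /kernel_poly_root [k hk xk].
have kp : (0 < k < p)%N by rewrite /p; lia.
have Pk : orbit_pt k = P k by rewrite /orbit_pt; case/andP: hk => _ ->.
have : y ^+ 2 = (P k).2 ^+ 2 by rewrite xy -Pk orbit_pt_on_curve // Pk xk.
move/eqP; rewrite eqf_sqr => /orP [] /eqP yk.
  by exists k => //; rewrite /orbit_point kp Pk xk yk; case: (P k).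
exists (p - k)%N; first by rewrite /p in kp *; lia.
rewrite /orbit_point ifT; last by rewrite /p in kp *; lia.
by rewrite orbit_pt_opp // Pk /opp_pt xk yk.
Qed.

End PrimeOrbit.

(** * The Weierstrass equation for the formula of Kohel *)

Section TopCoefficient.
Variable F : fieldType.
Implicit Types (P Q : {poly F}) (a b : nat) (c d : F).

(** A nominal degree: c may vanish, so that the rules below hold in every characteristic. *)
Definition top a P c := (size P <= a.+1)%N /\ P`_a = c.

Lemma top_mul a b P Q c d : top a P c -> top b Q d -> top (a + b) (P * Q) (c * d).
Proof.
move=> [sP <-] [sQ <-]; split.
  by apply: leq_trans (size_polyMleq _ _) _; lia.
rewrite coefM (bigD1 (inord a)) //= inordK ?ltnS ?leq_addr // addKn big1 ?addr0 //.
move=> i ne; have ia : (i : nat) != a.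
  by apply: contra ne => /eqP ia; apply/eqP/val_inj; rewrite /= inordK ?ltnS ?leq_addr.
case: (ltngtP i a) => [lt|gt|e]; last by rewrite e eqxx in ia.
  by rewrite [X in _ * X]nth_default ?mulr0 //; apply: leq_trans sQ _; lia.
by rewrite nth_default ?mul0r //; apply: leq_trans sP _.
Qed.

Lemma top_add a P Q c d : top a P c -> top a Q d -> top a (P + Q) (c + d).
Proof.
move=> [sP <-] [sQ <-]; split; last by rewrite coefD.
by rewrite (leq_trans (size_polyD _ _)) // geq_max sP.
Qed.

Lemma top_opp a P c : top a P c -> top a (- P) (- c).
Proof. by move=> [sP <-]; split; rewrite ?size_polyN ?coefN. Qed.

Lemma top_scale a P c k : top a P c -> top a (k *: P) (k * c).
Proof.
by move=> [sP <-]; split; rewrite ?coefZ // (leq_trans (size_scale_leq _ _)).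
Qed.

Lemma top_deriv a P c : top a.+1 P c -> top a P^`() (a.+1%:R * c).
Proof.
move=> [sP <-]; split; last by rewrite coef_deriv mulr_natl.
have [->|P0] := eqVneq P 0; first by rewrite linear0 size_poly0.
by rewrite -ltnS (leq_trans (lt_size_deriv P0)).
Qed.

Lemma top_size a P c : top a P c -> c != 0 -> size P = a.+1.
Proof.
move=> [sP <-] c0; apply/eqP; rewrite eqn_leq sP ltnNge.
by apply: contra c0 => h; rewrite nth_default.
Qed.

End TopCoefficient.

(* A factor of D can be split off any solution Q of Q' D = k Q D'. *)
Lemma log_derivative_factor (F : fieldType) (D Q : {poly F}) k :
  coprimep D D^`() -> D != 0 -> k.+1%:R != 0 :> F -> Q^`() * D = k.+1%:R *: (Q * D^`()) ->
  exists Q1, Q = Q1 * D /\ Q1^`() * D = k%:R *: (Q1 * D^`()).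
Proof.
move=> coD D0 k0 e.
have : D %| Q * D^`().
  have -> : Q * D^`() = ((k.+1%:R)^-1 *: Q^`()) * D.
    by rewrite -scalerAl e scalerA mulVf // scale1r.
  exact: dvdp_mulIr.
rewrite Gauss_dvdpl // => /dvdpP [Q1 QE]; exists Q1; split => //.
apply: (mulIf D0); move: e; rewrite QE derivM -!mul_polyC -natr1 polyCD => e.
apply/eqP; rewrite -subr_eq0; apply/eqP; transitivity
  ((Q1^`() * D + Q1 * D^`()) * D - (k%:R%:P + 1%:P) * (Q1 * D * D^`())); last by rewrite e subrr.
by rewrite polyC1; ring.
Qed.

Lemma deriv_eq0_const (F : fieldType) (Q : {poly F}) : 2 != 0 :> F -> 3 != 0 :> F ->
  (size Q <= 4)%N -> Q^`() = 0 -> Q = (Q`_0)%:P.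
Proof.
move=> n2 n3 sQ Q'; apply/polyP => i; rewrite coefC; case: i => [//|i] /=.
have : Q^`()`_i = 0 by rewrite Q' coef0.
rewrite coef_deriv; case: i => [|[|[|i]]].
- by rewrite mulr1n.
- by rewrite -mulr_natl => /eqP; rewrite mulf_eq0 (negbTE n2) => /eqP.
- by rewrite -mulr_natl => /eqP; rewrite mulf_eq0 (negbTE n3) => /eqP.
- by move=> _; rewrite nth_default // (leq_trans sQ).
Qed.

Section VeluIdentities.
Variables (R : comNzRingType) (dd : R -> R).
Hypotheses (ddD : forall a b, dd (a + b) = dd a + dd b) (ddN : forall a, dd (- a) = - dd a).
Hypothesis ddM : forall a b, dd (a * b) = dd a * b + a * dd b.
Variables (x A2 B2 p f f1 ell D U V E2 E4 : R).
Hypotheses (df : dd f = f1) (df1 : dd f1 = 6 * x) (dx : dd x = 1).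
Hypotheses (dell : dd ell = p) (dp : dd p = 0) (dA2 : dd A2 = 0) (dB2 : dd B2 = 0).
Let D1 := dd D.
Hypothesis UE : U = 4 * f * (D1 ^+ 2 - D * dd D1) - 2 * f1 * D * D1 + ell * D ^+ 2.
Hypothesis VE : V = dd U * D - 2 * U * D1.
Hypothesis E2E : E2 = 2 * f * dd D1 + f1 * D1.
Hypothesis E4E : E4 = 2 * f * dd (dd E2) + f1 * dd E2.

Let dd1 : dd 1 = 0.
Proof.
have := ddM 1 1; rewrite !mulr1 mul1r => h.
by apply: (addrI (dd 1)); rewrite addr0 -h.
Qed.
Let dd0 : dd 0 = 0.
Proof. by have := ddM 0 0; rewrite !mulr0 mul0r addr0. Qed.
Let ddn k : dd k%:R = 0.
Proof. by elim: k => [//|k IH]; rewrite -natr1 ddD IH dd1 addr0. Qed.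

Let W := f * V ^+ 2 - U ^+ 3 - A2 * (U * D ^+ 4) - B2 * D ^+ 6.
Let Z := f1 * V * D + 2 * f * (dd V * D - 3 * (V * D1)) - 3 * U ^+ 2 - A2 * D ^+ 4.

(** With X = U/D^2 and X' = V/D^3, the quotient W/D^6 is f X'^2 - X^3 - A2 X - B2. Its derivative is
    X' times f' X' + 2 f X'' - 3 X^2 - A2, which is Z/D^4. Working in a ring with an abstract
    derivation keeps the identities within reach of [ring]. *)
Lemma defect_deriv : dd W * D - 6 * (W * D1) = V * Z.
Proof.
have dUD : dd U * D = V + 2 * U * D1 by rewrite VE; ring.
have dW : dd W = f1 * V ^+ 2 + 2 * f * V * dd V - 3 * U ^+ 2 * dd U
    - A2 * (dd U * D ^+ 4 + 4 * U * D ^+ 3 * D1) - 6 * B2 * D ^+ 5 * D1.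
  rewrite /W !exprS !expr0 !mulr1 !(ddn, ddD, ddN, ddM) df dA2 dB2 -/D1; ring.
rewrite dW /Z /W.
transitivity ((f1 * V ^+ 2 + 2 * f * V * dd V - 6 * B2 * D ^+ 5 * D1
  - 4 * A2 * U * D ^+ 3 * D1) * D - (3 * U ^+ 2 + A2 * D ^+ 4) * (dd U * D)
  - 6 * ((f * V ^+ 2 - U ^+ 3 - A2 * (U * D ^+ 4) - B2 * D ^+ 6) * D1)); first by ring.
by rewrite dUD; ring.
Qed.

Let D2 := dd D1.
Let D3 := dd D2.
Let D4 := dd D3.

Let dU : dd U = 4 * f1 * (D1 ^+ 2 - D * D2) + 4 * f * (D1 * D2 - D * D3)
  - 12 * x * D * D1 - 2 * f1 * (D1 ^+ 2 + D * D2) + p * D ^+ 2 + 2 * ell * D * D1.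
Proof.
rewrite UE !expr2 !(ddn, ddD, ddN, ddM) df df1 dell -/D1 -/D2 -/D3; ring.
Qed.

Let d2U : dd (dd U) = 24 * x * (D1 ^+ 2 - D * D2) + 8 * f1 * (D1 * D2 - D * D3)
  + 4 * f * (D2 ^+ 2 - D * D4)
  - 12 * D * D1 - 24 * x * D1 ^+ 2 - 24 * x * D * D2 - 2 * f1 * (3 * D1 * D2 + D * D3)
  + 4 * p * D * D1 + 2 * ell * (D1 ^+ 2 + D * D2).
Proof.
rewrite dU !expr2 !(ddn, ddD, ddN, ddM) df df1 dell dx dp -/D1 -/D2 -/D3 -/D4; ring.
Qed.

Let dV : dd V = dd (dd U) * D - dd U * D1 - 2 * U * D2.
Proof. rewrite VE !(ddn, ddD, ddN, ddM) -/D1 -/D2; ring. Qed.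

Let dE2 : dd E2 = 3 * f1 * D2 + 2 * f * D3 + 6 * x * D1.
Proof. rewrite E2E !(ddn, ddD, ddN, ddM) df df1 -/D2 -/D3; ring. Qed.

Let d2E2 : dd (dd E2) = 24 * x * D2 + 5 * f1 * D3 + 2 * f * D4 + 6 * D1.
Proof. rewrite dE2 !(ddn, ddD, ddN, ddM) df df1 dx -/D2 -/D3 -/D4; ring. Qed.

Lemma defect_hirota :
  Z = - (D ^+ 2 * (2 * (D * E4 - 8 * f * D1 * dd E2 + 3 * E2 ^+ 2)
        - 12 * ell * (D * E2 - 2 * f * D1 ^+ 2)
        + (3 * ell ^+ 2 + A2 - p * f1) * D ^+ 2)).
Proof. rewrite /Z dV VE E4E d2E2 dE2 d2U dU E2E -/D2 UE -/D2; ring. Qed.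

(** The two leading terms of f V^2 and U^3 along D cancel whatever D is. Removing D^2 beforehand
    leaves only the exponents 4, 3, 2, 1 to be divided by, so that characteristic 5 needs no special
    treatment. *)
Lemma defect_square_factor : exists Q, W = Q * D ^+ 2.
Proof.
pose S := 4 * f * D2 + 2 * f1 * D1 - ell * D.
exists (f * dd U ^+ 2 + U * (- 8 * ell * f * D1 ^+ 2 + 4 * f * D1 * dd S - S ^+ 2)
        - A2 * U * D ^+ 2 - B2 * D ^+ 4).
have dS : dd S = 4 * f * D3 + 6 * f1 * D2 + 12 * x * D1 - p * D - ell * D1.
  rewrite /S !(ddn, ddD, ddN, ddM) df df1 dell -/D1 -/D2 -/D3; ring.
rewrite dS /S /W VE dU UE -/D2; ring.
Qed.

End VeluIdentities.

Lemma derivE_facts (F : fieldType) :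
  [/\ forall a b : {poly F}, (a + b)^`() = a^`() + b^`(),
      forall a : {poly F}, (- a)^`() = - a^`()
    & forall a b : {poly F}, (a * b)^`() = a^`() * b + a * b^`()].
Proof. by split; [exact: derivD | exact: derivN | exact: derivM]. Qed.

Section OddIsogeny.
Variables (F : fieldType) (A B A2 B2 c : F) (h : nat) (D : {poly F}).
Hypotheses (n2 : 2 != 0 :> F) (n3 : 3 != 0 :> F).
Hypotheses (sD : size D = h.+1) (h_gt0 : (0 < h)%N).
Let p := (2 * h).+1.

Let f : {poly F} := cubic A B.
Let f1 : {poly F} := 3 * 'X ^+ 2 + A%:P.
Let ell : {poly F} := p%:R * 'X + c%:P.

Definition velu_num : {poly F} :=
  4 * f * (D^`() ^+ 2 - D * D^`()^`()) - 2 * f1 * D * D^`() + ell * D ^+ 2.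
Let U := velu_num.
(** V/D^3 is the derivative of U/D^2: the isogeny is normalized, pulling dX/Y back to dx/y. *)
Definition velu_yfactor : {poly F} := U^`() * D - 2 * U * D^`().
Let V := velu_yfactor.

(* theta2 is the square of the derivation d/dz, where (dx/dz) ^ 2 = 2 f. *)
Definition theta2 (g : {poly F}) : {poly F} := 2 * f * g^`()^`() + f1 * g^`().

(* Hirota's bilinear form of the equation theta2 X = 3 X ^ 2 + A2 satisfied by
   X = ell - 2 theta2 (log D) = U / D ^ 2. *)
Definition hirota : {poly F} :=
  2 * (D * theta2 (theta2 D) - 8 * f * D^`() * (theta2 D)^`() + 3 * theta2 D ^+ 2)
  - 12 * ell * (D * theta2 D - 2 * f * D^`() ^+ 2)
  + (3 * ell ^+ 2 + A2%:P - p%:R * f1) * D ^+ 2.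

Definition velu_defect : {poly F} :=
  f * V ^+ 2 - U ^+ 3 - A2%:P * (U * D ^+ 4) - B2%:P * D ^+ 6.

Let derivX1 : ('X : {poly F})^`() = 1. Proof. exact: derivX. Qed.
Let df : f^`() = f1.
Proof.
by rewrite /f /f1 /cubic !derivD derivZ derivC derivX derivXn /= addr0 alg_polyC -mulr_natl.
Qed.
Let df1 : f1^`() = 6 * 'X.
Proof.
by rewrite /f1 derivD derivC derivM -polyC_natr derivC derivXn /= polyC_natr; ring.
Qed.
Let dell : ell^`() = p%:R.
Proof. by rewrite /ell derivD derivC derivM -polyC_natr derivC derivX; ring. Qed.

(** With l the leading coefficient of D, that of U is (4h^2 - 4h(h-1) - 6h + 2h+1) l^2 = l^2 and
    that of V is (2h+1 - 2h) l^3 = l^3. No integer factor remains, so the degrees do not drop in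
    positive characteristic. *)
Lemma velu_sizes : size U = (2 * h).+2 /\ size V = (3 * h).+1.
Proof.
pose l := lead_coef D.
have l0 : l != 0 by rewrite lead_coef_eq0 -size_poly_gt0 sD.
have tD : top h D l by split; [rewrite sD | rewrite /l lead_coefE sD].
have [k hk] : exists k, h = k.+1 by exists h.-1; rewrite prednK.
have tD1 : top k D^`() (h%:R * l).
  by have := tD; rewrite hk => /top_deriv.
have tf : top 3 f 1.
  split; first by rewrite size_cubic.
  by rewrite /f /cubic !coefD coefXn coefZ coefX coefC /= mulr0 !addr0.
have tf1 : top 2 f1 3.
  rewrite /f1 -polyC_natr mul_polyC; split.
    rewrite (leq_trans (size_polyD _ _)) // geq_max (leq_trans (size_scale_leq _ _)) ?size_polyXn //.
    by rewrite (leq_trans (size_polyC_leq1 _)).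
  by rewrite coefD coefZ coefXn coefC /= mulr1 addr0.
have tell : top 1 ell p%:R.
  rewrite /ell -polyC_natr mul_polyC; split.
    rewrite (leq_trans (size_polyD _ _)) // geq_max (leq_trans (size_scale_leq _ _)) ?size_polyX //.
    by rewrite (leq_trans (size_polyC_leq1 _)).
  by rewrite coefD coefZ coefX coefC /= mulr1 addr0.
have tfD2 : top (k + 2) (f * D^`()^`()) (h%:R * k%:R * l).
  case: k => [|k'] in hk tD1 *.
    have -> : D^`()^`() = 0.
      case: tD1 => s1 _; have [->|D10] := eqVneq D^`() 0; first by rewrite linear0.
      by apply/eqP; rewrite -size_poly_eq0 -leqn0 -ltnS (leq_trans (lt_size_deriv D10)).
    by rewrite !mulr0 mul0r; split; rewrite ?size_poly0 ?coef0.
  have := top_mul tf (top_deriv tD1).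
  by rewrite mul1r [k'.+1%:R * _]mulrA [k'.+1%:R * _]mulrC (_ : 3 + k' = k'.+1 + 2)%N //; lia.
have nat_scale n (P : {poly F}) : n%:R * P = n%:R *: P by rewrite -polyC_natr mul_polyC.
have tU : top (2 * h).+1 U (l ^+ 2).
  have -> : U = 4 *: (f * (D^`() * D^`())) - 4 *: (D * (f * D^`()^`()))
      - 2 *: (f1 * (D * D^`())) + ell * (D * D).
    by rewrite /U /velu_num -!nat_scale; ring.
  have t1 := top_scale 4 (top_mul tf (top_mul tD1 tD1)).
  have t2 := top_scale 4 (top_mul tD tfD2).
  have t3 := top_scale 2 (top_mul tf1 (top_mul tD tD1)).
  have t4 := top_mul tell (top_mul tD tD).
  have e1 : (3 + (k + k) = (2 * h).+1)%N by lia.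
  have e2 : (h + (k + 2) = (2 * h).+1)%N by lia.
  have e3 : (2 + (h + k) = (2 * h).+1)%N by lia.
  have e4 : (1 + (h + h) = (2 * h).+1)%N by lia.
  rewrite e1 in t1; rewrite e2 in t2; rewrite e3 in t3; rewrite e4 in t4.
  have := top_add (top_add (top_add t1 (top_opp t2)) (top_opp t3)) t4.
  have -> : p%:R = 2 * k%:R + 3 :> F.
    have -> : p = (2 * k + 3)%N by rewrite /p hk; lia.
    by rewrite natrD natrM.
  have -> : h%:R = k%:R + 1 :> F by rewrite hk -natr1.
  by set z := (X in top _ _ X); have -> : z = l ^+ 2 by rewrite /z; ring.
have tV : top (3 * h) V (l ^+ 3).
  have -> : V = U^`() * D - 2 *: (U * D^`()) by rewrite /V /velu_yfactor -nat_scale; ring.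
  have t1 := top_mul (top_deriv tU) tD.
  have t2 := top_scale 2 (top_mul tU tD1).
  have e1 : (2 * h + h = 3 * h)%N by lia.
  have e2 : ((2 * h).+1 + k = 3 * h)%N by lia.
  rewrite e1 in t1; rewrite e2 in t2.
  have := top_add t1 (top_opp t2).
  have -> : (2 * h).+1%:R = 2 * h%:R + 1 :> F by rewrite -natr1 natrM.
  by set z := (X in top _ _ X); have -> : z = l ^+ 3 by rewrite /z; ring.
by rewrite (top_size tU) ?expf_neq0 // (top_size tV) ?expf_neq0.
Qed.

Hypothesis hirota0 : hirota = 0.
Hypothesis coD : coprimep D D^`().
Hypothesis defect_const : forall r, velu_defect = r%:P * D ^+ 6 -> r = 0.

(** Once Hirota's form vanishes, the logarithmic derivative of the defect W is 6 D'/D. Separability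
    of D then splits off D^6, the quotient has derivative 0, and [defect_const] excludes a nonzero
    constant. *)
Lemma velu_isogeny_data : isogeny_data A B A2 B2 h U V D.
Proof.
have [sU sV] := velu_sizes; split=> //.
have [dD dN dM] := derivE_facts F.
have dA2 : (A2%:P)^`() = 0 by rewrite derivC.
have dB2 : (B2%:P)^`() = 0 by rewrite derivC.
have dp : (p%:R : {poly F})^`() = 0 by rewrite -polyC_natr derivC.
have D0 : D != 0 by rewrite -size_poly_gt0 sD.
have Wder := defect_deriv dD dN dM df dA2 dB2 (erefl V).
rewrite (defect_hirota dD dN dM A2%:P df df1 derivX1 dell dp (erefl U) (erefl V)
  (erefl (theta2 D)) (erefl (theta2 (theta2 D)))) in Wder.
have [Q WQ] := defect_square_factor dD dN dM A2%:P B2%:P df df1 dell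
  (erefl U) (erefl V).
rewrite -/hirota hirota0 mulr0 oppr0 mulr0 WQ in Wder.
have Q4 : Q^`() * D = 4 *: (Q * D^`()).
  apply: (mulIf (expf_neq0 2 D0)); apply/eqP; rewrite -subr_eq0; apply/eqP.
  rewrite -[RHS]Wder expr2 !derivM.
  by rewrite -mul_polyC polyC_natr; ring.
have n4 : 4 != 0 :> F by rewrite (_ : 4 = 2 * 2 :> F) ?mulf_neq0 //; ring.
have [Q1 [QE1 {Q4}/= /(log_derivative_factor coD D0 n3)]] := log_derivative_factor coD D0 n4 Q4.
move=> [Q2 [QE2 /(log_derivative_factor coD D0 n2)]].
move=> [Q3 [QE3 /(@log_derivative_factor _ _ _ 0 coD D0 (oner_neq0 F))]].
move=> [Q5 [QE5]]; rewrite scale0r => /eqP; rewrite mulf_eq0 (negbTE D0) orbF => /eqP Q5'.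
have WE : velu_defect = Q5 * D ^+ 6.
  by rewrite /velu_defect WQ QE1 QE2 QE3 QE5; ring.
have sW : (size velu_defect <= 6 * h + 4)%N.
  rewrite /velu_defect !mul_polyC.
  have s1 : (size (f * V ^+ 2)%R <= 6 * h + 4)%N.
    by rewrite (size_mul_monic_bound (size_cubic A B) (size_exp_eq 2 sV)); lia.
  have s2 : (size (U ^+ 3) <= 6 * h + 4)%N by rewrite (size_exp_eq 3 sU); lia.
  have s3 : (size (A2 *: (U * D ^+ 4)) <= 6 * h + 4)%N.
    rewrite (leq_trans (size_scale_leq _ _)) //.
    by rewrite (size_mul_monic_bound sU (size_exp_eq 4 sD)); lia.
  have s4 : (size (B2 *: D ^+ 6) <= 6 * h + 4)%N.
    by rewrite (leq_trans (size_scale_leq _ _)) // (size_exp_eq 6 sD); lia.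
  do 3 (rewrite (leq_trans (size_polyD _ _)) // geq_max size_polyN ?s1 ?s2 ?s3 ?s4 ?andbT //).
(* W has degree at most 6h+3, so the quotient by D^6 is at most a cubic. This is why characteristics
   other than 2 and 3 let a zero derivative imply constancy. *)
have sQ : (size Q5 <= 4)%N.
  have [->|Q50] := eqVneq Q5 0; first by rewrite size_poly0.
  move: sW; rewrite WE size_mul ?expf_neq0 // (size_exp_eq 6 sD).
  by move: (size Q5) => n; lia.
have Qc := deriv_eq0_const n2 n3 sQ Q5'.
have Q50 : Q5 = 0 by rewrite Qc (defect_const (r := Q5`_0)) // WE {1}Qc.
move: WE; rewrite Q50 mul0r /velu_defect !mul_polyC -addrA -opprD -addrA -opprD.
by move/eqP; rewrite subr_eq0 => /eqP ->; rewrite addrA.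
Qed.

End OddIsogeny.

(** * Cyclic isogenies of odd prime degree *)

Section CyclicOddIsogeny.
Variables (F : fieldType) (A B A2 B2 c : F) (h : nat) (D : {poly F}).
Hypotheses (n2 : 2 != 0 :> F) (n3 : 3 != 0 :> F) (disc0 : 4 * A ^+ 3 + 27 * B ^+ 2 != 0).
Hypotheses (sD : size D = h.+1) (h_gt0 : (0 < h)%N).
Let p := (2 * h).+1.
Hypothesis p_prime : prime p.

(* P 1, ..., P h are successive multiples of a point of order p whose
   abscissas are roots of D. *)
Definition kernel_chain (L : fieldType) (iota : F -> L) : Prop :=
  exists P : nat -> L * L,
  [/\ forall k, (1 <= k < h)%N ->
        collinear (iota A) (iota B) (P 1%N) (P k) (opp_pt (P k.+1)),
      collinear (iota A) (iota B) (P 1%N) (P h) (P h)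
    & forall k, (1 <= k <= h)%N -> root (map_poly iota D) (P k).1].

Hypothesis chain_closed : forall (L : closedFieldType) (iota : {rmorphism F -> L}),
  kernel_chain iota.
Hypothesis chain_ext : exists (L : fieldType) (iota : {rmorphism F -> L}), kernel_chain iota.
Hypothesis hirota0 : hirota A B A2 c h D = 0.
Hypothesis defect_const : forall r, velu_defect A B A2 B2 c h D = r%:P * D ^+ 6 -> r = 0.

Let U := velu_num A B c h D.
Let V := velu_yfactor A B c h D.
Let f := cubic A B.

Lemma chain_hyps (L : fieldType) (iota : {rmorphism F -> L}) :
  [/\ 2 != 0 :> L, 4 * iota A ^+ 3 + 27 * iota B ^+ 2 != 0
    & size (map_poly iota D) = h.+1].
Proof.
split; last by rewrite size_map_poly.
  by rewrite -(rmorph_nat iota) fmorph_eq0.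
by rewrite -!(rmorph_nat iota) -!rmorphXn -!rmorphM -rmorphD fmorph_eq0.
Qed.

Lemma cubic_iota (L : fieldType) (iota : {rmorphism F -> L}) x :
  (map_poly iota f).[x] = x ^+ 3 + iota A * x + iota B.
Proof.
rewrite /f /cubic !rmorphD /= map_polyXn map_polyZ /= map_polyX map_polyC !hornerD.
by rewrite hornerXn hornerZ hornerX hornerC.
Qed.

(** Over the extension carrying a chain, the roots of D are distinct and no kernel point has y = 0.
    Coprimality descends to F. *)
Lemma chain_coprime : coprimep D D^`() /\ coprimep D f.
Proof.
have [L [iota [P [ch la rt]]]] := chain_ext.
have [n2' d0' sD'] := chain_hyps iota.
split.
  rewrite -(coprimep_map iota) -deriv_map.
  exact: (kernel_poly_separable n2' d0' h_gt0 p_prime ch la sD' rt).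
rewrite -(coprimep_map iota).
rewrite (kernel_polyE n2' d0' h_gt0 p_prime ch la sD' rt).
rewrite coprimepZl ?lead_coef_eq0 -?size_poly_gt0 ?sD' //.
rewrite big_map big_seq; elim/big_ind: _ => [|P1 P2 c1 c2|k hk]; first exact: coprime1p.
  by rewrite coprimepMl c1.
have {}hk : (1 <= k <= h)%N by move: hk; rewrite mem_iota; lia.
rewrite coprimep_sym coprimep_XsubC rootE cubic_iota.
have Pk : orbit_pt h P k = P k by rewrite /orbit_pt; case/andP: hk => _ ->.
have kp : (0 < k < p)%N by rewrite /p; lia.
have := orbit_pt_on_curve n2' d0' h_gt0 p_prime ch la kp; rewrite Pk => <-.
by rewrite expf_eq0 /= (orbit_ordinate_neq0 n2' d0' h_gt0 p_prime ch la).
Qed.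

(** This congruence modulo D shows both that U/D^2 is in lowest terms and that V does not vanish at
    the roots of D. *)
Lemma velu_num_mod : exists S, U = 4 * f * D^`() ^+ 2 - S * D.
Proof.
exists (4 * f * D^`()^`() + 2 * (3 * 'X^2 + A%:P) * D^`() - (p%:R * 'X + c%:P) * D).
by rewrite /U /velu_num -/f -/p; ring.
Qed.

Lemma velu_num_coprime : coprimep U (D ^+ 2).
Proof.
have [coD cof] := chain_coprime; have [S ->] := velu_num_mod.
apply: coprimep_expr; rewrite coprimep_sym addrC -mulNr coprimep_addl_mul.
have n4 : 4 != 0 :> F by rewrite (_ : 4 = 2 * 2 :> F) ?mulf_neq0 //; ring.
have c4 : coprimep D 4 by rewrite -polyC_natr -alg_polyC coprimepZr // coprimep1.
by rewrite (coprimepMr D (4 * f)) (coprimepMr D 4) c4 cof coprimep_expr.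
Qed.

(** U/D^2 is reduced with numerator of degree 2h+1 = p. Over an algebraically closed field the
    kernel is O together with the points above the roots of D, which are the multiples of the first
    point of the chain. *)
Theorem cyclic_odd_isogeny :
  cyclic_isogeny_of_degree (short_wcurve A B) (short_wcurve A2 B2) p /\
  exists h' U' V' D', isogeny_data A B A2 B2 h' U' V' D'.
Proof.
have [coD cof] := chain_coprime.
have [sU sV] := velu_sizes A B c n2 n3 sD h_gt0.
have dat := velu_isogeny_data n2 n3 sD h_gt0 hirota0 coD defect_const.
split; last by exists h, U, V, D.
exists (xy_map A B U V D); split.
- exact: isogeny_data_isogeny dat.
- apply: (isogeny_data_degree (N := U) (M := D ^+ 2) dat) => //.
  + exact: velu_num_coprime.
  + by rewrite (size_exp_eq 2 sD).
- move=> L iota; have [P [ch la rt]] := chain_closed iota.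
  have [n2' d0' sD'] := chain_hyps iota.
  have EL : map_wcurve iota (short_wcurve A B) = short_wcurve (iota A) (iota B).
    by rewrite /map_wcurve /short_wcurve /= rmorph0.
  have op k := mul_point_orbit_order n2' d0' h_gt0 p_prime ch la k.
  exists (orbit_point h P 1) => Q; rewrite EL; split.
    case: Q => [[x y]|]; last by exists 0%N.
    move=> /(kernel_affine dat) [xy rD].
    rewrite cubic_iota in xy.
    have [k kp ->] := affine_orbit n2' d0' h_gt0 p_prime ch la sD' rt xy rD.
    by exists k; rewrite op modn_small //; case/andP: kp.
  move=> [k ->]; rewrite op /orbit_point; move: (k %% _)%N => {}k.
  case: ifP => [kp|_]; last exact: (kernel_infty dat).
  have on := orbit_pt_on_curve n2' d0' h_gt0 p_prime ch la kp.
  have [rx y0] : root (map_poly iota D) (orbit_pt h P k).1 /\ (orbit_pt h P k).2 != 0.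
    have ne0 i : (1 <= i <= h)%N -> (P i).2 != 0.
      exact: (orbit_ordinate_neq0 n2' d0' h_gt0 p_prime ch la).
    rewrite /orbit_pt; case: leqP => hk /=.
      by rewrite rt ?ne0 //; case/andP: kp => ->.
    have hk' : (1 <= p - k <= h)%N by rewrite /p in kp *; lia.
    by rewrite oppr_eq0 rt ?ne0.
  case: (orbit_pt h P k) on rx y0 => x y /= on rx y0.
  have xy : y ^+ 2 = (map_poly iota f).[x] by rewrite cubic_iota.
  split; first by apply/on_curve_cubic.
  apply: (maps_to_infty_odd A B sU sV sD rx) => //.
  have hM u v : (map_poly iota (u * v)).[x] = (map_poly iota u).[x] * (map_poly iota v).[x].
    by rewrite rmorphM hornerM.
  have hB u v : (map_poly iota (u - v)).[x] = (map_poly iota u).[x] - (map_poly iota v).[x].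
    by rewrite rmorphB hornerD hornerN.
  have hX u : (map_poly iota (u ^+ 2)).[x] = (map_poly iota u).[x] ^+ 2.
    by rewrite rmorphXn horner_exp.
  have hn i : (map_poly iota i%:R).[x] = i%:R.
    by rewrite rmorph_nat -polyC_natr hornerC.
  have [S US] := velu_num_mod.
  have Dx : (map_poly iota D).[x] = 0 by apply/eqP.
  have D'x : (map_poly iota D^`()).[x] != 0.
    have co : coprimep (map_poly iota D) (map_poly iota D^`()) by rewrite coprimep_map.
    exact: coprimep_root co rx.
  have n4 : 4 != 0 :> L by rewrite (_ : 4 = 2 * 2 :> L) ?mulf_neq0 //; ring.
  have Ux : (map_poly iota U).[x] = 4 * y ^+ 2 * (map_poly iota D^`()).[x] ^+ 2.
    by rewrite US hB (hM S) Dx mulr0 subr0 (hM (4 * f)) (hM 4) hX hn -xy.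
  (* At a root of D, V = -2 U D' = -8 y^2 D'^3, which is nonzero. *)
  rewrite rootE /V /velu_yfactor -/U hB (hM (_^`())) Dx mulr0 sub0r oppr_eq0.
  rewrite (hM (2 * U)) (hM 2) hn Ux !mulf_neq0 ?expf_neq0 //.
Qed.

End CyclicOddIsogeny.

(** * Adjunction of roots, and isogenies of degree 3 *)

Lemma irreducible_factor (F : fieldType) (q : {poly F}) : (1 < size q)%N ->
  exists2 r, irreducible_poly r & r %| q.
Proof.
have [n] := ubnP (size q); elim: n q => // n IH q /ltnSE le_qn q_gt1.
have [irr|red] := classic (irreducible_poly q); first by exists q.
have [r [r1 rq nrq]] : exists r : {poly F}, [/\ size r != 1%N, r %| q & ~~ (r %= q)].
  apply: NNPP => no; apply: red; split=> // r r1 rq.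
  by apply: NNPP => nrq; apply: no; exists r; split=> //; apply/negP.
have q0 : q != 0 by rewrite -size_poly_gt0 ltnW.
have r0 : r != 0 by apply: contraNneq q0 => r0; rewrite r0 dvd0p in rq.
have lt_rq : (size r < size q)%N.
  by rewrite ltn_neqAle dvdp_leq // dvdp_size_eqp ?nrq.
have r_gt1 : (1 < size r)%N by rewrite ltn_neqAle eq_sym r1 size_poly_gt0.
have [s irr_s sr] := IH r (leq_trans lt_rq le_qn) r_gt1.
by exists s => //; apply: dvdp_trans sr rq.
Qed.

Lemma adjoin_root (F : fieldType) (q : {poly F}) : (1 < size q)%N ->
  exists (L : fieldType) (iota : {rmorphism F -> L}) (x : L), root (map_poly iota q) x.
Proof.
move=> /irreducible_factor [r irr_r rq].
have [L _ [x rx _]] := irredp_FAdjoin irr_r.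
exists L, (in_alg L), x; apply: root_dvdp rx.
by rewrite dvdp_map.
Qed.

Lemma adjoin_sqrt (F : fieldType) (a : F) :
  exists (L : fieldType) (iota : {rmorphism F -> L}) (x : L), x ^+ 2 = iota a.
Proof.
have [|L [iota [x]]] := @adjoin_root F ('X^2 - a%:P).
  by rewrite size_polyDl ?size_polyXn // size_polyN (leq_ltn_trans (size_polyC_leq1 _)).
rewrite rootE rmorphB /= map_polyXn map_polyC !hornerE subr_eq0 => /eqP e.
by exists L, iota, x.
Qed.

Lemma closed_root (L : closedFieldType) (q : {poly L}) : (1 < size q)%N -> exists x, root q x.
Proof. by move=> q1; apply/closed_rootP; rewrite gtn_eqF. Qed.

Lemma closed_sqrt (L : closedFieldType) (a : L) : exists x, x ^+ 2 = a.
Proof.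
have [|x] := @closed_root L ('X^2 - a%:P).
  by rewrite size_polyDl ?size_polyXn // size_polyN (leq_ltn_trans (size_polyC_leq1 _)).
by rewrite rootE !hornerE subr_eq0 => /eqP e; exists x.
Qed.

Section ThreeIsogeny.
Variables (F : fieldType) (A B A2 B2 a : F).
Hypotheses (n2 : 2 != 0 :> F) (n3 : 3 != 0 :> F) (disc0 : 4 * A ^+ 3 + 27 * B ^+ 2 != 0).
Hypothesis psi3 : 3 * a ^+ 4 + 6 * A * a ^+ 2 + 12 * B * a - A ^+ 2 = 0.
Let T := 6 * a ^+ 2 + 2 * A.
Hypotheses (hA2 : A2 = A - 5 * T).
Hypotheses (hB2 : B2 = B - 7 * (4 * (a ^+ 3 + A * a + B) + a * T)).
Let D : {poly F} := 'X - a%:P.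

Let fa := a ^+ 3 + A * a + B.

Let psi3_square : (3 * a ^+ 2 + A) ^+ 2 = 12 * a * fa.
Proof. by apply/eqP; rewrite eq_sym -subr_eq0 -psi3 /fa; apply/eqP; ring. Qed.

Lemma three_torsion_ordinate : fa != 0.
Proof.
apply: contraNneq disc0 => fa0; apply/eqP.
have /eqP : (3 * a ^+ 2 + A) ^+ 2 = 0 by rewrite psi3_square fa0 mulr0.
rewrite sqrf_eq0 addrC addr_eq0 => /eqP AE.
have -> : B = 2 * a ^+ 3.
  apply/eqP; rewrite -subr_eq0; apply/eqP.
  by rewrite -[RHS]fa0 /fa AE; ring.
by rewrite AE; ring.
Qed.

(** A point of order 3 is an inflection point. The third division polynomial vanishes at a exactly
    when (3 a^2 + A)^2 = 12 a f(a), that is when the tangent slope satisfies s^2 = 3 a. *)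
Lemma three_chain (L : fieldType) (iota : {rmorphism F -> L}) (y : L) :
  y ^+ 2 = iota fa -> kernel_chain A B 1 D iota.
Proof.
move=> yE.
have n2' : 2 != 0 :> L by rewrite -(rmorph_nat iota) fmorph_eq0.
have y0 : y != 0 by rewrite -sqrf_eq0 yE fmorph_eq0 three_torsion_ordinate.
pose s := iota (3 * a ^+ 2 + A) / (2 * y).
have sy : 2 * s * y = 3 * iota a ^+ 2 + iota A.
  have -> : 3 * iota a ^+ 2 + iota A = iota (3 * a ^+ 2 + A).
    by rewrite rmorphD rmorphM rmorphXn rmorph_nat.
  by rewrite /s; field; rewrite n2' y0.
have s2 : s ^+ 2 = 3 * iota a.
  have -> : s ^+ 2 = iota ((3 * a ^+ 2 + A) ^+ 2) / (4 * y ^+ 2).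
    by rewrite /s rmorphXn expr_div_n exprMn; congr (_ / (_ * _)); ring.
  rewrite psi3_square rmorphM -yE rmorphM rmorph_nat; field.
  by rewrite y0 (_ : 4 = 2 * 2 :> L) ?mulf_neq0 //; ring.
have yf : y ^+ 2 = iota a ^+ 3 + iota A * iota a + iota B.
  by rewrite yE /fa !rmorphD rmorphM rmorphXn.
exists (fun=> (iota a, y)); split.
- by move=> k; lia.
- exists s, (y - s * iota a); split; first by split=> /=; ring.
  split=> /=; first by rewrite s2; ring.
    transitivity (iota A - (2 * s * y) + 2 * s ^+ 2 * iota a); first by ring.
    by rewrite sy s2; ring.
  transitivity (iota B - y ^+ 2 + (2 * s * y) * iota a - s ^+ 2 * iota a ^+ 2); first by ring.
  by rewrite sy s2 yf; ring.
- by move=> k _; rewrite /= /D map_polyXsubC root_XsubC.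
Qed.

Let n_velu : (2 * 1).+1%:R = 3 :> {poly F}. Proof. by []. Qed.

(** For D = X - a, Hirota's form is -6 times the third division polynomial at a. *)
Lemma three_hirota : hirota A B A2 (- 2 * a) 1 D = 0.
Proof.
have D1 : D^`() = 1 by rewrite /D derivXsubC.
have D2 : (1 : {poly F})^`() = 0 by rewrite -polyC1 derivC.
have D3 : (0 : {poly F})^`() = 0 by rewrite -polyC0 derivC.
transitivity ((3 * a ^+ 4 + 6 * A * a ^+ 2 + 12 * B * a - A ^+ 2)%:P * (- 6 : {poly F}));
  last by rewrite psi3 mul0r.
have E2 : theta2 A B D = 3 * 'X ^+ 2 + A%:P.
  by rewrite /theta2 D1 D2; ring.
have dE2 : (3 * 'X ^+ 2 + A%:P : {poly F})^`() = 6 * 'X.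
  by rewrite derivD derivC derivM -polyC_natr derivC derivXn /= polyC_natr; ring.
have d2E2 : (6 * 'X : {poly F})^`() = 6.
  by rewrite derivM -polyC_natr derivC derivX polyC_natr; ring.
rewrite /hirota E2 /theta2 dE2 d2E2 D1 n_velu hA2 /T /cubic /D -!mul_polyC.
rewrite !(polyCN, polyCD, polyCM, polyC_exp, polyC_natr); ring.
Qed.

Theorem cyclic_3isogeny :
  cyclic_isogeny_of_degree (short_wcurve A B) (short_wcurve A2 B2) 3 /\
  exists h' U' V' D', isogeny_data A B A2 B2 h' U' V' D'.
Proof.
have Dx : D.[a + 1] = 1 by rewrite /D hornerXsubC; ring.
have D1 : D^`() = 1 by rewrite /D derivXsubC.
have D2 : (1 : {poly F})^`() = 0 by rewrite -polyC1 derivC.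
apply: (@cyclic_odd_isogeny F A B A2 B2 (- 2 * a) 1 D n2 n3 disc0 _ isT isT _ _ three_hirota).
- by rewrite size_XsubC.
- by move=> L iota; have [y yE] := closed_sqrt (iota fa); exact: three_chain yE.
- by have [L [iota [y yE]]] := adjoin_sqrt fa; exists L, iota; exact: three_chain yE.
(* D takes the value 1 at a + 1, so that a defect of the form r D^6 is r there, and one evaluation
   decides. *)
suff W1 : (velu_defect A B A2 B2 (- 2 * a) 1 D).[a + 1] = 0.
  move=> r WE; have := congr1 (fun P => P.[a + 1]) WE.
  by rewrite W1 hornerM hornerC horner_exp Dx expr1n mulr1 => ->.
have UE : velu_num A B (- 2 * a) 1 D = 'X * D ^+ 2 + T%:P * D + (4 * fa)%:P.
  rewrite /velu_num D1 D2 n_velu /T /fa /cubic /D -!mul_polyC.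
  rewrite !(polyCN, polyCD, polyCM, polyC_exp, polyC_natr); ring.
have VE : velu_yfactor A B (- 2 * a) 1 D
    = (D ^+ 2 + 2 * 'X * D + T%:P) * D - 2 * ('X * D ^+ 2 + T%:P * D + (4 * fa)%:P).
  rewrite /velu_yfactor UE D1 mulr1; congr (_ * _ - _).
  rewrite !expr2 !(D1, derivX, derivC, derivD, derivM); ring.
rewrite /velu_defect VE UE /cubic -!mul_polyC.
transitivity ((3 * a ^+ 4 + 6 * A * a ^+ 2 + 12 * B * a - A ^+ 2) * (2 * T + 12 * fa - 6));
  last by rewrite psi3 mul0r.
have hn i : (i%:R : {poly F}).[a + 1] = i%:R by rewrite -polyC_natr hornerC.
rewrite !(hn, Dx, hornerD, hornerN, horner_exp, hornerM, hornerX, hornerC).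
by rewrite hA2 hB2 /T /fa; ring.
Qed.

End ThreeIsogeny.

(** * Expansion at infinity and the coefficients of the target *)

Section Jets.
Variable F : fieldType.
Implicit Types (P Q : {poly F}) (a b : nat).

Definition jet_poly (c0 c1 c2 c3 : F) : {poly F} :=
  c0%:P * 'X^3 + c1%:P * 'X^2 + c2%:P * 'X + c3%:P.

(* P = c0 X^a + c1 X^(a-1) + c2 X^(a-2) + c3 X^(a-3) + lower order terms, where
   the factor X^3 makes sense of this for a < 3. *)
Definition jet a P (c0 c1 c2 c3 : F) :=
  (size (P * 'X^3 - jet_poly c0 c1 c2 c3 * 'X^a)%R <= a)%N.

Lemma size_jet_poly c0 c1 c2 c3 : (size (jet_poly c0 c1 c2 c3) <= 4)%N.
Proof.
rewrite /jet_poly !mul_polyC.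
rewrite (leq_trans (size_polyD _ _)) // geq_max (leq_trans (size_polyC_leq1 _)) // andbT.
rewrite (leq_trans (size_polyD _ _)) // geq_max (leq_trans (size_scale_leq _ _)) ?size_polyX // andbT.
by rewrite (leq_trans (size_polyD _ _)) // geq_max !(leq_trans (size_scale_leq _ _)) ?size_polyXn.
Qed.

Lemma jet_ext a P c0 c1 c2 c3 d0 d1 d2 d3 : jet a P c0 c1 c2 c3 ->
  d0 = c0 -> d1 = c1 -> d2 = c2 -> d3 = c3 -> jet a P d0 d1 d2 d3.
Proof. by move=> h -> -> -> ->. Qed.

Lemma jetD a P Q c0 c1 c2 c3 d0 d1 d2 d3 : jet a P c0 c1 c2 c3 -> jet a Q d0 d1 d2 d3 ->
  jet a (P + Q) (c0 + d0) (c1 + d1) (c2 + d2) (c3 + d3).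
Proof.
rewrite /jet => hP hQ.
have -> : (P + Q) * 'X^3 - jet_poly (c0 + d0) (c1 + d1) (c2 + d2) (c3 + d3) * 'X^a
  = (P * 'X^3 - jet_poly c0 c1 c2 c3 * 'X^a) + (Q * 'X^3 - jet_poly d0 d1 d2 d3 * 'X^a).
  by rewrite /jet_poly !polyCD; ring.
by rewrite (leq_trans (size_polyD _ _)) // geq_max hP.
Qed.

Lemma jetZ a k P c0 c1 c2 c3 : jet a P c0 c1 c2 c3 ->
  jet a (k%:P * P) (k * c0) (k * c1) (k * c2) (k * c3).
Proof.
rewrite /jet => hP.
have -> : k%:P * P * 'X^3 - jet_poly (k * c0) (k * c1) (k * c2) (k * c3) * 'X^a
  = k%:P * (P * 'X^3 - jet_poly c0 c1 c2 c3 * 'X^a).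
  by rewrite /jet_poly !polyCM; ring.
by rewrite mul_polyC (leq_trans (size_scale_leq _ _)).
Qed.

Lemma jetN a P c0 c1 c2 c3 : jet a P c0 c1 c2 c3 -> jet a (- P) (- c0) (- c1) (- c2) (- c3).
Proof.
rewrite /jet => hP.
have -> : - P * 'X^3 - jet_poly (- c0) (- c1) (- c2) (- c3) * 'X^a
  = - (P * 'X^3 - jet_poly c0 c1 c2 c3 * 'X^a) by rewrite /jet_poly !polyCN; ring.
by rewrite size_polyN.
Qed.

Lemma jetM a b P Q c0 c1 c2 c3 d0 d1 d2 d3 : jet a P c0 c1 c2 c3 -> jet b Q d0 d1 d2 d3 ->
  jet (a + b) (P * Q) (c0 * d0) (c0 * d1 + c1 * d0) (c0 * d2 + c1 * d1 + c2 * d0)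
    (c0 * d3 + c1 * d2 + c2 * d1 + c3 * d0).
Proof.
rewrite /jet; set E := P * _ - _; set G := Q * _ - _ => hE hG.
set R : {poly F} := P * Q * 'X^3 - _.
have X3 : ('X^3 : {poly F}) != 0 by rewrite -size_poly_gt0 size_polyXn.
have [->|R0] := eqVneq R 0; first by rewrite size_poly0.
(* The product of the two shifted polynomials carries X^6 where the definition has X^3. A further
   X^3 makes the error a sum of terms each involving an error of a factor or the discarded low part
   of the product of the jets. *)
rewrite -(leq_add2l 3) -(size_mulXn _ R0).
set lo : {poly F} := (c1 * d3 + c2 * d2 + c3 * d1)%:P * 'X^2 + (c2 * d3 + c3 * d2)%:P * 'X
  + (c3 * d3)%:P.
have -> : R * 'X^3 = lo * 'X^(a + b) + E * (jet_poly d0 d1 d2 d3 * 'X^b)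
    + jet_poly c0 c1 c2 c3 * 'X^a * G + E * G.
  by rewrite /R /E /G /lo /jet_poly exprD !(polyCD, polyCM); ring.
have slo : (size lo <= 3)%N.
  rewrite /lo !mul_polyC.
  rewrite (leq_trans (size_polyD _ _)) // geq_max (leq_trans (size_polyC_leq1 _)) // andbT.
  rewrite (leq_trans (size_polyD _ _)) // geq_max !(leq_trans (size_scale_leq _ _)) ?size_polyX //.
  by rewrite size_polyXn.
have sM (S T : {poly F}) i j k : (size S <= i)%N -> (size T <= j)%N -> (i + j <= k.+1)%N ->
    (size (S * T)%R <= k)%N.
  by move=> hS hT hk; apply: leq_trans (size_polyMleq _ _) _; lia.
have sX i : (size ('X^i : {poly F}) <= i.+1)%N by rewrite size_polyXn.
have sJ := size_jet_poly.
rewrite (leq_trans (size_polyD _ _)) // geq_max; apply/andP; split; last first.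
  by apply: (sM _ _ _ _ _ hE hG); lia.
rewrite (leq_trans (size_polyD _ _)) // geq_max; apply/andP; split; last first.
  by apply: (sM _ _ (4 + a)%N _ _ _ hG); [apply: (sM _ _ _ _ _ (sJ _ _ _ _) (sX a)) |]; lia.
rewrite (leq_trans (size_polyD _ _)) // geq_max; apply/andP; split.
  by apply: (sM _ _ _ _ _ slo (sX _)); lia.
by apply: (sM _ _ _ (4 + b)%N _ hE); [apply: (sM _ _ _ _ _ (sJ _ _ _ _) (sX b)) |]; lia.
Qed.

(** The Euler operator X d/dX keeps the nominal degree and multiplies the coefficient of X^(a-i) by
    a - i, so no truncated subtraction on exponents occurs for small a. *)
Lemma jet_deriv a P c0 c1 c2 c3 : jet a P c0 c1 c2 c3 ->
  jet a ('X * P^`()) (a%:R * c0) ((a%:R - 1) * c1) ((a%:R - 2) * c2) ((a%:R - 3) * c3).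
Proof.
rewrite /jet; set E : {poly F} := P * _ - _ => hE.
have XE i : 'X * ('X^i)^`() = i%:R * 'X^i :> {poly F}.
  case: i => [|i]; first by rewrite derivC mulr0 mul0r.
  by rewrite derivXn /= -mulr_natl mulrCA -exprS.
have dX : ('X : {poly F})^`() = 1 by exact: derivX.
have dE : 'X * E^`() = 'X * P^`() * 'X^3 + 3 * P * 'X^3
    - (3 * c0%:P * 'X^3 + 2 * c1%:P * 'X^2 + c2%:P * 'X) * 'X^a
    - a%:R * jet_poly c0 c1 c2 c3 * 'X^a.
  rewrite /E /jet_poly derivB !derivM !derivD !derivM !derivC dX.
  have -> : forall u v w y z x3 x2 xa : {poly F},
    'X * (u * 'X^3 + v * x3 - ((0 * 'X^3 + w * x3 + (0 * 'X^2 + y * x2)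
      + (0 * 'X + z * 1) + 0) * 'X^a
      + (w * 'X^3 + y * 'X^2 + z * 'X + c3%:P) * xa))
    = 'X * u * 'X^3 + v * ('X * x3) - (w * ('X * x3) + y * ('X * x2) + z * 'X) * 'X^a
      - (w * 'X^3 + y * 'X^2 + z * 'X + c3%:P) * ('X * xa).
    by move=> *; ring.
  by rewrite !XE; ring.
have -> : 'X * P^`() * 'X^3 - jet_poly (a%:R * c0) ((a%:R - 1) * c1) ((a%:R - 2) * c2)
    ((a%:R - 3) * c3) * 'X^a = 'X * E^`() - 3%:P * E :> {poly F}.
  rewrite dE /jet_poly /E /jet_poly !(polyCM, polyCB, polyC_natr, polyC1); ring.
rewrite (leq_trans (size_polyD _ _)) // geq_max size_polyN mul_polyC.
rewrite (leq_trans (size_scale_leq _ _)) // andbT.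
have [->|E0] := eqVneq E 0; first by rewrite linear0 mulr0 size_poly0.
apply: leq_trans (size_polyMleq _ _) _; rewrite size_polyX /=.
exact: leq_trans (lt_size_deriv E0) hE.
Qed.

Lemma jet_mulX a P c0 c1 c2 c3 : jet a.+1 ('X * P) c0 c1 c2 c3 <-> jet a P c0 c1 c2 c3.
Proof.
rewrite /jet.
set J : {poly F} := jet_poly c0 c1 c2 c3.
have -> : 'X * P * 'X^3 - J * 'X^(a.+1) = (P * 'X^3 - J * 'X^a) * 'X by rewrite (exprSr _ a); ring.
have [->|E0] := eqVneq (P * 'X^3 - J * 'X^a) 0.
  by rewrite mul0r !size_poly0.
by rewrite size_mulX.
Qed.

Lemma jet_inj3 a P c0 c1 c2 c3 d0 d1 d2 d3 :
  jet a P c0 c1 c2 c3 -> jet a P d0 d1 d2 d3 -> c3 = d3.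
Proof.
have co x y z w : jet a P x y z w -> (P * 'X^3)`_a = w.
  move=> /(nth_default 0) /eqP; rewrite coefB subr_eq0 => /eqP ->.
  by rewrite coefMXn ltnn subnn /jet_poly !mul_polyC !coefD !coefZ !coefXn coefX coefC /= !mulr0 !add0r.
by move=> /co <- /co.
Qed.

(** A constant is given nominal degree 2, or 3 below, so that all terms of the defect share the
    nominal degree 6h+3. *)
Lemma jet_const2 k : jet 2 k%:P 0 0 k 0.
Proof.
rewrite /jet /jet_poly (_ : _ - _ = 0) ?size_poly0 //.
by rewrite polyC0; ring.
Qed.

Lemma jet_const3 k : jet 3 k%:P 0 0 0 k.
Proof.
rewrite /jet /jet_poly (_ : _ - _ = 0) ?size_poly0 //.
by rewrite polyC0; ring.
Qed.

Lemma jet_coefs h P : (size P <= h.+1)%N ->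
  jet h P P`_h (P * 'X)`_h (P * 'X^2)`_h (P * 'X^3)`_h.
Proof.
move=> sP; apply/leq_sizeP => j hj.
rewrite coefB !coefMXn /jet_poly !mul_polyC !coefD !coefZ !coefXn coefX coefC.
have [le|lt3] := leqP (h + 4) j.
  rewrite !gtn_eqF ?mulr0 ?addr0 ?(leq_gtF hj); try lia.
  by rewrite subr0; case: ifP => // _; apply/nth_default/(leq_trans sP); lia.
rewrite (leq_gtF hj).
have [->|[->|[->|->]]] : (j = h \/ j = h.+1 \/ j = h.+2 \/ j = h.+3) by lia.
- by rewrite subnn /= !mulr0 !add0r subrr.
- rewrite subSnn /= !mulr0 !mulr1 !addr0 !add0r -[(h.+1 < 3)%N]/(h < 2)%N.
  by rewrite subSS subrr.
- rewrite (_ : h.+2 - h = 2)%N; last by lia.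
  rewrite /= !mulr0 !mulr1 !addr0 !add0r coefMX.
  by case: (h) => [|h'] /=; rewrite ?subrr // ?subSS ?subn0 subrr.
- rewrite (_ : h.+3 - h = 3)%N; last by lia.
  by rewrite /= !mulr0 !mulr1 !addr0 !subSS subn0 subrr.
Qed.

End Jets.

(* The defect is determined by its expansion at infinity, i.e. at the origin of
   the curve; e i is the coefficient of X^(h-i) in D. *)
Section DefectAtInfinity.
Variables (F : fieldType) (A B A2 B2 c : F) (h : nat) (D : {poly F}).
Hypothesis sD : size D = h.+1.
Let e i := (D * 'X^i)`_h.
Hypotheses (hc : c * e 0 = 2 * e 1%N)
  (hA2 : e 0 ^+ 2 * (A - A2) = 5 * (6 * (e 1%N ^+ 2 - 2 * e 0 * e 2) + 2 * A * h%:R * e 0 ^+ 2))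
  (hB2 : e 0 ^+ 3 * (B - B2)
    = 7 * (10 * (- e 1%N ^+ 3 + 3 * e 0 * e 1%N * e 2 - 3 * e 0 ^+ 2 * e 3)
           - 6 * A * e 1%N * e 0 ^+ 2 + 4 * B * h%:R * e 0 ^+ 3)).

(** Through Newton's identities, the hypotheses are Velu's A2 = A - 5 t and B2 = B - 7 w, with t and
    w the sums of 6 x^2 + 2 A and of 10 x^3 + 6 A x + 4 B over the roots x of D, cleared of e 0.
    Then U/D^2 = x + t/x + w/x^2 + ..., and the coefficient of X^(6h) in the defect vanishes. *)
Lemma velu_defect_const r : velu_defect A B A2 B2 c h D = r%:P * D ^+ 6 -> r = 0.
Proof.
have e0 : e 0 != 0.
  by rewrite /e expr0 mulr1 -[h]/(h.+1.-1) -sD -lead_coefE lead_coef_eq0 -size_poly_gt0 sD.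
have jD : jet h D (e 0) (e 1%N) (e 2) (e 3).
  by have := jet_coefs (eq_leq sD); rewrite /e expr0 mulr1 expr1.
move: e0 hc hA2 hB2 jD; move: (e 0) (e 1%N) (e 2) (e 3) => l l1 l2 l3 l0 hc' hA' hB' jD defE.
have [x1 x1E] : exists x1, l1 = l * x1 by exists (l1 / l); field.
have [x2 x2E] : exists x2, l2 = l * x2 by exists (l2 / l); field.
have [x3 x3E] : exists x3, l3 = l * x3 by exists (l3 / l); field.
have [k hk] : exists k : F, k = h%:R by exists h%:R.
have cE : c = 2 * x1 by apply: (mulIf l0); rewrite hc' x1E; ring.
have l30 n : l ^+ n != 0 by rewrite expf_neq0.
have A2E : A2 = A - 5 * (6 * (x1 ^+ 2 - 2 * x2) + 2 * A * k).
  rewrite -hk in hA'; apply: (mulfI (l30 2%N)).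
  apply/eqP; rewrite -subr_eq0; apply/eqP.
  transitivity (5 * (6 * (l1 ^+ 2 - 2 * l * l2) + 2 * A * k * l ^+ 2) - l ^+ 2 * (A - A2)).
    by rewrite x1E x2E; ring.
  by rewrite hA' subrr.
have B2E : B2 = B - 7 * (10 * (- x1 ^+ 3 + 3 * x1 * x2 - 3 * x3) - 6 * A * x1 + 4 * B * k).
  rewrite -hk in hB'; apply: (mulfI (l30 3%N)).
  apply/eqP; rewrite -subr_eq0; apply/eqP.
  transitivity (7 * (10 * (- l1 ^+ 3 + 3 * l * l1 * l2 - 3 * l ^+ 2 * l3)
           - 6 * A * l1 * l ^+ 2 + 4 * B * k * l ^+ 3) - l ^+ 3 * (B - B2)).
    by rewrite x1E x2E x3E; ring.
  by rewrite hB' subrr.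
have jf : jet 3 (cubic A B) 1 0 A B.
  rewrite /jet /jet_poly /cubic (_ : _ - _ = 0) ?size_poly0 //.
  by rewrite -mul_polyC polyC0 polyC1; ring.
have jf1 : jet 2 (3 * 'X ^+ 2 + A%:P) 3 0 A 0.
  rewrite /jet /jet_poly (_ : _ - _ = 0) ?size_poly0 //.
  by rewrite polyC0 polyC_natr; ring.
have pE : (2 * h).+1%:R = (2 * k + 1)%:P :> {poly F}.
  by rewrite -polyC_natr -natr1 natrM -hk.
have jl : jet 1 ((2 * h).+1%:R * 'X + c%:P) (2 * k + 1) c 0 0.
  rewrite pE /jet /jet_poly (_ : _ - _ = 0) ?size_poly0 //.
  by rewrite polyC0; ring.
have jD1 := jet_deriv jD.
have jX P a c0 c1 c2 c3 : jet a P c0 c1 c2 c3 -> jet a.+1 ('X * P) c0 c1 c2 c3.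
  by move/jet_mulX.
have dXD1 : 'X * ('X * D^`())^`() = 'X * D^`() + 'X ^+ 2 * D^`()^`() :> {poly F}.
  by rewrite derivM derivX; ring.
have jD2 := jetD (jet_deriv jD1) (jetN jD1).
have D2E : 'X * ('X * D^`())^`() - 'X * D^`() = 'X ^+ 2 * D^`()^`() :> {poly F}.
  by rewrite dXD1; ring.
rewrite D2E in jD2.
set U := velu_num A B c h D.
have UE : 'X * ('X * U) = 4%:P * (cubic A B * (('X * D^`()) * ('X * D^`())))
    - 4%:P * (cubic A B * (D * ('X ^+ 2 * D^`()^`())))
    - 2%:P * ('X * (3 * 'X ^+ 2 + A%:P) * (D * ('X * D^`())))
    + ('X * ('X * ((2 * h).+1%:R * 'X + c%:P))) * (D * D).
  by rewrite /U /velu_num !polyC_natr; ring.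
have jXXU := jetD (jetD (jetD (jetZ 4 (jetM jf (jetM jD1 jD1)))
    (jetN (jetZ 4 (jetM jf (jetM jD jD2)))))
    (jetN (jetZ 2 (jetM (jX _ _ _ _ _ _ _ jf1) (jetM jD jD1)))))
  (jetM (jX _ _ _ _ _ _ _ (jX _ _ _ _ _ _ _ jl)) (jetM jD jD)).
rewrite -UE in jXXU.
rewrite -hk in jD1 jD2 jXXU.
(* These are the sums of Velu: x1, x2, x3 are, up to sign, the elementary symmetric functions of the
   roots of D, and k is their number. *)
pose t := 6 * (x1 ^+ 2 - 2 * x2) + 2 * A * k.
pose w := 10 * (- x1 ^+ 3 + 3 * x1 * x2 - 3 * x3) - 6 * A * x1 + 4 * B * k.
have jU : jet (1 + (h + h)) U (l ^+ 2) (l ^+ 2 * (2 * x1)) (l ^+ 2 * (x1 ^+ 2 + 2 * x2 + t))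
    (l ^+ 2 * (2 * x3 + 2 * x1 * x2 + 2 * x1 * t + w)).
  apply/(iffLR (jet_mulX _ _ _ _ _ _))/(iffLR (jet_mulX _ _ _ _ _ _)).
  by refine (jet_ext jXXU _ _ _ _); rewrite ?x1E ?x2E ?x3E ?cE /t /w; ring.
set V := velu_yfactor A B c h D.
have VE : 'X * V = 'X * U^`() * D - 2%:P * (U * ('X * D^`())).
  by rewrite /V /velu_yfactor -/U !polyC_natr; ring.
have jV : jet (h + (h + h)) V (l ^+ 3) (l ^+ 3 * (3 * x1))
    (l ^+ 3 * (3 * x1 ^+ 2 + 3 * x2 - t))
    (l ^+ 3 * (x1 ^+ 3 + 6 * x1 * x2 + 3 * x3 - 3 * x1 * t - 2 * w)).
  apply/(iffLR (jet_mulX _ _ _ _ _ _)).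
  have jXV := jetD (jetM (jet_deriv jU) jD) (jetN (jetZ 2 (jetM jU jD1))).
  have hE : (1 + (h + h) + h = (h + (h + h)).+1)%N by clear; lia.
  rewrite -VE hE in jXV; refine (jet_ext jXV _ _ _ _);
    by rewrite ?natrD -?hk ?x1E ?x2E ?x3E ?cE /t /w; ring.
have jDD := jetM jD jD.
have jD4 := jetM jDD jDD.
have jW1 := jetM jf (jetM jV jV).
have jW2 := jetN (jetM jU (jetM jU jU)).
have jW3 := jetN (jetM (jet_const2 A2) (jetM jU jD4)).
have jW4 := jetN (jetM (jet_const3 B2) (jetM jDD jD4)).
have jW5 := jetM (jet_const3 r) (jetM jDD jD4).
have i2 : (1 + (h + h) + (1 + (h + h) + (1 + (h + h))) = 3 + (h + (h + h) + (h + (h + h))))%N.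
  by clear; lia.
have i3 : (2 + (1 + (h + h) + (h + h + (h + h))) = 3 + (h + (h + h) + (h + (h + h))))%N by clear; lia.
have i4 : (3 + (h + h + (h + h + (h + h))) = 3 + (h + (h + h) + (h + (h + h))))%N by clear; lia.
rewrite i2 in jW2; rewrite i3 in jW3; rewrite i4 in jW4 jW5.
have jW := jetD (jetD (jetD jW1 jW2) jW3) jW4.
have WE : cubic A B * (V * V) - U * (U * U) - A2%:P * (U * (D * D * (D * D)))
    - B2%:P * (D * D * (D * D * (D * D))) = r%:P * (D * D * (D * D * (D * D))).
  transitivity (velu_defect A B A2 B2 c h D); last by rewrite defE; ring.
  by rewrite /velu_defect -/U -/V; ring.
(* Only the fourth coefficients, those of X^(6h), are compared: this is where r D^6 begins. *)
rewrite WE in jW; have r0 := jet_inj3 jW5 jW.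
apply: (mulIf (l30 6%N)); rewrite mul0r.
transitivity (0 * (l * l * (l * l1 + l1 * l)) + r * (l * l * (l * l * (l * l)))); first by ring.
move: r0; set z := (X in X = _) => zE; rewrite (_ : _ + _ = z); last by rewrite /z; ring.
by rewrite zE x1E x2E x3E A2E B2E /t /w; ring.
Qed.

End DefectAtInfinity.

(** * Computation with integer polynomials and quadratic extensions *)

(* Polynomials as coefficient lists, constant term first, over a type C that is
   interpreted in a commutative ring by phi. *)
Section Dense.
Variables (C : Type) (zero : C) (add mul : C -> C -> C) (opp : C -> C).

Fixpoint dense_add (l1 l2 : seq C) : seq C :=
  match l1, l2 with
  | c1 :: l1', c2 :: l2' => add c1 c2 :: dense_add l1' l2'
  | [::], _ => l2
  | _, [::] => l1
  end.

Definition dense_scale c (l : seq C) := map (mul c) l.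

Fixpoint dense_mul (l1 l2 : seq C) : seq C :=
  if l1 is c :: l then dense_add (dense_scale c l2) (zero :: dense_mul l l2) else [::].

Variables (R : comPzRingType) (phi : C -> R).
Hypotheses (phi0 : phi zero = 0) (phiD : forall a b, phi (add a b) = phi a + phi b).
Hypotheses (phiM : forall a b, phi (mul a b) = phi a * phi b) (phiN : forall a, phi (opp a) = - phi a).

Fixpoint dense_eval (x : R) (l : seq C) : R :=
  if l is c :: l' then phi c + x * dense_eval x l' else 0.

Lemma dense_evalD x l1 l2 :
  dense_eval x (dense_add l1 l2) = dense_eval x l1 + dense_eval x l2.
Proof.
elim: l1 l2 => [|c1 l1 IH] [|c2 l2] /=; rewrite ?add0r ?addr0 // phiD IH; ring.
Qed.

Lemma dense_evalZ x c l : dense_eval x (dense_scale c l) = phi c * dense_eval x l.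
Proof. by elim: l => [|c' l IH] /=; rewrite ?mulr0 // phiM IH; ring. Qed.

Lemma dense_evalM x l1 l2 :
  dense_eval x (dense_mul l1 l2) = dense_eval x l1 * dense_eval x l2.
Proof.
elim: l1 => [|c l IH] /=; first by rewrite mul0r.
by rewrite dense_evalD dense_evalZ /= phi0 IH; ring.
Qed.

Lemma dense_evalN x l : dense_eval x (map opp l) = - dense_eval x l.
Proof. by elim: l => [|c l IH] /=; rewrite ?oppr0 // phiN IH; ring. Qed.

Lemma dense_eval0 x (is0 : pred C) l : (forall c, is0 c -> phi c = 0) ->
  all is0 l -> dense_eval x l = 0.
Proof.
by move=> h; elim: l => //= c l IH /andP[/h -> /IH ->]; rewrite mulr0 addr0.
Qed.

End Dense.

Lemma intr_of_ZE (R : pzRingType) z : intr_of_Z R z = (int_of_Z z)%:~R.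
Proof. by case: z => [|q|q] //=; rewrite NegzE prednK ?mulrNz //; lia. Qed.

Lemma intr_of_nat (R : pzRingType) k : intr_of_Z R (Z.of_nat k) = k%:R.
Proof. by case: k => //= k; rewrite SuccNat2Pos.id_succ. Qed.

Section IntegerPolynomials.
Variables (R : comPzRingType).
Implicit Types (x : R) (l : seq Z) (e : pexp).

Let phi := intr_of_Z R.

Lemma intr_of_Z0 : phi Z0 = 0. Proof. by []. Qed.
Lemma intr_of_ZD a b : phi (Z.add a b) = phi a + phi b.
Proof. by rewrite /phi !intr_of_ZE (rmorphD int_of_Z) rmorphD. Qed.
Lemma intr_of_ZM a b : phi (Z.mul a b) = phi a * phi b.
Proof. by rewrite /phi !intr_of_ZE (rmorphM int_of_Z) rmorphM. Qed.
Lemma intr_of_ZN a : phi (Z.opp a) = - phi a.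
Proof. by rewrite /phi !intr_of_ZE (rmorphN int_of_Z) rmorphN. Qed.

Definition zadd := dense_add Z.add.
Definition zmul := dense_mul Z0 Z.add Z.mul.
Definition zopp := map Z.opp.
Definition zev := dense_eval phi.
Definition zis0 := all (Z.eqb Z0).

Lemma zevD x l1 l2 : zev x (zadd l1 l2) = zev x l1 + zev x l2.
Proof. exact: dense_evalD intr_of_ZD _ _ _. Qed.
Lemma zevM x l1 l2 : zev x (zmul l1 l2) = zev x l1 * zev x l2.
Proof. exact: dense_evalM intr_of_Z0 intr_of_ZD intr_of_ZM _ _ _. Qed.
Lemma zevN x l : zev x (zopp l) = - zev x l.
Proof. exact: dense_evalN intr_of_ZN _ _. Qed.
Lemma zis0P x l : zis0 l -> zev x l = 0.
Proof. by apply: dense_eval0 => z /Z.eqb_eq <-. Qed.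

Fixpoint coefs e : seq Z :=
  match e with
  | PCst z => [:: z]
  | PVar => [:: Z0; Z.one]
  | POpp e1 => zopp (coefs e1)
  | PAdd e1 e2 => zadd (coefs e1) (coefs e2)
  | PMul e1 e2 => zmul (coefs e1) (coefs e2)
  | PPow e1 k => iter k (zmul (coefs e1)) [:: Z.one]
  end.

Lemma peval_coefs x e : peval x e = zev x (coefs e).
Proof.
elim: e => [z||e IH|e1 IH1 e2 IH2|e1 IH1 e2 IH2|e IH k] /=.
- by rewrite mulr0 addr0.
- by rewrite mulr0 addr0 add0r mulr1.
- by rewrite zevN IH.
- by rewrite zevD IH1 IH2.
- by rewrite zevM IH1 IH2.
- elim: k => [|k IHk] /=; first by rewrite expr0 mulr0 addr0.
  by rewrite zevM -IHk -IH exprS.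
Qed.

Lemma peval_eq0 x e : zis0 (coefs e) -> peval x e = 0.
Proof. by rewrite peval_coefs => /zis0P ->. Qed.

End IntegerPolynomials.

(* Elements (a(w) + b(w) v) / M(w) ^ k, where v^2 = K(w) - H(w) v. *)
Definition quad := (seq Z * seq Z * nat)%type.

Section QuadraticExtension.
Variables (H K M : seq Z).

Definition zexp l k := iter k (zmul l) [:: Z.one].

Definition quad_lift j (q : quad) : quad :=
  let: (a, b, k) := q in
  if j is 0 then q else let Mj := zexp M j in (zmul a Mj, zmul b Mj, j + k)%N.

Definition quad_add (q1 q2 : quad) : quad :=
  let: (a1, b1, k) := quad_lift (q2.2 - q1.2) q1 in
  let: (a2, b2, _) := quad_lift (q1.2 - q2.2) q2 in (zadd a1 a2, zadd b1 b2, k).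

Definition quad_opp (q : quad) : quad := let: (a, b, k) := q in (zopp a, zopp b, k).

Definition quad_mul (q1 q2 : quad) : quad :=
  let: (a1, b1, k1) := q1 in let: (a2, b2, k2) := q2 in
  let bb := zmul b1 b2 in
  (zadd (zmul a1 a2) (zmul bb K),
   zadd (zadd (zmul a1 b2) (zmul b1 a2)) (zopp (zmul bb H)), k1 + k2)%N.

Definition quad_const z : quad := ([:: z], [::], 0%N).

Fixpoint quad_subst (q : quad) (e : pexp) : quad :=
  match e with
  | PCst z => quad_const z
  | PVar => q
  | POpp e1 => quad_opp (quad_subst q e1)
  | PAdd e1 e2 => quad_add (quad_subst q e1) (quad_subst q e2)
  | PMul e1 e2 => quad_mul (quad_subst q e1) (quad_subst q e2)
  | PPow e1 k => let q1 := quad_subst q e1 in iter k (quad_mul q1) (quad_const Z.one)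
  end.

Fixpoint quad_horner (l : seq quad) (q : quad) : quad :=
  if l is c :: l' then quad_add c (quad_mul q (quad_horner l' q)) else ([::], [::], 0%N).

Definition quad_is0 (q : quad) := zis0 q.1.1 && zis0 q.1.2.
Definition quad_eq q1 q2 := quad_is0 (quad_add q1 (quad_opp q2)).

Variables (L : fieldType) (w v : L).
Hypotheses (M0 : zev w M != 0) (vE : v ^+ 2 = zev w K - zev w H * v).

Definition quad_ev (q : quad) : L := (zev w q.1.1 + zev w q.1.2 * v) / zev w M ^+ q.2.

Let Mk0 k : zev w M ^+ k != 0. Proof. exact: expf_neq0. Qed.

Lemma zev_one : zev w [:: Z.one] = 1.
Proof. by rewrite /zev /= mulr0 addr0. Qed.

Lemma zevX l k : zev w (zexp l k) = zev w l ^+ k.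
Proof. by elim: k => [|k IH]; rewrite ?zev_one // /zexp /= zevM -/(zexp l k) IH exprS. Qed.

Lemma quad_evL j q : quad_ev (quad_lift j q) = quad_ev q.
Proof.
case: q => [[a b] k]; rewrite /quad_lift; case: j => // j; rewrite /quad_ev /= !zevM zevX exprD.
rewrite -exprS; move: (Mk0 j.+1) (Mk0 k); move: (_ ^+ j.+1) (_ ^+ k) => x y x0 y0.
by field; rewrite x0 y0.
Qed.

Lemma quad_lift2 j q : (quad_lift j q).2 = (j + q.2)%N.
Proof. by case: q => [[a b] k]; case: j. Qed.

Lemma quad_evD q1 q2 : quad_ev (quad_add q1 q2) = quad_ev q1 + quad_ev q2.
Proof.
rewrite -(quad_evL (q2.2 - q1.2) q1) -(quad_evL (q1.2 - q2.2) q2) /quad_add.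
have := quad_lift2 (q2.2 - q1.2) q1; have := quad_lift2 (q1.2 - q2.2) q2.
case: (quad_lift _ q1) => [[a1 b1] k1]; case: (quad_lift _ q2) => [[a2 b2] k2] /= e2 e1.
have -> : k2 = k1 by rewrite e1 e2; lia.
by rewrite /quad_ev /= !zevD -mulrDl; congr (_ / _); ring.
Qed.

Lemma quad_evN q : quad_ev (quad_opp q) = - quad_ev q.
Proof. by case: q => [[a b] k]; rewrite /quad_ev /= !zevN -mulNr; congr (_ / _); ring. Qed.

Lemma quad_evM q1 q2 : quad_ev (quad_mul q1 q2) = quad_ev q1 * quad_ev q2.
Proof.
case: q1 q2 => [[a1 b1] k1] [[a2 b2] k2]; rewrite /quad_ev /quad_mul /=.
rewrite !(zevD, zevN, zevM) exprD; move: (Mk0 k1) (Mk0 k2).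
move: (_ ^+ k1) (_ ^+ k2) => d1 d2 d10 d20.
set x1 := zev w a1; set x2 := zev w a2; set y1 := zev w b1; set y2 := zev w b2.
transitivity ((x1 * x2 + (x1 * y2 + y1 * x2) * v + y1 * y2 * (zev w K - zev w H * v))
   / (d1 * d2)); first by field; rewrite d10 d20.
by rewrite -vE; field; rewrite d10 d20.
Qed.

Lemma quad_evC z : quad_ev (quad_const z) = intr_of_Z L z.
Proof. by rewrite /quad_ev /quad_const /zev /= mulr0 mul0r !addr0 expr0 divr1. Qed.

Lemma quad_ev_subst q e : quad_ev (quad_subst q e) = peval (quad_ev q) e.
Proof.
elim: e => [z||e IH|e1 IH1 e2 IH2|e1 IH1 e2 IH2|e IH k] //=.
- by rewrite quad_evC.
- by rewrite quad_evN IH.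
- by rewrite quad_evD IH1 IH2.
- by rewrite quad_evM IH1 IH2.
- elim: k => [|k IHk] /=; first by rewrite quad_evC expr0.
  by rewrite quad_evM IHk IH exprS.
Qed.

Lemma quad_ev0 q : quad_is0 q -> quad_ev q = 0.
Proof.
case: q => [[a b] k] /andP[/= ha hb].
by rewrite /quad_ev /= (zis0P _ ha) (zis0P _ hb) mul0r add0r mul0r.
Qed.

Lemma quad_evE q1 q2 : quad_eq q1 q2 -> quad_ev q1 = quad_ev q2.
Proof. by move/quad_ev0; rewrite quad_evD quad_evN => /eqP; rewrite subr_eq0 => /eqP. Qed.

Lemma quad_ev_horner l q :
  quad_ev (quad_horner l q) = foldr (fun c r => quad_ev c + quad_ev q * r) 0 l.
Proof.
elim: l => [|c l IH] /=; first by rewrite /quad_ev /= mul0r add0r mul0r.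
by rewrite quad_evD quad_evM IH.
Qed.

End QuadraticExtension.

(** * Quadratic twists *)

Lemma deriv_polyCM (F : fieldType) c (P : {poly F}) : (c%:P * P)^`() = c%:P * P^`().
Proof. by rewrite derivM derivC mul0r add0r. Qed.

Section Twist.
Variables (F : fieldType) (u : F).
Hypothesis u0 : u != 0.
Implicit Type P : {poly F}.

(** P(x/u): on the twist by u abscissas are multiplied by u, so this carries kernel polynomials to
    the twist. *)
Definition stretch P := P \Po (u^-1 *: 'X).

Lemma coef_stretch P i : (stretch P)`_i = u^-1 ^+ i * P`_i.
Proof.
rewrite /stretch comp_polyE coef_sum.
rewrite (eq_bigr (fun j : 'I_(size P) => (u^-1 ^+ i * P`_i) *+ (i == j))) => [|j _].
  case: (ltnP i (size P)) => lt_i; last first.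
    rewrite nth_default // mulr0 big1 // => j _; exact: mul0rn.
  rewrite (bigD1 (Ordinal lt_i)) //= eqxx big1 ?addr0 // => j ne.
  by rewrite (_ : (i == j) = false) //; apply: contraNF ne => /eqP e; apply/eqP/val_inj.
rewrite exprZn !coefZ coefXn; case: eqVneq => [->|_]; last by rewrite !mulr0.
by rewrite mulr1 mulrC.
Qed.

Lemma deriv_stretch P : (stretch P)^`() = (u^-1)%:P * stretch P^`().
Proof.
by rewrite /stretch deriv_comp derivZ derivX -mul_polyC mulr1 mulrC.
Qed.

Lemma size_stretch P : size (stretch P) = size P.
Proof.
by rewrite /stretch size_comp_poly2 // size_scale ?invr_eq0 // size_polyX.
Qed.

Lemma horner_stretch P x : (stretch P).[u * x] = P.[x].
Proof. by rewrite horner_comp hornerZ hornerX mulKf. Qed.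

Lemma stretch_natr n : stretch n%:R = n%:R. Proof. exact: rmorph_nat. Qed.
Lemma stretchC c : stretch c%:P = c%:P. Proof. exact: comp_polyC. Qed.
Lemma stretchX : stretch 'X = (u^-1)%:P * 'X.
Proof. by rewrite /stretch comp_polyX mul_polyC. Qed.
Lemma stretchD P Q : stretch (P + Q) = stretch P + stretch Q. Proof. exact: comp_polyD. Qed.
Lemma stretchB P Q : stretch (P - Q) = stretch P - stretch Q. Proof. exact: comp_polyB. Qed.
Lemma stretchM P Q : stretch (P * Q) = stretch P * stretch Q. Proof. exact: comp_polyM. Qed.
Lemma stretchXn P n : stretch (P ^+ n) = stretch P ^+ n. Proof. exact: rmorphXn. Qed.

Let uV : u%:P * (u^-1)%:P = 1 :> {poly F}. Proof. by rewrite -polyCM divff. Qed.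

Lemma cubic_stretch A B :
  cubic (u ^+ 2 * A) (u ^+ 3 * B) = u%:P ^+ 3 * stretch (cubic A B).
Proof.
rewrite /cubic -!mul_polyC !(stretchD, stretchM, stretchXn, stretchC, stretchX).
rewrite !(polyC_exp, polyCM); set a := u%:P; set b := (u^-1)%:P.
transitivity ((a * b) ^+ 3 * 'X ^+ 3 + a ^+ 2 * A%:P * ((a * b) * 'X) + a ^+ 3 * B%:P).
  by rewrite uV; ring.
by ring.
Qed.

Lemma cubic'_stretch A :
  3 * 'X ^+ 2 + (u ^+ 2 * A)%:P = u%:P ^+ 2 * stretch (3 * 'X ^+ 2 + A%:P) :> {poly F}.
Proof.
rewrite !(stretchD, stretchM, stretchXn, stretchC, stretchX, stretch_natr).
rewrite !(polyC_exp, polyCM); set a := u%:P; set b := (u^-1)%:P.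
transitivity (3 * ((a * b) ^+ 2 * 'X ^+ 2) + a ^+ 2 * A%:P); first by rewrite uV; ring.
by ring.
Qed.

Lemma theta2_stretch A B P :
  theta2 (u ^+ 2 * A) (u ^+ 3 * B) (stretch P) = u%:P * stretch (theta2 A B P).
Proof.
rewrite /theta2 cubic_stretch cubic'_stretch deriv_stretch deriv_polyCM deriv_stretch.
rewrite [in RHS]stretchD !(stretchM, stretch_natr).
set a := u%:P; set b := (u^-1)%:P.
transitivity (a * (2 * ((a * b) ^+ 2) * stretch (cubic A B) * stretch P^`()^`()
   + (a * b) * stretch (3 * 'X ^+ 2 + A%:P) * stretch P^`())); first by ring.
by rewrite uV; ring.
Qed.

Lemma theta2Z A B c P : theta2 A B (c%:P * P) = c%:P * theta2 A B P.
Proof. by rewrite /theta2 !deriv_polyCM; ring. Qed.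

(** Hirota's form is homogeneous of weight 2 when x and c have weight 1, A and A2 weight 2, and B
    weight 3; it is quadratic in the kernel polynomial. *)
Lemma hirota_stretch A B A2 c h g P : hirota (u ^+ 2 * A) (u ^+ 3 * B) (u ^+ 2 * A2) (u * c) h
    (g%:P * stretch P)
  = (g * u)%:P ^+ 2 * stretch (hirota A B A2 c h P).
Proof.
rewrite /hirota !(theta2Z, theta2_stretch).
set n := (2 * h).+1.
have lE : n%:R * 'X + (u * c)%:P = u%:P * stretch (n%:R * 'X + c%:P) :> {poly F}.
  rewrite !(stretchD, stretchM, stretchC, stretchX, stretch_natr) !polyCM.
  transitivity (n%:R * ((u%:P * (u^-1)%:P) * 'X) + u%:P * c%:P); first by rewrite uV; ring.
  by ring.
rewrite lE cubic_stretch cubic'_stretch !deriv_polyCM !deriv_stretch.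
move: (n%:R * 'X + c%:P) (3 * 'X ^+ 2 + A%:P) (cubic A B) => l f1 f.
move: (theta2 A B (theta2 A B P)) => E4; move: (theta2 A B P) => E.
rewrite !(stretchB, stretchD, stretchM, stretchXn, stretchC, stretch_natr).
rewrite !(polyC_exp, polyCM); set a := u%:P; set b := (u^-1)%:P.
set SP := stretch P; set SE := stretch E; set SE4 := stretch E4; set SD := stretch P^`().
set SDE := stretch E^`(); set Sf := stretch f; set Sl := stretch l; set Sf1 := stretch f1.
transitivity (g%:P ^+ 2 * a ^+ 2 * (2 * (SP * SE4 - 8 * Sf * ((a * b) ^+ 2) * SD * SDE + 3 * SE ^+ 2)
  - 12 * Sl * (SP * SE - 2 * Sf * ((a * b) ^+ 2) * SD ^+ 2)
  + (3 * Sl ^+ 2 + A2%:P - n%:R * Sf1) * SP ^+ 2)); first by ring.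
by rewrite uV; ring.
Qed.

End Twist.

Lemma collinear_scale (L : fieldType) (A B u : L) (P Q R : L * L) :
  collinear A B P Q R ->
  let sc (S : L * L) := (u ^+ 2 * S.1, u ^+ 3 * S.2) in
  collinear (u ^+ 4 * A) (u ^+ 6 * B) (sc P) (sc Q) (sc R).
Proof.
move=> [s [nu [[hP hQ hR] [h1 h2 h3]]]] /=.
exists (u * s), (u ^+ 3 * nu); rewrite /= hP hQ hR; split; first by split; ring.
split; first by rewrite exprMn h1; ring.
  transitivity (u ^+ 4 * (A - 2 * (s * nu))); first by ring.
  by rewrite h2; ring.
transitivity (u ^+ 6 * (B - nu ^+ 2)); first by ring.
by rewrite h3; ring.
Qed.

Section TwistedIsogeny.
Variables (F : fieldType) (A B A2 B2 c : F) (h : nat) (D : {poly F}) (u : F).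
Hypotheses (n2 : 2 != 0 :> F) (n3 : 3 != 0 :> F) (disc0 : 4 * A ^+ 3 + 27 * B ^+ 2 != 0).
Hypotheses (sD : size D = h.+1) (h_gt0 : (0 < h)%N) (u0 : u != 0).
Let p := (2 * h).+1.
Hypothesis p_prime : prime p.
Let e i := (D * 'X^i)`_h.
Hypotheses (hc : c * e 0 = 2 * e 1%N)
  (hA2 : e 0 ^+ 2 * (A - A2) = 5 * (6 * (e 1%N ^+ 2 - 2 * e 0 * e 2) + 2 * A * h%:R * e 0 ^+ 2))
  (hB2 : e 0 ^+ 3 * (B - B2)
    = 7 * (10 * (- e 1%N ^+ 3 + 3 * e 0 * e 1%N * e 2 - 3 * e 0 ^+ 2 * e 3)
           - 6 * A * e 1%N * e 0 ^+ 2 + 4 * B * h%:R * e 0 ^+ 3)).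
Hypothesis hirota0 : hirota A B A2 c h D = 0.
Let Du := (u ^+ h)%:P * stretch u D.
Hypothesis chain_closed : forall (L : closedFieldType) (iota : {rmorphism F -> L}),
  kernel_chain (u ^+ 2 * A) (u ^+ 3 * B) h Du iota.
Hypothesis chain_ext : exists (L : fieldType) (iota : {rmorphism F -> L}),
  kernel_chain (u ^+ 2 * A) (u ^+ 3 * B) h Du iota.

(** All identities are homogeneous, so they need to be checked only for the untwisted curves; u
    enters through the chain alone. *)
Lemma cyclic_twisted_isogeny :
  cyclic_isogeny_of_degree (short_wcurve (u ^+ 2 * A) (u ^+ 3 * B))
    (short_wcurve (u ^+ 2 * A2) (u ^+ 3 * B2)) p /\
  exists h' U' V' D',
    isogeny_data (u ^+ 2 * A) (u ^+ 3 * B) (u ^+ 2 * A2) (u ^+ 3 * B2) h' U' V' D'.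
Proof.
have sDu : size Du = h.+1.
  by rewrite /Du mul_polyC size_scale ?expf_neq0 // size_stretch.
have eE i : (Du * 'X^i)`_h = u ^+ i * e i.
  rewrite /e !coefMXn; case: ltnP => [_|le_ih]; first by rewrite mulr0.
  rewrite /Du mul_polyC coefZ coef_stretch // mulrA; congr (_ * _).
  by rewrite exprVn -{1}(subnKC le_ih) exprD mulfK ?expf_neq0.
apply: (@cyclic_odd_isogeny F _ _ _ _ (u * c) h Du n2 n3 _ sDu h_gt0 p_prime chain_closed chain_ext).
- rewrite (_ : _ + _ = u ^+ 6 * (4 * A ^+ 3 + 27 * B ^+ 2)) ?mulf_neq0 ?expf_neq0 //; ring.
- by rewrite hirota_stretch // hirota0 /stretch comp_poly0 mulr0.
apply: velu_defect_const => //; rewrite ?eE ?expr0 ?mul1r ?expr1.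
- by rewrite -mulrA hc mulrCA.
- transitivity (u ^+ 2 * (e 0 ^+ 2 * (A - A2))); first by ring.
  by rewrite hA2; ring.
- transitivity (u ^+ 3 * (e 0 ^+ 3 * (B - B2))); first by ring.
  by rewrite hB2; ring.
Qed.

End TwistedIsogeny.

(* Polynomials in x whose coefficients are integer polynomials in a parameter. *)
Definition badd := dense_add zadd.
Definition bmul := dense_mul [::] zadd zmul.
Definition bopp := map zopp.
Definition bconst z : seq (seq Z) := [:: [:: z]].
Fixpoint bderiv (l : seq (seq Z)) : seq (seq Z) :=
  if l is c :: l' then badd l' ([::] :: bderiv l') else [::].
Definition bis0 := all zis0.

Section BivariateEvaluation.
Variables (F : fieldType) (s : F).

Definition bev (l : seq (seq Z)) : {poly F} := dense_eval (fun c => (zev s c)%:P) 'X l.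

Let phi0 : (zev s [::])%:P = 0 :> {poly F}. Proof. exact: polyC0. Qed.
Let phiD a b : (zev s (zadd a b))%:P = (zev s a)%:P + (zev s b)%:P :> {poly F}.
Proof. by rewrite zevD polyCD. Qed.
Let phiM a b : (zev s (zmul a b))%:P = (zev s a)%:P * (zev s b)%:P :> {poly F}.
Proof. by rewrite zevM polyCM. Qed.
Let phiN a : (zev s (zopp a))%:P = - (zev s a)%:P :> {poly F}.
Proof. by rewrite zevN polyCN. Qed.

Lemma bevD l1 l2 : bev (badd l1 l2) = bev l1 + bev l2.
Proof. exact: dense_evalD phiD _ _ _. Qed.
Lemma bevM l1 l2 : bev (bmul l1 l2) = bev l1 * bev l2.
Proof. by apply: (dense_evalM (phi := fun c => (zev s c)%:P)). Qed.
Lemma bevN l : bev (bopp l) = - bev l.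
Proof. exact: dense_evalN phiN _ _. Qed.
Lemma bevC z : bev (bconst z) = (intr_of_Z F z)%:P.
Proof. by rewrite /bev /= /zev /= !mulr0 !addr0. Qed.
Lemma bev_cons c l : bev (c :: l) = (zev s c)%:P + 'X * bev l.
Proof. by []. Qed.
Lemma bev_nil : bev [::] = 0. Proof. by []. Qed.

Lemma bev_deriv l : bev (bderiv l) = (bev l)^`().
Proof.
elim: l => [|c l IH]; first by rewrite /= linear0.
rewrite /= bevD !bev_cons IH derivD derivC derivM derivX mul1r add0r.
by rewrite add0r.
Qed.

Lemma bev0 l : bis0 l -> bev l = 0.
Proof. by apply: dense_eval0 => c /(zis0P s) ->; rewrite polyC0. Qed.

Lemma coef_bev l i : (bev l)`_i = zev s (nth [::] l i).
Proof.
elim: l i => [|c l IH] [|i]; rewrite ?coef0 //.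
  by rewrite bev_cons coefD coefC coefXM /= addr0.
by rewrite bev_cons coefD coefC coefXM /= add0r IH.
Qed.

Lemma size_bev l z : zev s z != 0 -> size (bev (rcons l z)) = (size l).+1.
Proof.
move=> z0; apply/eqP; rewrite eqn_leq; apply/andP; split.
  apply/leq_sizeP => j le_j; rewrite coef_bev nth_default //.
  by rewrite size_rcons.
rewrite ltnNge; apply: contra z0 => le_l.
have := nth_default 0 le_l; rewrite coef_bev nth_rcons ltnn eqxx => ->; exact: eqxx.
Qed.

Section Hirota.
Variables (A B A2 c : seq Z) (h : nat) (D : seq (seq Z)).

Let p := bconst (Z.of_nat (2 * h).+1).
Let f := [:: B; A; [::]; [:: Z.one]].
Let f1 := [:: A; [::]; [:: Z.of_nat 3]].
Let n z := bmul (bconst (Z.of_nat z)).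

Definition btheta2 (g : seq (seq Z)) :=
  badd (n 2 (bmul f (bderiv (bderiv g)))) (bmul f1 (bderiv g)).

Definition bhirota :=
  let ell := [:: c; [:: Z.of_nat (2 * h).+1]] in
  let D1 := bderiv D in let E2 := btheta2 D in let E4 := btheta2 E2 in
  let DD := bmul D D in
  badd (badd
    (n 2 (badd (badd (bmul D E4) (bopp (n 8 (bmul f (bmul D1 (bderiv E2))))))
      (n 3 (bmul E2 E2))))
    (bopp (n 12 (bmul ell (badd (bmul D E2) (bopp (n 2 (bmul f (bmul D1 D1)))))))))
    (bmul (badd (badd (n 3 (bmul ell ell)) [:: A2]) (bopp (n (2 * h).+1 f1))) DD).

Let bevn z : bev (bconst (Z.of_nat z)) = z%:R.
Proof. by rewrite bevC intr_of_nat polyC_natr. Qed.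

Let cubicE : bev f = cubic (zev s A) (zev s B).
Proof.
rewrite /f !bev_cons bev_nil (_ : zev s [::] = 0) // zev_one polyC0 polyC1 /cubic -mul_polyC; ring.
Qed.
Let cubic'E : bev f1 = 3 * 'X ^+ 2 + (zev s A)%:P.
Proof.
rewrite /f1 !bev_cons bev_nil (_ : zev s [::] = 0) //.
have -> : (zev s [:: Z.of_nat 3])%:P = 3 :> {poly F}.
  by rewrite -(bevn 3) bev_cons bev_nil mulr0 addr0.
by rewrite polyC0; ring.
Qed.

Lemma bev_theta2 g : bev (btheta2 g) = theta2 (zev s A) (zev s B) (bev g).
Proof. by rewrite /btheta2 /theta2 bevD !bevM !bev_deriv bevn cubicE cubic'E mulrA. Qed.

Lemma bev_hirota : bev bhirota = hirota (zev s A) (zev s B) (zev s A2) (zev s c) h (bev D).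
Proof.
have ellE : bev [:: c; [:: Z.of_nat (2 * h).+1]] = (2 * h).+1%:R * 'X + (zev s c)%:P.
  rewrite !bev_cons bev_nil mulr0 addr0.
  have -> : (zev s [:: Z.of_nat (2 * h).+1])%:P = (2 * h).+1%:R :> {poly F}.
    by rewrite -(bevn (2 * h).+1) bev_cons bev_nil mulr0 addr0.
  by rewrite addrC mulrC.
have A2E : bev [:: A2] = (zev s A2)%:P by rewrite bev_cons bev_nil mulr0 addr0.
rewrite /bhirota /hirota /n !(bevD, bevN, bevM, bevn, bev_deriv, bev_theta2, ellE, A2E).
rewrite cubicE cubic'E.
move: (theta2 _ _ (theta2 _ _ _)) => E4; move: (theta2 _ _ _) => E2.
by move: (cubic _ _) (_ * 'X ^+ 2 + _) (_ * 'X + _) => f' f1' l'; ring.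
Qed.

End Hirota.
End BivariateEvaluation.

(** * Isogenies certified on the universal curve over X_1(p) *)

Lemma rmorph_peval (R S : comPzRingType) (phi : {rmorphism R -> S}) x e :
  phi (peval x e) = peval (phi x) e.
Proof.
elim: e => [z||e IH|e1 IH1 e2 IH2|e1 IH1 e2 IH2|e IH k] //=.
- by rewrite !intr_of_ZE rmorph_int.
- by rewrite rmorphN IH.
- by rewrite rmorphD IH1 IH2.
- by rewrite rmorphM IH1 IH2.
- by rewrite rmorphXn IH.
Qed.

(* Data for a parameter t on the genus 0 curve X_0(p), p = 2 h + 1: the curves
   (A, B) and (A2, B2) linked by the p-isogeny, p times the kernel polynomial D,
   and, on the universal curve over X_1(p), a point P of order p and the slopes of
   the lines through P and k P, k = 1, ..., h, and of the tangent at h P.  The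
   function field of X_1(p) is Q(w, v) with v ^ 2 = K(w) - H(w) v. *)
Record modular_data := ModularData {
  md_h : nat;
  md_A : pexp; md_B : pexp; md_A2 : pexp; md_B2 : pexp;
  md_c : pexp; md_D : seq pexp;
  md_H : pexp; md_K : pexp; md_M : pexp;
  md_T : quad; md_mu : quad; md_kap : quad;
  md_pt1 : quad * quad; md_slopes : seq quad; md_xi : seq quad }.

Definition quad_of (a b : pexp) k : quad := (coefs a, coefs b, k).

Section ModularData.
Variable d : modular_data.
Let h := md_h d.
Let A := md_A d. Let B := md_B d. Let A2 := md_A2 d. Let B2 := md_B2 d.
Let c := md_c d. Let D := md_D d.
Let H := coefs (md_H d). Let K := coefs (md_K d). Let M := coefs (md_M d).
Let T := md_T d. Let mu := md_mu d. Let kap := md_kap d. Let P1 := md_pt1 d.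
Let q0 : quad := ([::], [::], 0%N).
Let slope k := nth q0 (md_slopes d) k.-1.
Let xi k := nth q0 (md_xi d) k.-1.

Local Notation "x +q y" := (quad_add M x y) (at level 50, left associativity).
Local Notation "-q x" := (quad_opp x) (at level 35).
Local Notation "x *q y" := (quad_mul H K x y) (at level 40, left associativity).

(** The chord through P and kP with slope s has third abscissa s^2 - x(P) - x(kP). Storing the
    slopes makes the computation free of divisions. *)
Fixpoint chain_points (P : quad * quad) (slopes : seq quad) : seq (quad * quad) :=
  if slopes is s :: slopes' then
    let x := s *q s +q (-q (P1.1 +q P.1)) in
    P :: chain_points (x, s *q (P1.1 +q (-q x)) +q (-q P1.2)) slopes'
  else [::].

Let pts := chain_points P1 (md_slopes d).
Let pt k := nth (q0, q0) pts k.-1.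

(* The coefficients of the universal curve, from its tangent at P. *)
Let nu1 := P1.2 +q (-q (slope 1 *q P1.1)).
Let A' := slope 1 *q (nu1 +q nu1) +q P1.1 *q (P1.1 +q (pt 2).1 +q (pt 2).1).
Let B' := nu1 *q nu1 +q (-q (P1.1 *q P1.1 *q (pt 2).1)).

Let coef i := if (i <= h)%N then nth (PCst Z0) D (h - i) else PCst Z0.

(** The hypotheses of [cyclic_twisted_isogeny] on D, A2, B2 and c, as identities in the parameter.
    [coef i] is the coefficient of degree h - i, taken as 0 when i exceeds h. *)
Definition velu_check :=
  let e0 := coef 0 in let e1 := coef 1 in let e2 := coef 2 in let e3 := coef 3 in
  let hZ := PCst (Z.of_nat h) in
  [&& size D == h.+1,
      bis0 (bhirota (coefs A) (coefs B) (coefs A2) (coefs c) h (map coefs D)),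
      zis0 (coefs (c * e0 - 2 * e1)%pexp),
      zis0 (coefs (e0 ^ 2 * (A - A2)
        - 5 * (6 * (e1 ^ 2 - 2 * e0 * e2) + 2 * A * hZ * e0 ^ 2))%pexp)
    & zis0 (coefs (e0 ^ 3 * (B - B2)
        - 7 * (10 * (- e1 ^ 3 + 3 * e0 * e1 * e2 - 3 * e0 ^ 2 * e3)
               - 6 * A * e1 * e0 ^ 2 + 4 * B * hZ * e0 ^ 3))%pexp)].

Definition line_check (a b s : quad) (P Q R : quad * quad) :=
  let nu := P.2 +q (-q (s *q P.1)) in
  [&& quad_eq M Q.2 (s *q Q.1 +q nu), quad_eq M R.2 (s *q R.1 +q nu),
      quad_eq M (s *q s) (P.1 +q Q.1 +q R.1),
      quad_eq M (a +q (quad_const (Zneg (xO xH)) *q (s *q nu)))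
        (P.1 *q Q.1 +q P.1 *q R.1 +q Q.1 *q R.1)
    & quad_eq M (b +q (-q (nu *q nu))) (-q (P.1 *q Q.1 *q R.1))].

(** The first two equations say that the curve of parameter T is the twist of the universal curve by
    mu/kap^2, and [xi k] is the abscissa of kP on that twist. Since P + hP + hP = O, the tangent at
    hP, of slope index h+1, passes through P and closes the chain. *)
Definition chain_check :=
  let kap2 := kap *q kap in let kap4 := kap2 *q kap2 in let mu2 := mu *q mu in
  let qD := map (quad_subst H K M T) D in
  [&& quad_eq M (mu2 *q A') (kap4 *q quad_subst H K M T A),
      quad_eq M (mu2 *q mu *q B') (kap4 *q kap2 *q quad_subst H K M T B),
      all (fun k => line_check A' B' (slope k) (pt 1) (pt k) ((pt k.+1).1, -q (pt k.+1).2))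
        (iota 1 h.-1),
      line_check A' B' (slope h.+1) (pt 1) (pt h) (pt h)
    & all (fun k => quad_eq M (xi k *q kap2) (mu *q (pt k).1) &&
                    quad_is0 (quad_horner H K M qD (xi k))) (iota 1 h)].

Section ChainPoints.
Variables (F L : fieldType) (phi : {rmorphism F -> L}) (s u : F) (w v eps : L).
Hypotheses (M0 : zev w M != 0) (vE : v ^+ 2 = zev w K - zev w H * v).
Let ev := quad_ev M w v.
Hypotheses (TE : ev T = phi s) (kap0 : ev kap != 0) (epsE : eps ^+ 2 = phi u * ev mu).
Hypotheses (h_gt0 : (0 < h)%N) (chk : chain_check) (u0 : u != 0).

Let evD q1 q2 : ev (q1 +q q2) = ev q1 + ev q2. Proof. exact: quad_evD. Qed.
Let evN q : ev (-q q) = - ev q. Proof. exact: quad_evN. Qed.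
Let evM q1 q2 : ev (q1 *q q2) = ev q1 * ev q2. Proof. exact: quad_evM. Qed.
Let evE q1 q2 : quad_eq M q1 q2 -> ev q1 = ev q2. Proof. exact: quad_evE. Qed.
Let evT e : ev (quad_subst H K M T e) = phi (peval s e).
Proof. by rewrite /ev quad_ev_subst // -/ev TE rmorph_peval. Qed.
Let ev2 : ev (quad_const (Zneg (xO xH))) = - 2.
Proof. by rewrite /ev quad_evC /=. Qed.

Let evpt (P : quad * quad) := (ev P.1, ev P.2).

Lemma line_checkP a b t P Q R : line_check a b t P Q R ->
  collinear (ev a) (ev b) (evpt P) (evpt Q) (evpt R).
Proof.
case/and5P => /evE e1 /evE e2 /evE e3 /evE e4 /evE e5.
rewrite !(evD, evN, evM, ev2) in e1 e2 e3 e4 e5.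
exists (ev t), (ev P.2 - ev t * ev P.1); split; split=> /=.
- by ring.
- by rewrite e1.
- by rewrite e2.
- by rewrite expr2 e3.
- by rewrite -e4; ring.
- by rewrite -e5; ring.
Qed.

Lemma chain_of_check : kernel_chain (u ^+ 2 * peval s A) (u ^+ 3 * peval s B) h
  ((u ^+ h)%:P * stretch u (bev s (map coefs D))) phi.
Proof.
case/and5P: chk => /evE cA /evE cB /allP lines last_line /allP roots.
rewrite !(evM, evT) in cA cB.
(* r^2 is the total twist u mu/kap^2, so (x, y) -> (r^2 x, r^3 y) is an isomorphism from the
   universal curve to the twisted one. *)
pose r := eps / ev kap.
have r2 : r ^+ 2 = phi u * ev mu / ev kap ^+ 2 by rewrite expr_div_n epsE.
have r4 : r ^+ 4 = (phi u * ev mu / ev kap ^+ 2) ^+ 2 by rewrite -r2; ring.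
have r6 : r ^+ 6 = (phi u * ev mu / ev kap ^+ 2) ^+ 3 by rewrite -r2; ring.
have AE : phi (u ^+ 2 * peval s A) = r ^+ 4 * ev A'.
  rewrite rmorphM rmorphXn; have -> : phi (peval s A) = (ev mu * ev mu * ev A') / (ev kap ^+ 4).
    by rewrite cA; field.
  by rewrite r4; field.
have BE : phi (u ^+ 3 * peval s B) = r ^+ 6 * ev B'.
  rewrite rmorphM rmorphXn; have -> : phi (peval s B) = (ev mu * ev mu * ev mu * ev B') / (ev kap ^+ 6).
    by rewrite cB; field.
  by rewrite r6; field.
exists (fun k => (r ^+ 2 * ev (pt k).1, r ^+ 3 * ev (pt k).2)).
rewrite AE BE; split.
- move=> k kh; have /lines/line_checkP : k \in iota 1 h.-1 by rewrite mem_iota; lia.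
  move/(collinear_scale r); rewrite /= /opp_pt /= evN.
  by rewrite (_ : r ^+ 3 * - _ = - (r ^+ 3 * ev (pt k.+1).2)) //; ring.
- by move/line_checkP: last_line => /(collinear_scale r).
move=> k kh; have /roots/andP[/evE ek] : k \in iota 1 h by rewrite mem_iota; lia.
move/(quad_ev0 M w v); rewrite quad_ev_horner // => r0.
rewrite /= !evM in ek.
have -> : r ^+ 2 * ev (pt k).1 = phi u * ev (xi k).
  rewrite r2; apply: (mulIf (expf_neq0 2 kap0)).
  by rewrite -[in RHS]mulrA [_ ^+ 2]expr2 ek; field.
have -> : map_poly phi ((u ^+ h)%:P * stretch u (bev s (map coefs D)))
    = (phi u ^+ h)%:P * stretch (phi u) (map_poly phi (bev s (map coefs D))).
  rewrite rmorphM /= map_polyC /stretch map_comp_poly map_polyZ map_polyX.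
  by congr (_%:P * (_ \Po (_ *: _))); [exact: rmorphXn | exact: fmorphV].
rewrite rootE hornerM horner_stretch ?fmorph_eq0 //.
apply/eqP; rewrite (_ : _.[ev (xi k)] = 0) ?mulr0 //.
rewrite -[RHS]r0; elim: (D) => [|e l IH] /=.
  by rewrite bev_nil map_polyC /= rmorph0 horner0.
rewrite bev_cons rmorphD rmorphM /= map_polyX map_polyC hornerD hornerC hornerM hornerX IH.
by congr (_ + _); rewrite -/ev evT peval_coefs.
Qed.

End ChainPoints.

Section ModularIsogeny.
Variables (F : fieldType) (s u : F).
Hypotheses (n2 : 2 != 0 :> F) (n3 : 3 != 0 :> F) (u0 : u != 0).
Hypothesis disc0 : 4 * peval s A ^+ 3 + 27 * peval s B ^+ 2 != 0.
Hypotheses (h_gt0 : (0 < h)%N) (p_prime : prime (2 * h).+1).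
Hypotheses (lead0 : peval s (coef 0) != 0) (vchk : velu_check) (cchk : chain_check).

(** A point (w, v) of X_1(p) above the parameter s, away from the poles, with a square root that
    trivializes the twist. *)
Definition tower (L : fieldType) (phi : F -> L) : Prop := exists w v eps : L,
  [/\ zev w M != 0, v ^+ 2 = zev w K - zev w H * v, quad_ev M w v T = phi s,
      quad_ev M w v kap != 0 & eps ^+ 2 = phi u * quad_ev M w v mu].

Hypothesis tower_closed : forall (L : closedFieldType) (phi : {rmorphism F -> L}), tower phi.
Hypothesis tower_ext : exists (L : fieldType) (phi : {rmorphism F -> L}), tower phi.

Theorem modular_isogeny :
  cyclic_isogeny_of_degree (short_wcurve (u ^+ 2 * peval s A) (u ^+ 3 * peval s B))
    (short_wcurve (u ^+ 2 * peval s A2) (u ^+ 3 * peval s B2)) (2 * h).+1 /\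
  exists h' U' V' D', isogeny_data (u ^+ 2 * peval s A) (u ^+ 3 * peval s B)
    (u ^+ 2 * peval s A2) (u ^+ 3 * peval s B2) h' U' V' D'.
Proof.
have tower_chain (L : fieldType) (phi : {rmorphism F -> L}) : tower phi ->
    kernel_chain (u ^+ 2 * peval s A) (u ^+ 3 * peval s B) h
      ((u ^+ h)%:P * stretch u (bev s (map coefs D))) phi.
  by move=> [w [v [eps [M0 vE TE kap0 epsE]]]]; apply: (chain_of_check M0 vE TE kap0 epsE).
case/and5P: vchk => /eqP sizeD hir cc cA cB.
have eE i : (bev s (map coefs D) * 'X^i)`_h = peval s (coef i).
  rewrite coefMXn /coef ltnNge; case: leqP => //= le_ih.
  by rewrite coef_bev (nth_map (PCst Z0)) ?sizeD ?ltnS ?leq_subr // -peval_coefs.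
have sD : size (bev s (map coefs D)) = h.+1.
  have sm : size (map coefs D) = h.+1 by rewrite size_map.
  have := lead0; rewrite /coef leq0n subn0 peval_coefs -(nth_map _ [::]) ?sizeD //.
  have -> : map coefs D = rcons (take h (map coefs D)) (nth [::] (map coefs D) h).
    by rewrite -take_nth ?sm // take_oversize ?sm.
  rewrite nth_rcons size_take sm ltnSn ltnn eqxx => l0.
  by rewrite size_bev // size_take sm ltnSn.
apply: (@cyclic_twisted_isogeny F _ _ _ _ (peval s c) h _ u n2 n3 disc0 sD h_gt0 u0 p_prime).
- by rewrite !eE; apply/eqP; rewrite -subr_eq0; apply/eqP; exact: (peval_eq0 s cc).
- rewrite !eE; apply/eqP; rewrite -subr_eq0; apply/eqP; move: (peval_eq0 s cA) => /= <-.
  by rewrite intr_of_nat.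
- rewrite !eE; apply/eqP; rewrite -subr_eq0; apply/eqP; move: (peval_eq0 s cB) => /= <-.
  by rewrite intr_of_nat.
- by rewrite !peval_coefs -bev_hirota bev0.
- by move=> L phi; apply/tower_chain/tower_closed.
- by have [L [phi /tower_chain ch]] := tower_ext; exists L, phi.
Qed.

End ModularIsogeny.
End ModularData.

(** * The data for p = 5, 7, 13 *)

Section Data.
Local Notation t := PVar.
Local Notation w := PVar.

Definition modular_data5 : modular_data := ModularData 2
  (family_coefs 5 1).1 (family_coefs 5 1).2 (family_coefs 5 2).1 (family_coefs 5 2).2
  (-60*t^2 - 1320*t - 7500)%pexp
  [:: 801*t^4 + 42372*t^3 + 785250*t^2 + 6187500*t + 17578125;
      -150*t^2 - 3300*t - 18750;
      5]%pexp
  (0)%pexp (0)%pexp (w^2 - 11*w - 1)%pexp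
  (coefs (5 * 5 * 5 * w)%pexp, [::], 1%N) (quad_of (625*w^2 + 625)%pexp (0)%pexp 2) (quad_of
    1%pexp 0%pexp 0)
  (quad_of (3*w^2 - 18*w + 3)%pexp (0)%pexp 0,
   quad_of (-108*w)%pexp (0)%pexp 0)
  [:: quad_of (-3*w + 3)%pexp (0)%pexp 0;
      quad_of (3*w + 3)%pexp (0)%pexp 0;
      quad_of (3*w + 3)%pexp (0)%pexp 0]
  [:: quad_mul [::] [::] (quad_of (625*w^2 + 625)%pexp (0)%pexp 2) (quad_of (3*w^2 - 18*w +
    3)%pexp (0)%pexp 0);
      quad_mul [::] [::] (quad_of (625*w^2 + 625)%pexp (0)%pexp 2) (quad_of (3*w^2 + 18*w +
        3)%pexp (0)%pexp 0)].

(** Tate's normal form with b = w^3 - w^2 and c = w^2 - w; X_1(7) is rational as well. *)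
Definition modular_data7 : modular_data := ModularData 3
  (family_coefs 7 1).1 (family_coefs 7 1).2 (family_coefs 7 2).1 (family_coefs 7 2).2
  (-126*t^2 - 1638*t - 6174)%pexp
  [:: -23787*t^6 - 1338525*t^5 - 28743498*t^4 - 317587473*t^3 - 1924972938*t^2 - 6070335453*t -
    7626831723;
      6237*t^4 + 201474*t^3 + 2324511*t^2 + 11798514*t + 22235661;
      -441*t^2 - 5733*t - 21609;
      7]%pexp
  (0)%pexp (0)%pexp (w^3 - 8*w^2 + 5*w + 1)%pexp
  (coefs (7 * 7 * w * (w - 1))%pexp, [::], 1%N) (quad_of (343*w^2 - 343*w + 343)%pexp (0)%pexp 2)
    (quad_of 1%pexp 0%pexp 0)
  (quad_of (3*w^4 - 18*w^3 + 9*w^2 + 6*w + 3)%pexp (0)%pexp 0,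
   quad_of (-108*w^3 + 108*w^2)%pexp (0)%pexp 0)
  [:: quad_of (-3*w^2 + 3*w + 3)%pexp (0)%pexp 0;
      quad_of (3*w^2 - 3*w + 3)%pexp (0)%pexp 0;
      quad_of (-3*w^2 + 9*w - 3)%pexp (0)%pexp 0;
      quad_of (-3*w^2 + 9*w - 3)%pexp (0)%pexp 0]
  [:: quad_mul [::] [::] (quad_of (343*w^2 - 343*w + 343)%pexp (0)%pexp 2) (quad_of (3*w^4 -
    18*w^3 + 9*w^2 + 6*w + 3)%pexp (0)%pexp 0);
      quad_mul [::] [::] (quad_of (343*w^2 - 343*w + 343)%pexp (0)%pexp 2) (quad_of (3*w^4 +
        18*w^3 - 27*w^2 + 6*w + 3)%pexp (0)%pexp 0);
      quad_mul [::] [::] (quad_of (343*w^2 - 343*w + 343)%pexp (0)%pexp 2) (quad_of (3*w^4 -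
        18*w^3 + 45*w^2 - 30*w + 3)%pexp (0)%pexp 0)].

(** X_1(13) has genus 2, with equation v^2 + (w^3 + w^2 + 1) v = w^2 + w. The factor [kap] = 1 + v
    accounts for the scaling of the model of the universal curve. *)
Definition modular_data13 : modular_data := ModularData 6
  (family_coefs 13 1).1 (family_coefs 13 1).2 (family_coefs 13 2).1 (family_coefs 13 2).2
  (-468*t^4 - 5148*t^3 - 26208*t^2 - 66924*t - 79092)%pexp
  [:: 622980801*t^24 + 67506946938*t^23 + 3356279114787*t^22 + 103300287222006*t^21 +
    2233915731557235*t^20 + 36407440779507504*t^19 + 467244678719249964*t^18 +
    4863295288308467556*t^17 + 41906561590255386609*t^16 + 303348821268237041466*t^15 +
    1863798819157615717377*t^14 + 9788595229330076393442*t^13 + 44138240189368590164562*t^12 +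
    171227991383758224759402*t^11 + 571384854792671610766725*t^10 + 1636133561416468284955434*t^9
    + 4000275330765235434196245*t^8 + 8284586643485214269107212*t^7 +
    14361170212157308972118388*t^6 + 20479193784291462549824664*t^5 +
    23418702189712030595428359*t^4 + 20656047368081621548317798*t^3 +
    13186166352133829283451287*t^2 + 5410679450086478013008706*t + 1065739891683700214683533;
      -303358770*t^20 - 25600997214*t^19 - 987315110964*t^18 - 23553023522418*t^17 -
        394257850494300*t^16 - 4958265317199714*t^15 - 48845028011905944*t^14 -
        387271892652141978*t^13 - 2516052360074875362*t^12 - 13552154315506638468*t^11 -
        60938890933866971688*t^10 - 229437149682478743252*t^9 - 722756806364513463426*t^8 -
        1896173114635356868818*t^7 - 4105455623891345796696*t^6 - 7226703791456367381930*t^5 -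
        10103011360869277125756*t^4 - 10810611436379050820394*t^3 - 8324007417006866874900*t^2 -
        4104596760799937803830*t - 970177416189076208178;
      55538379*t^16 + 3456135540*t^15 + 98229907386*t^14 + 1726993583640*t^13 +
        21225858702867*t^12 + 194467741057512*t^11 + 1378738957388130*t^10 + 7734988234538604*t^9
        + 34765525075390668*t^8 + 125777228312419164*t^7 + 365490176195652066*t^6 +
        844908619262832072*t^5 + 1524564834370313931*t^4 + 2077244035105188456*t^3 +
        2016341737727088330*t^2 + 1245515630647834260*t + 367993254509587395;
      -4735692*t^12 - 200385900*t^11 - 3894015060*t^10 - 46643334192*t^9 - 385690915116*t^8 -
        2326217600772*t^7 - 10512405456696*t^6 - 35918013024036*t^5 - 92217672602172*t^4 -
        173785280754384*t^3 - 228616691867460*t^2 - 188972178826860*t - 74443585598460;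
      188487*t^8 + 4733586*t^7 + 55240731*t^6 + 387991890*t^5 + 1792620180*t^4 + 5581561986*t^3 +
        11478523095*t^2 + 14335622730*t + 8471049795;
      -3042*t^4 - 33462*t^3 - 170352*t^2 - 435006*t - 514098;
      13]%pexp
  (w^3 + w^2 + 1)%pexp (w^2 + w)%pexp (w^3 + 4*w^2 + w - 1)%pexp
  (coefs (13 * - w * (w - - 1))%pexp, [::], 1%N) (quad_of (2197*w^12 + 10985*w^11 + 21970*w^10 +
    28561*w^9 + 43940*w^8 + 70304*w^7 + 81289*w^6 + 70304*w^5 + 52728*w^4 + 41743*w^3 + 30758*w^2
    + 10985*w + 2197)%pexp (2197*w^9 + 8788*w^8 + 13182*w^7 + 13182*w^6 + 19773*w^5 + 28561*w^4 +
    26364*w^3 + 13182*w^2)%pexp 4) (quad_of 1%pexp 1%pexp 0)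
  (quad_of (3*w^12 + 15*w^11 + 18*w^10 + 39*w^7 + 33*w^6 - 27*w^5 - 27*w^4 + 18*w^3 + 21*w^2 + 3*w
    + 3)%pexp (-3*w^13 - 15*w^12 - 18*w^11 - 3*w^10 - 15*w^9 - 57*w^8 - 33*w^7 + 30*w^6 - 45*w^4 -
    3*w^3 + 15*w^2 + 3)%pexp 0,
   quad_of (-108*w^14 - 324*w^13 - 216*w^12 + 108*w^11 - 324*w^10 - 864*w^9 - 108*w^8 + 648*w^7 -
     540*w^5 - 108*w^4 + 216*w^3 + 108*w^2)%pexp (108*w^15 + 324*w^14 + 216*w^13 + 648*w^11 +
     1080*w^10 - 432*w^8 + 648*w^7 + 648*w^6 - 324*w^5 - 324*w^4 + 108*w^3 + 108*w^2)%pexp 0)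
  [:: quad_of (-3*w^4 + 3*w^2 + 3)%pexp (3*w^5 - 3*w^3 + 3*w^2 + 3)%pexp 0;
      quad_of (3*w^4 - 3*w^2 + 3)%pexp (-3*w^5 + 3*w^3 - 3*w^2 + 3)%pexp 0;
      quad_of (-3*w^4 - 6*w^3 - 3*w^2 + 3)%pexp (3*w^5 + 6*w^4 + 3*w^3 + 3*w^2 + 3)%pexp 0;
      quad_of (3*w^4 + 6*w^3 + 3*w^2 + 3)%pexp (-3*w^5 - 6*w^4 - 3*w^3 - 3*w^2 - 6*w + 3)%pexp 0;
      quad_of (-3*w^4 - 6*w^3 + 3*w^2 + 6*w + 3)%pexp (3*w^5 + 6*w^4 - 3*w^3 - 3*w^2 + 6*w +
        3)%pexp 0;
      quad_of (3*w^4 + 6*w^3 - 3*w^2 - 12*w - 3)%pexp (-3*w^5 - 6*w^4 + 3*w^3 + 9*w^2 - 6*w -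
        3)%pexp 0;
      quad_of (3*w^4 + 6*w^3 - 3*w^2 - 12*w - 3)%pexp (-3*w^5 - 6*w^4 + 3*w^3 + 9*w^2 - 6*w -
        3)%pexp 0]
  [:: quad_of (6591*w^12 + 46137*w^11 + 125229*w^10 + 197730*w^9 + 316368*w^8 + 553644*w^7 +
    751374*w^6 + 751374*w^5 + 533871*w^4 + 283413*w^3 + 131820*w^2 + 32955*w + 6591)%pexp
    (79092*w^5 + 158184*w^4 + 158184*w^3 + 79092*w^2)%pexp 4;
      quad_of (6591*w^12 + 46137*w^11 + 125229*w^10 + 197730*w^9 + 237276*w^8 + 158184*w^7 -
        39546*w^6 - 197730*w^5 - 177957*w^4 - 32955*w^3 + 52728*w^2 + 32955*w + 6591)%pexp
        (79092*w^8 + 237276*w^7 + 316368*w^6 + 237276*w^5 + 79092*w^4)%pexp 4;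
      quad_of (6591*w^12 - 32955*w^11 - 191139*w^10 - 355914*w^9 - 395460*w^8 - 395460*w^7 -
        435006*w^6 - 435006*w^5 - 257049*w^4 - 32955*w^3 + 52728*w^2 + 32955*w + 6591)%pexp
        (-79092*w^8 - 237276*w^7 - 316368*w^6 - 237276*w^5 - 79092*w^4)%pexp 4;
      quad_of (6591*w^12 + 46137*w^11 + 125229*w^10 + 118638*w^9 - 79092*w^8 - 237276*w^7 -
        39546*w^6 + 355914*w^5 + 533871*w^4 + 362505*w^3 + 131820*w^2 + 32955*w + 6591)%pexp
        (-79092*w^7 - 395460*w^6 - 870012*w^5 - 1107288*w^4 - 870012*w^3 - 395460*w^2 -
        79092*w)%pexp 4;
      quad_of (6591*w^12 + 46137*w^11 + 125229*w^10 + 197730*w^9 + 237276*w^8 + 316368*w^7 +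
        435006*w^6 + 435006*w^5 + 296595*w^4 + 125229*w^3 + 52728*w^2 + 32955*w + 6591)%pexp
        (-79092*w^5 - 158184*w^4 - 158184*w^3 - 79092*w^2)%pexp 4;
      quad_of (6591*w^12 + 46137*w^11 + 204321*w^10 + 593190*w^9 + 1186380*w^8 + 1819116*w^7 +
        2333214*w^6 + 2491398*w^5 + 2115711*w^4 + 1311609*w^3 + 527280*w^2 + 112047*w + 6591)%pexp
        (79092*w^7 + 395460*w^6 + 870012*w^5 + 1107288*w^4 + 870012*w^3 + 395460*w^2 +
        79092*w)%pexp 4].

End Data.

(** * Points of X_1(p) above a given parameter *)

Lemma polyC_intr_of_Z (F : fieldType) z : (intr_of_Z F z)%:P = intr_of_Z {poly F} z.
Proof. by rewrite !intr_of_ZE rmorph_int. Qed.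

Lemma zev_horner (F : fieldType) (w : F) l : (zev ('X : {poly F}) l).[w] = zev w l.
Proof.
elim: l => [|z l IH]; first by rewrite horner0.
by rewrite /zev /= -polyC_intr_of_Z hornerD hornerM hornerX hornerC -/(zev _ l) IH.
Qed.

Lemma coef_zev (F : fieldType) l i : (zev ('X : {poly F}) l)`_i = intr_of_Z F (nth Z0 l i).
Proof.
elim: l i => [|z l IH] [|i] //=; rewrite ?coef0 // coefD coefXM -polyC_intr_of_Z coefC /=.
  by rewrite addr0.
by rewrite add0r IH.
Qed.

Lemma map_zev (F L : fieldType) (phi : {rmorphism F -> L}) l :
  map_poly phi (zev 'X l) = zev 'X l.
Proof.
elim: l => [|z l IH]; first exact: rmorph0.
by rewrite /zev /= rmorphD rmorphM /= map_polyX -/(zev _ l) IH !intr_of_ZE rmorph_int.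
Qed.

Section TowerExistence.
Variables (d : modular_data) (Tn : seq Z) (F : fieldType) (s u : F).
Let M := coefs (md_M d).
Let H := coefs (md_H d). Let K := coefs (md_K d).
Hypothesis T_E : md_T d = (Tn, [::], 1%N).
Hypotheses (sM : (1 < size M)%N) (sTn : (size Tn < size M)%N) (leadM : last Z0 M = Z.one).
Hypothesis s0 : s != 0.
Hypothesis coTM : forall (L : fieldType) (phi : {rmorphism F -> L}) (w : L),
  zev w M = 0 -> zev w Tn <> 0.
Hypothesis kap0 : forall (L : fieldType) (phi : {rmorphism F -> L}) (w v : L),
  zev w M != 0 -> v ^+ 2 = zev w K - zev w H * v -> zev w Tn != 0 ->
  quad_ev M w v (md_kap d) != 0.

(** Its roots w have T(w) = s. It is not constant because M is monic of larger degree than [Tn] and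
    s is nonzero. *)
Let qw : {poly F} := zev 'X Tn - s%:P * zev 'X M.

Let size_qw : (1 < size qw)%N.
Proof.
rewrite ltnNge; apply/negP => /leq_sizeP/(_ (size M).-1).
rewrite coefB coefCM !coef_zev nth_last leadM nth_default ?sub0r; last by case: (M) sTn.
rewrite (_ : intr_of_Z F Z.one = 1) // mulr1 => /(_ _) e.
by move: s0; rewrite -oppr_eq0 e ?eqxx //; case: (M) sM.
Qed.

Let qv (L : fieldType) (w : L) : {poly L} := 'X^2 + ((zev w H)%:P * 'X - (zev w K)%:P).

Let size_qv (L : fieldType) (w : L) : (1 < size (qv w))%N.
Proof.
rewrite /qv size_polyDl size_polyXn //.
rewrite (leq_ltn_trans (size_polyD _ _)) // size_polyN gtn_max mul_polyC.
rewrite (leq_ltn_trans (size_scale_leq _ _)) ?size_polyX //.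
by rewrite (leq_ltn_trans (size_polyC_leq1 _)).
Qed.

Let tower_roots (L : fieldType) (phi : {rmorphism F -> L}) (w v eps : L) :
  root (map_poly phi qw) w -> root (qv w) v ->
  eps ^+ 2 = phi u * quad_ev M w v (md_mu d) -> tower d s u phi.
Proof.
rewrite /qw rmorphB rmorphM /= map_polyC !map_zev rootE hornerD hornerN hornerM hornerC.
rewrite !zev_horner subr_eq0 => /eqP Tw.
rewrite rootE /qv !(hornerD, hornerN, hornerM, hornerC, hornerX, hornerXn) => /eqP vw epsE.
have M0 : zev w M != 0.
  by apply/eqP => M0; apply: (coTM phi M0); rewrite Tw M0 mulr0.
have vE : v ^+ 2 = zev w K - zev w H * v.
  by apply/eqP; rewrite -subr_eq0 -[X in _ == X]vw; apply/eqP; ring.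
exists w, v, eps; split => //.
  by rewrite T_E /quad_ev /= mul0r addr0 Tw mulfK.
by apply: kap0 => //; rewrite Tw mulf_neq0 // fmorph_eq0.
Qed.

Lemma tower_in_closed (L : closedFieldType) (phi : {rmorphism F -> L}) : tower d s u phi.
Proof.
have [w rw] : exists w, root (map_poly phi qw) w by apply: closed_root; rewrite size_map_poly.
have [v rv] := closed_root (size_qv w).
have [eps epsE] := closed_sqrt (phi u * quad_ev M w v (md_mu d)).
exact: tower_roots rw rv epsE.
Qed.

Lemma tower_in_extension : exists (L : fieldType) (phi : {rmorphism F -> L}), tower d s u phi.
Proof.
have [L1 [i1 [w rw]]] := adjoin_root size_qw.
have [L2 [i2 [v rv]]] := adjoin_root (size_qv w).
have [L3 [i3 [eps epsE]]] := adjoin_sqrt (i2 (i1 u) * quad_ev M (i2 w) v (md_mu d)).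
pose phi : {rmorphism F -> L3} := i3 \o i2 \o i1.
have zevi (R S : fieldType) (i : {rmorphism R -> S}) x l : i (zev x l) = zev (i x) l.
  by rewrite -!zev_horner -(map_zev i) horner_map.
have map_qv (R S : fieldType) (i : {rmorphism R -> S}) x : map_poly i (qv x) = qv (i x).
  rewrite /qv rmorphD /= map_polyXn rmorphB rmorphM /= map_polyX !map_polyC /=.
  by rewrite !zevi.
exists L3, phi; apply: (@tower_roots _ _ (i3 (i2 w)) (i3 v) eps).
- rewrite /phi !map_poly_comp !fmorph_root //.
- by move/(rmorph_root i3): rv; rewrite !map_qv.
- rewrite epsE rmorphM /=; congr (_ * _).
  by rewrite /quad_ev fmorph_div rmorphXn rmorphD rmorphM !zevi.
Qed.

End TowerExistence.

(** * The Fricke arrows of degree 5, 7 and 13 *)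

Lemma velu_check5 : velu_check modular_data5. Proof. by vm_compute. Qed.
Lemma chain_check5 : chain_check modular_data5. Proof. by vm_compute. Qed.
Lemma velu_check7 : velu_check modular_data7. Proof. by vm_compute. Qed.
Lemma chain_check7 : chain_check modular_data7. Proof. by vm_compute. Qed.
Lemma velu_check13 : velu_check modular_data13. Proof. by vm_compute. Qed.
Lemma chain_check13 : chain_check modular_data13. Proof. by vm_compute. Qed.

Section PrimeDegree.
Variables (F : fieldType) (s u : F).
Hypotheses (n2 : 2 != 0 :> F) (n3 : 3 != 0 :> F) (u0 : u != 0) (s0 : s != 0).

Definition fricke_isogeny p := let: (A, B) := family_coefs p 1 in
  let: (A2, B2) := family_coefs p 2 in
  4 * peval s A ^+ 3 + 27 * peval s B ^+ 2 != 0 ->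
  cyclic_isogeny_of_degree (short_wcurve (u ^+ 2 * peval s A) (u ^+ 3 * peval s B))
    (short_wcurve (u ^+ 2 * peval s A2) (u ^+ 3 * peval s B2)) p /\
  exists h' U' V' D', isogeny_data (u ^+ 2 * peval s A) (u ^+ 3 * peval s B)
    (u ^+ 2 * peval s A2) (u ^+ 3 * peval s B2) h' U' V' D'.

Let natr_neq0 (L : fieldType) (phi : {rmorphism F -> L}) k : k%:R != 0 :> F -> k%:R != 0 :> L.
Proof. by rewrite -(rmorph_nat phi) fmorph_eq0. Qed.

Lemma zev_intr (L : fieldType) z l :
  zev (intr_of_Z L z) l = intr_of_Z L (foldr (fun c r => Z.add c (Z.mul z r)) Z0 l).
Proof. by elim: l => //= c l IH; rewrite intr_of_ZD intr_of_ZM -IH. Qed.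

Let zev_unit (L : fieldType) z l :
  foldr (fun c r => Z.add c (Z.mul z r)) Z0 l \in [:: Z.one; Z.opp Z.one] ->
  zev (intr_of_Z L z) l <> 0.
Proof.
rewrite zev_intr !inE => /orP[] /eqP ->; apply/eqP; rewrite /= ?oppr_eq0; exact: oner_neq0.
Qed.

(* In each case the numerator of the parameter vanishes only where w is 0, 1 or
   -1, and its denominator is 1 or -1 there. *)
Lemma fricke_isogeny5 : 5 != 0 :> F -> fricke_isogeny 5.
Proof.
move=> n5 disc0.
pose M := coefs (md_M modular_data5); pose Tn := coefs (5 * 5 * 5 * PVar)%pexp.
have coTM (L : fieldType) (phi : {rmorphism F -> L}) (w : L) :
    zev w M = 0 -> zev w Tn <> 0.
  have := natr_neq0 phi n5; rewrite -[zev w Tn]peval_coefs /= => m5 M0 /eqP.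
  rewrite !mulf_eq0 !(negPf m5) /= => /eqP w0; move: M0; rewrite w0.
  exact: (@zev_unit L Z0 M isT).
have kap0 (L : fieldType) (phi : {rmorphism F -> L}) (w v : L) :
    zev w M != 0 ->
    v ^+ 2 = zev w (coefs (md_K modular_data5)) - zev w (coefs (md_H modular_data5)) * v ->
    zev w Tn != 0 ->
    quad_ev M w v (md_kap modular_data5) != 0.
  by move=> _ _ _; rewrite /quad_ev /zev /= !mulr0 !addr0 mul0r addr0 divr1 oner_eq0.
apply: (@modular_isogeny modular_data5 F s u n2 n3 u0 disc0 isT isT n5 velu_check5 chain_check5).
  move=> L phi.
  exact: (@tower_in_closed modular_data5 Tn F s u (erefl _) isT isT (erefl _) s0 coTM kap0).
exact: (@tower_in_extension modular_data5 Tn F s u (erefl _) isT isT (erefl _) s0 coTM kap0).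
Qed.

Lemma fricke_isogeny7 : 7 != 0 :> F -> fricke_isogeny 7.
Proof.
move=> n7 disc0.
pose M := coefs (md_M modular_data7); pose Tn := coefs (7 * 7 * PVar * (PVar - 1))%pexp.
have coTM (L : fieldType) (phi : {rmorphism F -> L}) (w : L) :
    zev w M = 0 ->
    zev w Tn <> 0.
  have := natr_neq0 phi n7; rewrite -[zev w Tn]peval_coefs /= => m7 M0 /eqP.
  rewrite !mulf_eq0 !(negPf m7) subr_eq0 /= => /orP[] /eqP w0; move: M0; rewrite w0.
    exact: (@zev_unit L Z0 M isT).
  exact: (@zev_unit L Z.one M isT).
have kap0 (L : fieldType) (phi : {rmorphism F -> L}) (w v : L) :
    zev w M != 0 ->
    v ^+ 2 = zev w (coefs (md_K modular_data7)) - zev w (coefs (md_H modular_data7)) * v ->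
    zev w Tn != 0 ->
    quad_ev M w v (md_kap modular_data7) != 0.
  by move=> _ _ _; rewrite /quad_ev /zev /= !mulr0 !addr0 mul0r addr0 divr1 oner_eq0.
apply: (@modular_isogeny modular_data7 F s u n2 n3 u0 disc0 isT isT n7 velu_check7 chain_check7).
  move=> L phi; exact: (@tower_in_closed modular_data7 Tn F s u (erefl _) isT isT (erefl _) s0 coTM kap0).
exact: (@tower_in_extension modular_data7 Tn F s u (erefl _) isT isT (erefl _) s0 coTM kap0).
Qed.

Lemma fricke_isogeny13 : 13 != 0 :> F -> fricke_isogeny 13.
Proof.
move=> n13 disc0.
pose M := coefs (md_M modular_data13); pose Tn := coefs (13 * - PVar * (PVar - - 1))%pexp.
have coTM (L : fieldType) (phi : {rmorphism F -> L}) (w : L) :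
    zev w M = 0 ->
    zev w Tn <> 0.
  have := natr_neq0 phi n13; rewrite -[zev w Tn]peval_coefs /= => m13 M0 /eqP.
  rewrite !mulf_eq0 !(negPf m13) oppr_eq0 subr_eq0 /= => /orP[] /eqP w0; move: M0; rewrite w0.
    exact: (@zev_unit L Z0 M isT).
  exact: (@zev_unit L (Z.opp Z.one) M isT).
have kap0 (L : fieldType) (phi : {rmorphism F -> L}) (w v : L) :
    zev w M != 0 ->
    v ^+ 2 = zev w (coefs (md_K modular_data13)) - zev w (coefs (md_H modular_data13)) * v ->
    zev w Tn != 0 ->
    quad_ev M w v (md_kap modular_data13) != 0.
  move=> _; rewrite -!peval_coefs /= => vE.
  move=> T0.
  have -> : quad_ev M w v (md_kap modular_data13) = 1 + v.
    by rewrite /quad_ev /zev /= !mulr0 !addr0 mul1r divr1.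
  apply: contraNneq T0 => v1.
  have vN : v = - 1 by apply/eqP; rewrite -addr_eq0 addrC v1.
  (* Putting v = -1 into the equation of X_1(13) leaves w^3 + 2 w^2 + w = 0, so [kap] vanishes only
     where T does. *)
  have : w * (w + 1) ^+ 2 = 0.
    move: (vE : v ^+ 2 = w ^+ 2 + w - (w ^+ 3 + w ^+ 2 + 1) * v); rewrite vN => /eqP; rewrite eq_sym -subr_eq0 => /eqP <-; ring.
  move/eqP; rewrite mulf_eq0 expf_eq0 /= addr_eq0 => /orP[/eqP -> | /eqP ->].
    by rewrite oppr0 mulr0 mul0r.
  by rewrite subrr mulr0.
apply: (@modular_isogeny modular_data13 F s u n2 n3 u0 disc0 isT isT n13 velu_check13 chain_check13).
  move=> L phi; exact: (@tower_in_closed modular_data13 Tn F s u (erefl _) isT isT (erefl _) s0 coTM kap0).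
exact: (@tower_in_extension modular_data13 Tn F s u (erefl _) isT isT (erefl _) s0 coTM kap0).
Qed.

End PrimeDegree.

(* How an arrow between two curves of a family is certified: by the abscissa a of
   the kernel and the scaling factor m of the codomain for degree 2, by 3 a for
   degree 3, by the parameter s = N / M and the twist U / M that identify
   the arrow with one of level 5, or as the arrow of prime level n itself. *)
Inductive arrow :=
| TwoArrow of pexp & Z
| ThreeArrow of pexp
| FiveArrow of pexp & pexp & pexp
| FrickeArrow.

(** * Certificates for the arrows, and their verification *)

Section ArrowData.
Local Notation t := PVar.

(** At levels 4, 8, 12 and 16 the list also contains the reverse of an arrow pointing into vertex 1,
    with scaling factor 2, so that every vertex can be reached from vertex 1. *)
Definition arrow_data (n : nat) : seq (nat * nat * arrow) :=
  match n with
  | 2 => [:: (1, 2, TwoArrow (6*t + 384)%pexp Z.one)]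
  | 3 => [:: (1, 2, ThreeArrow (9*t^2 + 486*t + 6561)%pexp)]
  | 4 => [:: (1, 2, TwoArrow (-24*t - 192)%pexp Z.one);
      (1, 3, TwoArrow (12*t - 192)%pexp Z.one);
      (4, 1, TwoArrow (-6*t - 192)%pexp Z.one);
      (1, 4, TwoArrow (12*t + 384)%pexp (Zpos 2))]
  | 5 => [:: (1, 2, FrickeArrow)]
  | 6 => [:: (1, 2, TwoArrow (2*t^2 + 72*t + 432)%pexp Z.one);
      (1, 3, ThreeArrow (9*t^2 + 216*t + 1296)%pexp);
      (3, 4, TwoArrow (18*t^2 + 216*t + 432)%pexp Z.one);
      (2, 4, ThreeArrow (36*t^2 + 432*t + 1296)%pexp)]
  | 7 => [:: (1, 2, FrickeArrow)]
  | 8 => [:: (1, 2, TwoArrow (-12*t^2 + 288*t - 192)%pexp Z.one);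
      (3, 1, TwoArrow (6*t^2 + 144*t + 96)%pexp Z.one);
      (1, 4, TwoArrow (24*t^2 + 384)%pexp Z.one);
      (4, 5, TwoArrow (-48*t^2 + 1536)%pexp Z.one);
      (4, 6, TwoArrow (96*t^2 - 768)%pexp Z.one);
      (1, 3, TwoArrow (-12*t^2 - 288*t - 192)%pexp (Zpos 2))]
  | 9 => [:: (1, 2, ThreeArrow (9*t^2 + 108*t + 324)%pexp);
      (2, 3, ThreeArrow (81*t^2)%pexp)]
  | 10 => [:: (1, 2, TwoArrow (6*t^4 + 132*t^3 + 528*t - 96)%pexp Z.one);
      (3, 4, TwoArrow (150*t^4 - 300*t^3 - 1200*t - 2400)%pexp Z.one);
      (1, 3, FiveArrow (t^2*(t^2 + 4*t + 8))%pexp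
       ((t - 4)^2*(t + 1)*(t^2 + 4*t + 8))%pexp (t^6)%pexp);
      (2, 4, FiveArrow (t*(t^2 - 2*t + 2))%pexp
       ((t - 4)*(t + 1)^2*(t^2 - 2*t + 2))%pexp (4*t^3)%pexp)]
  | 12 => [:: (1, 2, ThreeArrow (36*t^4 + 216*t^2 + 324)%pexp);
      (8, 2, TwoArrow (72*t^4 - 432*t^2 - 1728*t - 216)%pexp (Zpos 2));
      (7, 8, ThreeArrow (36*t^4 - 432*t^3 + 1080*t^2 + 1296*t + 324)%pexp);
      (1, 7, TwoArrow (-4*t^4 + 96*t^3 - 72*t^2 + 108)%pexp Z.one);
      (5, 1, TwoArrow (2*t^4 + 48*t^3 + 36*t^2 - 54)%pexp Z.one);
      (5, 6, ThreeArrow (9*t^4 + 108*t^3 + 270*t^2 - 324*t + 81)%pexp);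
      (6, 2, TwoArrow (18*t^4 - 108*t^2 + 432*t - 54)%pexp Z.one);
      (2, 4, TwoArrow (72*t^4 - 432*t^2 - 216)%pexp Z.one);
      (3, 4, ThreeArrow (144*t^4 - 864*t^2 + 1296)%pexp);
      (1, 3, TwoArrow (8*t^4 + 144*t^2 - 216)%pexp Z.one);
      (1, 5, TwoArrow (-4*t^4 - 96*t^3 - 72*t^2 + 108)%pexp (Zpos 2))]
  | 13 => [:: (1, 2, FrickeArrow)]
  | 16 => [:: (1, 3, TwoArrow (-12*t^4 + 288*t^3 - 288*t^2 + 1152*t - 192)%pexp Z.one);
      (2, 1, TwoArrow (6*t^4 + 144*t^3 + 144*t^2 + 576*t + 96)%pexp Z.one);
      (1, 4, TwoArrow (24*t^4 + 576*t^2 + 384)%pexp Z.one);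
      (4, 5, TwoArrow (-48*t^4 + 1152*t^2 - 768)%pexp Z.one);
      (4, 6, TwoArrow (96*t^4 + 1536)%pexp Z.one);
      (6, 7, TwoArrow (-192*t^4 + 6144)%pexp Z.one);
      (6, 8, TwoArrow (384*t^4 - 3072)%pexp Z.one);
      (1, 2, TwoArrow (-12*t^4 - 288*t^3 - 288*t^2 - 1152*t - 192)%pexp (Zpos 2))]
  | 18 => [:: (1, 3, ThreeArrow (9*t^6 + 108*t^5 + 324*t^4 + 72*t^3 + 432*t^2 + 144)%pexp);
      (1, 2, TwoArrow (2*t^6 + 48*t^5 + 48*t^4 + 184*t^3 - 96*t^2 + 192*t - 16)%pexp Z.one);
      (2, 4, ThreeArrow (36*t^6 + 432*t^4 - 144*t^3 + 1296*t^2 - 864*t + 144)%pexp);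
      (3, 4, TwoArrow (18*t^6 + 360*t^3 - 144)%pexp Z.one);
      (3, 5, ThreeArrow (81*t^6 + 648*t^3 + 1296)%pexp);
      (5, 6, TwoArrow (162*t^6 - 648*t^3 - 1296)%pexp Z.one);
      (4, 6, ThreeArrow (324*t^6 - 1296*t^3 + 1296)%pexp)]
  | 25 => [:: (1, 2, FiveArrow ((t^4 + t^3 + 6*t^2 + 6*t + 11)*(t^4 + 6*t^3 + 21*t^2 + 36*t +
    61))%pexp
       ((t - 1)^5*(t^4 + 6*t^3 + 21*t^2 + 36*t + 61))%pexp ((t^4 + t^3 + 6*t^2 + 6*t +
         11)^3)%pexp);
      (2, 3, FiveArrow (t^4 + 3*t^2 + 1)%pexp
       ((t^5 + 5*t^3 + 5*t - 11)*(t^4 + 3*t^2 + 1))%pexp (25)%pexp)]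
  | _ => [::]
  end%N.

End ArrowData.

Definition arrow_degree n (c : arrow) : nat :=
  match c with TwoArrow _ _ => 2 | ThreeArrow _ => 3 | FiveArrow _ _ _ => 5 | FrickeArrow => n end.

(** Removes the powers of p from z. Insufficient fuel, or z = 0, only makes the test [smooth]
    fail. *)
Fixpoint strip fuel (p z : Z) : Z :=
  if fuel is m.+1 then
    let: (q, r) := Z.div_eucl z p in if Z.eqb r Z0 then strip m p q else z
  else z.

Definition level_primes n : seq Z :=
  [seq p <- map Z.of_nat [:: 2; 3; 5; 7; 13] | Z.eqb (Z.rem (Z.of_nat (6 * n)) p) Z0].

(* z is, up to sign, a product of primes that divide 6 n. *)
Definition smooth n (z : Z) := Z.eqb (Z.abs (foldr (strip 200) z (level_primes n))) Z.one.
(** A sufficient criterion: one coefficient that is a unit in every admissible K keeps the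
    polynomial nonzero there. *)
Definition nonvanishing n (e : pexp) := has (smooth n) (coefs e).

(** For degree 3 the certificate is three times the abscissa, so the division polynomial and Velu's
    formulas appear multiplied by powers of 3. For [FiveArrow], both curves are matched with those
    of level 5 at s = N/M, twisted by U/M. *)
Definition arrow_check n k l (c : arrow) :=
  let: (A, B) := family_coefs n k in let: (A2, B2) := family_coefs n l in
  match c with
  | TwoArrow a m => let T := (3 * a ^ 2 + A)%pexp in
    [&& zis0 (coefs (a ^ 3 + A * a + B)%pexp),
        zis0 (coefs (A - 5 * T - PCst m ^ 4 * A2)%pexp),
        zis0 (coefs (B - 7 * (a * T) - PCst m ^ 6 * B2)%pexp)
      & nonvanishing n (PCst m)]
  | ThreeArrow a => let T := (2 * a ^ 2 + 6 * A)%pexp in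
    [&& zis0 (coefs (a ^ 4 + 18 * A * a ^ 2 + 108 * B * a - 27 * A ^ 2)%pexp),
        zis0 (coefs (3 * A2 - 3 * A + 5 * T)%pexp)
      & zis0 (coefs (27 * B2 - 27 * B + 7 * (4 * (a ^ 3 + 9 * A * a + 27 * B) + 3 * a * T))%pexp)]
  | FiveArrow M N U =>
    let: (A5, B5) := family_coefs 5 1 in let: (A52, B52) := family_coefs 5 2 in
    let m := coefs M in let s := (coefs N, [::], 1%N) in let u := (coefs U, [::], 1%N) in
    let sub e := quad_subst [::] [::] m s e in
    let mul := quad_mul [::] [::] in let u2 := mul u u in let u3 := mul u u2 in
    let emb e : quad := (coefs e, [::], 0%N) in
    [&& nonvanishing n M, nonvanishing n N, nonvanishing n U, nonvanishing n (PCst 5)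
      & [&& quad_eq m (mul u2 (sub A5)) (emb A), quad_eq m (mul u3 (sub B5)) (emb B),
            quad_eq m (mul u2 (sub A52)) (emb A2) & quad_eq m (mul u3 (sub B52)) (emb B2)]]
  | FrickeArrow => [&& k == 1%N, l == 2, n \in [:: 5; 7; 13]%N & nonvanishing n (PCst (Z.of_nat n))]
  end.

Definition disc_exp n k := let: (A, B) := family_coefs n k in (4 * A ^ 3 + 27 * B ^ 2)%pexp.

Section Arrows.
Variables (F : fieldType) (n : nat) (t d : F).
Hypothesis nz : forall e, nonvanishing n e -> peval t e != 0.
Hypotheses (n2 : 2 != 0 :> F) (n3 : 3 != 0 :> F) (t0 : t != 0) (d0 : d != 0).

Let curveA k := d ^+ 2 * peval t (family_coefs n k).1.
Let curveB k := d ^+ 3 * peval t (family_coefs n k).2.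

Definition linked k l := exists h U V D, isogeny_data (curveA k) (curveB k) (curveA l) (curveB l) h U V D.

Lemma two_arrow k l a m : nonvanishing n (disc_exp n k) -> arrow_check n k l (TwoArrow a m) ->
  cyclic_isogeny_of_degree (short_wcurve (curveA k) (curveB k)) (short_wcurve (curveA l) (curveB l)) 2
  /\ linked k l.
Proof.
rewrite /linked /curveA /curveB /disc_exp /arrow_check.
case: (family_coefs n k) (family_coefs n l) => [A B] [A2 B2]; cbv beta iota zeta => /nz disc0.
case/and4P=> /(peval_eq0 t) fa /(peval_eq0 t) hA /(peval_eq0 t) hB /nz m0.
move: disc0 fa hA hB m0 => /=; move: (peval t A) (peval t B) (peval t A2) (peval t B2) (peval t a).
move: (intr_of_Z F m) => {A B A2 B2 a}m A B A2 B2 a disc0 fa hA hB m0.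
(* This is the derivative of the cubic at its root d a, which is simple because the discriminant
   does not vanish. *)
have T0 : 3 * (d * a) ^+ 2 + d ^+ 2 * A != 0.
  rewrite (_ : _ + _ = d ^+ 2 * (3 * a ^+ 2 + A)); last by ring.
  rewrite mulf_neq0 ?expf_neq0 //; apply: contraNneq disc0 => T0.
  have AE : A = - (3 * a ^+ 2) by apply/eqP; rewrite -addr_eq0 addrC T0.
  have BE : B = 2 * a ^+ 3.
    by apply/eqP; rewrite -subr_eq0 -[X in _ == X]fa AE; apply/eqP; ring.
  by rewrite AE BE; apply/eqP; change (4 * (- (3 * a ^+ 2)) ^+ 3 + 27 * (2 * a ^+ 3) ^+ 2 = 0); ring.
have f0 : (d * a) ^+ 3 + d ^+ 2 * A * (d * a) + d ^+ 3 * B = 0.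
  by transitivity (d ^+ 3 * (a ^+ 3 + A * a + B)); [ring | rewrite fa mulr0].
have hA2 : d ^+ 2 * A - 5 * (3 * (d * a) ^+ 2 + d ^+ 2 * A) = m ^+ 4 * (d ^+ 2 * A2).
  apply/eqP; rewrite -subr_eq0; apply/eqP.
  transitivity (d ^+ 2 * (A - 5 * (3 * a ^+ 2 + A) - m ^+ 4 * A2)); first by ring.
  by rewrite [X in _ * X]hA mulr0.
have hB2 : d ^+ 3 * B - 7 * (d * a * (3 * (d * a) ^+ 2 + d ^+ 2 * A)) = m ^+ 6 * (d ^+ 3 * B2).
  apply/eqP; rewrite -subr_eq0; apply/eqP.
  transitivity (d ^+ 3 * (B - 7 * (a * (3 * a ^+ 2 + A)) - m ^+ 6 * B2)); first by ring.
  by rewrite [X in _ * X]hB mulr0.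
split; first exact: (cyclic_2isogeny m0 T0 f0 hA2 hB2).
have dat := two_isogeny_data m0 f0 hA2 hB2.
by do 4!eexists; exact: dat.
Qed.

Lemma three_arrow k l a : nonvanishing n (disc_exp n k) -> arrow_check n k l (ThreeArrow a) ->
  cyclic_isogeny_of_degree (short_wcurve (curveA k) (curveB k)) (short_wcurve (curveA l) (curveB l)) 3
  /\ linked k l.
Proof.
rewrite /linked /curveA /curveB /disc_exp /arrow_check.
case: (family_coefs n k) (family_coefs n l) => [A B] [A2 B2]; cbv beta iota zeta => /nz disc0.
case/and3P=> /(peval_eq0 t) fa /(peval_eq0 t) hA /(peval_eq0 t) hB.
move: disc0 fa hA hB => /=; move: (peval t A) (peval t B) (peval t A2) (peval t B2) (peval t a).
move=> {A B A2 B2 a} A B A2 B2 a disc0 fa hA hB.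
have [b aE] : exists b, a = 3 * b by exists (a / 3); field.
have n33 j : 3 ^+ j != 0 :> F by rewrite expf_neq0.
apply: (@cyclic_3isogeny F _ _ _ _ (d * b) n2 n3).
- rewrite (_ : _ + _ = d ^+ 6 * (4 * A ^+ 3 + 27 * B ^+ 2)) ?mulf_neq0 ?expf_neq0 //; ring.
- apply: (mulfI (n33 3%N)); rewrite mulr0.
  transitivity (d ^+ 4 * (a ^+ 4 + 18 * A * a ^+ 2 + 108 * B * a - 27 * A ^+ 2)).
    by rewrite aE; ring.
  by rewrite [X in _ * X]fa mulr0.
- apply: (mulfI n3); apply/eqP; rewrite -subr_eq0; apply/eqP.
  transitivity (d ^+ 2 * (3 * A2 - 3 * A + 5 * (2 * a ^+ 2 + 6 * A))); first by rewrite aE; ring.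
  by rewrite [X in _ * X]hA mulr0.
- apply: (mulfI (n33 3%N)); apply/eqP; rewrite -subr_eq0; apply/eqP.
  transitivity (d ^+ 3 * (27 * B2 - 27 * B + 7 * (4 * (a ^+ 3 + 9 * A * a + 27 * B)
     + 3 * a * (2 * a ^+ 2 + 6 * A)))); first by rewrite aE; ring.
  by rewrite [X in _ * X]hB mulr0.
Qed.

Lemma five_arrow k l M N U : nonvanishing n (disc_exp n k) ->
  arrow_check n k l (FiveArrow M N U) ->
  cyclic_isogeny_of_degree (short_wcurve (curveA k) (curveB k)) (short_wcurve (curveA l) (curveB l)) 5
  /\ linked k l.
Proof.
rewrite /linked /curveA /curveB /disc_exp /arrow_check.
case: (family_coefs n k) (family_coefs n l) => [A B] [A2 B2]; cbv beta iota zeta => /nz disc0.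
case/and5P=> /nz M0 /nz N0 /nz U0 /nz n5 /and4P[].
have M0' : zev t (coefs M) != 0 by rewrite -peval_coefs.
(* With v = 0 and H = K = 0, the quadratic arithmetic becomes that of fractions whose denominators
   are powers of M. *)
have v0 : (0 : F) ^+ 2 = zev t [::] - zev t [::] * 0 by rewrite mulr0 subr0 expr0n.
pose ev := quad_ev (coefs M) t 0.
have evE q1 q2 : quad_eq (coefs M) q1 q2 -> ev q1 = ev q2 by apply: quad_evE.
have evM q1 q2 : ev (quad_mul [::] [::] q1 q2) = ev q1 * ev q2 by apply: quad_evM.
have evs q e : ev (quad_subst [::] [::] (coefs M) q e) = peval (ev q) e by apply: quad_ev_subst.
have evfrac e : ev (coefs e, [::], 1%N) = peval t e / peval t M.
  by rewrite /ev /quad_ev /= mulr0 addr0 -!peval_coefs.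
have evint e : ev (coefs e, [::], 0%N) = peval t e.
  by rewrite /ev /quad_ev /= mulr0 addr0 divr1 -peval_coefs.
move=> /evE eA /evE eB /evE eA2 /evE eB2.
rewrite !(evM, evs, evfrac, evint) in eA eB eA2 eB2.
set s := peval t N / peval t M in eA eB eA2 eB2; set u := peval t U / peval t M in eA eB eA2 eB2.
have s0 : s != 0 by rewrite mulf_neq0 ?invr_eq0.
have u0 : u != 0 by rewrite mulf_neq0 ?invr_eq0.
(* The twist by d of the given family and the twist by u of the level 5 curve combine into a twist
   by d u. *)
have := @fricke_isogeny5 F s (d * u) n2 n3 (mulf_neq0 d0 u0) s0 n5.
rewrite /fricke_isogeny; move: eA eB eA2 eB2; rewrite [family_coefs 5 1]surjective_pairing.
rewrite [family_coefs 5 2]surjective_pairing.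
move: (peval s _) (peval s _) (peval s _) (peval s _) => b2 a2 b a eA eB eA2 eB2.
have E2 x y : u * u * x = y -> (d * u) ^+ 2 * x = d ^+ 2 * y by move=> <-; ring.
have E3 x y : u * (u * u) * x = y -> (d * u) ^+ 3 * x = d ^+ 3 * y by move=> <-; ring.
rewrite (E2 _ _ eA) (E3 _ _ eB) (E2 _ _ eA2) (E3 _ _ eB2); apply.
apply: contraNneq disc0 => dab.
rewrite /= -eA -eB; apply/eqP.
change (4 * (u * u * a) ^+ 3 + 27 * (u * (u * u) * b) ^+ 2 = 0).
by transitivity (u ^+ 6 * (4 * a ^+ 3 + 27 * b ^+ 2)); [ring | rewrite dab mulr0].
Qed.

Lemma arrow_isogeny k l c : nonvanishing n (disc_exp n k) -> arrow_check n k l c ->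
  cyclic_isogeny_of_degree (short_wcurve (curveA k) (curveB k)) (short_wcurve (curveA l) (curveB l))
    (arrow_degree n c)
  /\ linked k l.
Proof.
case: c => [a m|a|M S U|]; [exact: two_arrow | exact: three_arrow | exact: five_arrow |].
rewrite /linked /curveA /curveB /disc_exp /arrow_check => dsc.
case E: (family_coefs n k) => [A B]; case E2: (family_coefs n l) => [A2 B2].
case/and4P=> /eqP k1 /eqP l2; rewrite {}k1 in E dsc *; rewrite {}l2 in E2 *.
rewrite E in dsc; move: dsc => /nz disc0 n_in /nz p0.
have [nE|[nE|nE]] : n = 5%N \/ n = 7%N \/ n = 13%N.
- by move: n_in; rewrite !inE => /or3P[] /eqP ->; auto.
- have n5 : 5 != 0 :> F by move: p0; rewrite nE.
  have := @fricke_isogeny5 F t d n2 n3 d0 t0 n5.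
  by move: E E2; rewrite /fricke_isogeny nE => -> ->; apply.
- have n7 : 7 != 0 :> F by move: p0; rewrite nE.
  have := @fricke_isogeny7 F t d n2 n3 d0 t0 n7.
  by move: E E2; rewrite /fricke_isogeny nE => -> ->; apply.
- have n13 : 13 != 0 :> F by move: p0; rewrite nE.
  have := @fricke_isogeny13 F t d n2 n3 d0 t0 n13.
  by move: E E2; rewrite /fricke_isogeny nE => -> ->; apply.
Qed.

End Arrows.

(** * The checks for a level and what they imply *)

Definition step n (R : seq nat) : seq nat :=
  R ++ [seq x.1.2 | x <- arrow_data n & x.1.1 \in R].

(** j = c4^3/disc with c4 = -48 A and disc = -16 (4 A^3 + 27 B^2), cross-multiplied. *)
Definition invariant_check n i k :=
  let: (A, B) := family_coefs n k in let: (num, den) := fricke_j n i in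
  zis0 (coefs ((-48 * A) ^ 3 * den - num * (-16 * (4 * A ^ 3 + 27 * B ^ 2)))%pexp)
  && nonvanishing n den.

(** Invariance of the ratio A^3 : B^2 under isomorphism is what is tested, so the curves differ even
    up to twist. *)
Definition distinct_check n k l :=
  let: (A, B) := family_coefs n k in let: (A2, B2) := family_coefs n l in
  nonvanishing n (A ^ 3 * B2 ^ 2 - A2 ^ 3 * B ^ 2)%pexp.

Definition level_check n :=
  let vertices := iota 1 (family_size n) in
  [&& all (fun k => nonvanishing n (disc_exp n k)) vertices,
      all (fun k => all (fun l => (k < l)%N ==> distinct_check n k l) vertices) vertices,
      all (fun x => (x.1.1 \in vertices) && arrow_check n x.1.1 x.1.2 x.2) (arrow_data n),
      all (fun a => has (fun x => (a.1.1, a.2, a.1.2) == (x.1, arrow_degree n x.2)) (arrow_data n))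
        (isogeny_graph n)
    & [&& all (mem (iter 4 (step n) [:: 1%N])) vertices,
          invariant_check n 1 (fricke_indices n).1, invariant_check n 2 (fricke_indices n).2,
          ((fricke_indices n).1 \in vertices) && ((fricke_indices n).2 \in vertices)
        & nonvanishing n (PCst 2) && nonvanishing n (PCst 3)]].

(** Between short equations, invertibility of 2 and 3 forces r = s = w = 0, leaving only the scaling
    by u. *)
Lemma isomorphic_short (F : fieldType) (A B A2 B2 : F) : 2 != 0 :> F -> 3 != 0 :> F ->
  isomorphic (short_wcurve A B) (short_wcurve A2 B2) -> A ^+ 3 * B2 ^+ 2 = A2 ^+ 3 * B ^+ 2.
Proof.
move=> n2 n3 [u [r [s [w [u0 [/= h1 h2 h3 h4 h6]]]]]].
have s0 : s = 0 by apply: (mulfI n2); rewrite mulr0 -[LHS]add0r -h1 mulr0.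
have r0 : r = 0.
  by apply: (mulfI n3); transitivity (u ^+ 2 * 0); [rewrite h2 s0; ring | ring].
have w0 : w = 0.
  by apply: (mulfI n2); transitivity (u ^+ 3 * 0); [rewrite h3; ring | ring].
have eA : u ^+ 4 * A2 = A by rewrite h4 s0 r0 w0; ring.
have eB : u ^+ 6 * B2 = B by rewrite h6 r0 w0; ring.
apply: (mulfI (expf_neq0 12 u0)).
transitivity (A ^+ 3 * (u ^+ 6 * B2) ^+ 2); first by ring.
by rewrite eB -[in LHS]eA; ring.
Qed.

Lemma has_all (T : Type) (p q : pred T) s : has p s -> all q s -> exists2 x, p x & q x.
Proof.
elim: s => //= x s IH /orP[px|/IH h] /andP[qx sq]; [by exists x | exact: h].
Qed.

Lemma mem_map_filter (T : Type) (S : eqType) (f : T -> S) (p : pred T) s y :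
  (y \in [seq f x | x <- s & p x]) = has (fun x => p x && (f x == y)) s.
Proof. by elim: s => //= x s <-; case: (p x) => //=; rewrite inE eq_sym. Qed.

Section Level.
Variables (F : fieldType) (n : nat) (t d : F).
Hypothesis nz : forall e, nonvanishing n e -> peval t e != 0.
Hypotheses (t0 : t != 0) (d0 : d != 0) (chk : level_check n).

Let C i := isogeny_family n i t d.
Let vertex i := (1 <= i <= family_size n)%N.

Let C_short k : C k
  = short_wcurve (d ^+ 2 * peval t (family_coefs n k).1) (d ^+ 3 * peval t (family_coefs n k).2).
Proof. by rewrite /C /isogeny_family; case: (family_coefs n k). Qed.

Let vertices := iota 1 (family_size n).
Let mem_vertices i : (i \in vertices) = vertex i.
Proof. by rewrite mem_iota add1n ltnS. Qed.

Let n2 : 2 != 0 :> F.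
Proof. by case/and5P: chk => _ _ _ _ /and5P[_ _ _ _ /andP[/nz]]. Qed.
Let n3 : 3 != 0 :> F.
Proof. by case/and5P: chk => _ _ _ _ /and5P[_ _ _ _ /andP[_ /nz]]. Qed.
Let disc_vertex i : vertex i -> nonvanishing n (disc_exp n i).
Proof. by rewrite -mem_vertices; case/and5P: chk => /allP h _ _ _ _; exact: h. Qed.

Let wdisc_short (A B : F) :
  wdisc (short_wcurve (d ^+ 2 * A) (d ^+ 3 * B)) = - (16 * d ^+ 6 * (4 * A ^+ 3 + 27 * B ^+ 2)).
Proof. by rewrite /wdisc /wb2 /wb4 /wb6 /wb8 /=; ring. Qed.

Let n16 : 16 != 0 :> F.
Proof. by rewrite (_ : 16 = 2 * 2 * (2 * 2)) ?mulf_neq0 //; ring. Qed.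

Lemma level_elliptic i : vertex i -> elliptic (C i).
Proof.
move=> /disc_vertex; rewrite C_short /elliptic wdisc_short /disc_exp.
case: (family_coefs n i) => A B /nz disc0.
by rewrite oppr_eq0 !mulf_neq0 ?expf_neq0.
Qed.

Lemma level_invariant i k : vertex k -> invariant_check n i k -> j_invariant (C k) = fricke n i t.
Proof.
move=> /disc_vertex; rewrite C_short /disc_exp /invariant_check /fricke /j_invariant wdisc_short.
case: (family_coefs n k) (fricke_j n i) => [A B] [N D]; cbv beta iota => /nz disc0.
case/andP=> /(peval_eq0 t) eq /nz D0.
have -> : wc4 (short_wcurve (d ^+ 2 * peval t A) (d ^+ 3 * peval t B)) = d ^+ 2 * (- 48 * peval t A).
  by rewrite /wc4 /wb2 /wb4 /=; ring.
move: disc0 eq D0 => /=; move: (peval t A) (peval t B) (peval t N) (peval t D).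
move=> {A B N D} A B N D disc0 /eqP; rewrite subr_eq0 => /eqP eq D0.
have disc0' : 4 * A ^+ 3 + 27 * B ^+ 2 != 0 by [].
apply/eqP; rewrite eqr_div ?oppr_eq0 ?mulf_neq0 ?expf_neq0 //; apply/eqP.
transitivity (d ^+ 6 * ((- 48 * A) ^+ 3 * D)); first by ring.
rewrite [X in _ * X]eq.
by change (d ^+ 6 * (N * (- 16 * (4 * A ^+ 3 + 27 * B ^+ 2)))
  = N * - (16 * d ^+ 6 * (4 * A ^+ 3 + 27 * B ^+ 2))); ring.
Qed.

Lemma level_distinct i j : vertex i -> vertex j -> i <> j -> ~ isomorphic (C i) (C j).
Proof.
move=> vi vj /eqP; rewrite neq_ltn => ne iso.
move: iso; rewrite !C_short => /(isomorphic_short n2 n3).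
have dist k l : vertex k -> vertex l -> (k < l)%N -> distinct_check n k l.
  rewrite -!mem_vertices => vk vl; case/and5P: chk => _ /allP/(_ k vk)/allP/(_ l vl) /implyP h _ _ _.
  exact: h.
have key k l : distinct_check n k l ->
    (d ^+ 2 * peval t (family_coefs n k).1) ^+ 3 * (d ^+ 3 * peval t (family_coefs n l).2) ^+ 2
    <> (d ^+ 2 * peval t (family_coefs n l).1) ^+ 3 * (d ^+ 3 * peval t (family_coefs n k).2) ^+ 2.
  rewrite /distinct_check; case: (family_coefs n k) (family_coefs n l) => [A B] [A2 B2]; cbv beta iota.
  move/nz => /=; move: (peval t A) (peval t B) (peval t A2) (peval t B2) => {A B A2 B2} A B A2 B2.
  move=> /negP x0 e; apply: x0; apply/eqP; apply: (mulfI (expf_neq0 12 d0)); rewrite mulr0.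
  by move/eqP: e; rewrite -subr_eq0 => /eqP <-; ring.
case/orP: ne => lt_ij e.
  exact: key (dist _ _ vi vj lt_ij) e.
exact: key (dist _ _ vj vi lt_ij) (esym e).
Qed.

Lemma level_isogenous i : vertex i -> isogenous (C 1%N) (C i).
Proof.
have lk : all (fun x => (x.1.1 \in vertices) && arrow_check n x.1.1 x.1.2 x.2) (arrow_data n).
  by case/and5P: chk.
have reach m k : k \in iter m (step n) [:: 1%N] -> linked n t d 1 k.
  elim: m k => [|m IH] k /=.
    rewrite inE => /eqP ->; exists 0%N, 'X, 1, 1; split; rewrite ?size_polyX ?size_poly1 //.
    by rewrite /cubic -!mul_polyC; ring.
  rewrite mem_cat => /orP[/IH // |]; rewrite mem_map_filter => /has_all/(_ lk).
  case=> -[[k0 l0] c] /= /andP[/IH l1 /eqP <-]; rewrite mem_vertices => /andP[/disc_vertex dsc].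
  case/(arrow_isogeny nz n2 n3 t0 d0 dsc) => _ [h2 [U2 [V2 [D2 dat2]]]].
  case: l1 => [h [U [V [D dat]]]].
  exact: isogeny_data_comp dat dat2.
rewrite -mem_vertices => vi; case/and5P: chk => _ _ _ _ /and5P[/allP/(_ i vi)/reach].
move=> [h [U [V [D dat]]]] _ _ _ _; rewrite !C_short.
by eexists; exact: isogeny_data_isogeny dat.
Qed.

Lemma level_arrow k p l : (k, p, l) \in isogeny_graph n -> cyclic_isogeny_of_degree (C k) (C l) p.
Proof.
case/and5P: chk => _ _ lk /allP h2 _ /h2 /has_all/(_ lk) [[[k' l'] c] /=].
move=> /eqP[-> -> ->] /andP[]; rewrite mem_vertices => /disc_vertex dsc ok; rewrite !C_short.
by case: (arrow_isogeny nz n2 n3 t0 d0 dsc ok).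
Qed.

Lemma level_theorem :
  (forall i, vertex i -> elliptic (C i)) /\
  [/\ j_invariant (C (fricke_indices n).1) = fricke n 1 t
      /\ j_invariant (C (fricke_indices n).2) = fricke n 2 t,
      forall i j, vertex i -> vertex j -> i <> j -> ~ isomorphic (C i) (C j),
      forall i, vertex i -> isogenous (C 1%N) (C i)
    & forall k p l, (k, p, l) \in isogeny_graph n -> cyclic_isogeny_of_degree (C k) (C l) p].
Proof.
split; first exact: level_elliptic.
split; [|exact: level_distinct | exact: level_isogenous | exact: level_arrow].
case/and5P: chk => _ _ _ _ /and5P[_ i1 i2 /andP[v1 v2] _]; rewrite !mem_vertices in v1 v2.
by split; apply: level_invariant.
Qed.

End Level.

Lemma level_checks : all level_check genus0_levels.
Proof. by vm_compute. Qed.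

(** * Nonvanishing in K(t, d) *)

Section FunctionFieldKtd.
Variables (K : fieldType) (n : nat).
Hypothesis n_gt0 : (0 < n)%N.
Hypothesis K_char : forall p : nat, p \in [pchar K] -> coprime p (6 * n).

Lemma level_neq0 : (6 * n)%:R != 0 :> K.
Proof.
apply/negP => n0; have [|p pK] := natf0_pchar _ n0; first by rewrite muln_gt0.
have := K_char pK; rewrite prime_coprime ?(pcharf_prime pK) // (dvdn_pcharf pK).
by rewrite n0.
Qed.

Lemma strip_neq0 fuel p z : intr_of_Z K p != 0 -> intr_of_Z K (strip fuel p z) != 0 ->
  intr_of_Z K z != 0.
Proof.
move=> p0; elim: fuel z => //= m IH z.
have := Z_div_mod_full z p; case: (Z.div_eucl z p) => q r.
case: Z.eqb_spec => [-> | _ _ //] h /IH q0.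
have {h}[-> _] : z = Z.add (Z.mul p q) Z0 /\ True.
  split=> //; apply: (proj1 (h _)) => p0'; by rewrite p0' eqxx in p0.
by rewrite intr_of_ZD intr_of_ZM addr0 mulf_neq0.
Qed.

Lemma smooth_neq0 z : smooth n z -> intr_of_Z K z != 0.
Proof.
rewrite /smooth => /Z.eqb_eq h.
have one0 : intr_of_Z K (foldr (strip 200) z (level_primes n)) != 0.
  case: (Z.abs_spec (foldr (strip 200) z (level_primes n))) => -[_ e]; rewrite e in h.
    by rewrite h; exact: oner_neq0.
  by rewrite -(Z.opp_involutive (foldr _ _ _)) h intr_of_ZN oppr_eq0; exact: oner_neq0.
have : all (fun p => Z.eqb (Z.rem (Z.of_nat (6 * n)) p) Z0) (level_primes n).
  exact: filter_all.
move: one0; elim: (level_primes n) => [one0 _ | p l IH one0 /andP[/Z.eqb_eq pn /IH]]; [exact: one0 | apply].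
(* Each prime removed divides 6n, hence is nonzero in K along with 6n. *)
apply: (@strip_neq0 200 p _ _ one0).
have : intr_of_Z K (Z.of_nat (6 * n)) != 0 by rewrite intr_of_nat level_neq0.
by rewrite (Z.quot_rem' (Z.of_nat (6 * n)) p) pn intr_of_ZD intr_of_ZM addr0 mulf_eq0 => /norP[].
Qed.

(** The value at t is the image of a polynomial of K[t] under an injective map, and that polynomial
    has a nonzero coefficient. *)
Lemma nonvanishing_Ktd e : nonvanishing n e -> peval (Ktd_t K) e != 0.
Proof.
move=> /(has_nthP Z0) [i i_lt /smooth_neq0 c0].
pose phi := (@tofrac {poly {poly K}} \o polyC : {rmorphism {poly K} -> Ktd K}).
have -> : peval (Ktd_t K) e = phi (peval 'X e) by rewrite rmorph_peval.
rewrite /phi /= tofrac_eq0 polyC_eq0 peval_coefs.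
by apply: contraNneq c0 => e0; rewrite -coef_zev e0 coef0.
Qed.

End FunctionFieldKtd.

Theorem proposition3p1 (K : fieldType) (n : nat)
    (n_genus0 : n \in genus0_levels)
    (K_char : forall p : nat, p \in [pchar K] -> coprime p (6 * n)) :
  let t := Ktd_t K in
  let d := Ktd_d K in
  let C i := isogeny_family n i t d in
  let vertex i := (1 <= i <= family_size n)%N in
  (forall i, vertex i -> elliptic (C i)) /\
  [/\ j_invariant (C (fricke_indices n).1) = fricke n 1 t
      /\ j_invariant (C (fricke_indices n).2) = fricke n 2 t,
      forall i j, vertex i -> vertex j -> i <> j -> ~ isomorphic (C i) (C j),
      forall i, vertex i -> isogenous (C 1%N) (C i)
    & forall k p l, (k, p, l) \in isogeny_graph n ->
        cyclic_isogeny_of_degree (C k) (C l) p].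
Proof.
have n_gt0 : (0 < n)%N by move: n_genus0; case: (n).
have t0 : Ktd_t K != 0.
  by rewrite /Ktd_t tofrac_eq0 polyC_eq0 -size_poly_gt0 size_polyX.
have d0 : Ktd_d K != 0 by rewrite /Ktd_d tofrac_eq0 -size_poly_gt0 size_polyX.
exact: (level_theorem (nonvanishing_Ktd n_gt0 K_char) t0 d0 (allP level_checks n n_genus0)).
Qed.
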